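(* Let $N,M\ge1$ be integers and let $\mathcal{H}$, $\mathcal{F}_j$, $\mathcal{C}$ and the functions $\pi_0,\dots,\pi_N$ be as defined in the context. The mapping $$\boldsymbol{\pi}=(\pi_0,\dots,\pi_N):\mathrm{Inv}(\mathcal{H})\to\mathrm{Inv}(\mathcal{C})$$ is a (well-defined, i.e. independent of the chosen representation of the operator) group homomorphism. Moreover, $\boldsymbol{\pi}|_{\mathcal{F}_j}=(1,\dots,\pi_j,\dots,1)$ for each $j=0,\dots,N$, i.e. on $\mathcal{F}_j$ all components of $\boldsymbol{\pi}$ other than the $j$-th are identically $1$.
   Context: For $1\le j\le N$, $\langle\cdot\rangle_j:=\int_{[0,1]^j}\cdot\;dk_1\cdots dk_j$ (applied entrywise to scalar-, vector- or matrix-valued functions of $\mathbf{k}=(k_1,\dots,k_N)\in[0,1]^N$); the result depends only on $(k_{j+1},\dots,k_N)$ and is regarded also as a function on $[0,1]^N$ that is constant in $k_1,\dots,k_j$. $\mathcal{H}$ is the smallest (not necessarily closed) subalgebra of the bounded linear operators on $L^2([0,1]^N,\mathbb{C}^M)$ containing all multiplications $\mathbf{A}\cdot$ by continuous $M\times M$ matrix-valued functions on $[0,1]^N$ and all $\langle\cdot\rangle_1,\dots,\langle\cdot\rangle_N$. It is known that $\mathcal{H}$ is exactly the set of operators of the form $$\mathcal{A}=\mathbf{A}_0\cdot+\mathbf{A}_1\langle\mathbf{B}_1\cdot\rangle_1+\dots+\mathbf{A}_N\langle\mathbf{B}_N\cdot\rangle_N,\qquad( * )$$ with continuous matrix-valued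 functions on $[0,1]^N$: $\mathbf{A}_0$ of size $M\times M$, $\mathbf{A}_j$ of size $M\times M_j$, $\mathbf{B}_j$ of size $M_j\times M$, $M_j$ positive integers; here $\mathbf{A}\langle\mathbf{B}\cdot\rangle_j$ is the operator $\mathbf{u}\mapsto\mathbf{A}\langle\mathbf{B}\mathbf{u}\rangle_j$. $\mathrm{Inv}(S)$, for a set $S$ of operators, is the set of elements of $S$ invertible as bounded operators on $L^2([0,1]^N,\mathbb{C}^M)$. $\mathcal{F}_0=\mathrm{Inv}(\{\mathbf{A}\cdot\})$ ($\mathbf{A}$ continuous $M\times M$) and $\mathcal{F}_j=\mathrm{Inv}(\{\mathcal{I}+\mathbf{A}\langle\mathbf{B}\cdot\rangle_j\})$ for $1\le j\le N$ ($\mathbf{A}$, $\mathbf{B}$ continuous of sizes $M\times M'$, $M'\times M$, $M'$ any positive integer). Definition of $\pi_j$: for $\mathcal{A}\in\mathrm{Inv}(\mathcal{H})$ written as $( * )$, set $\pi_0(\mathcal{A})=\det\mathbf{A}_0$, $\mathbf{A}_{i,0}=\mathbf{A}_0^{-1}\mathbf{A}_i$ ($1\le i\le N$), and for $j=1,\dots,N$: $\mathbf{E}_j=\mathbf{I}+\langle\mathbf{B}_j\mathbf{A}_{j,j-1}\rangle_j$, $\pi_j(\mathcal{A})=\det\mathbf{E}_j$, $\mathbf{A}_{i,j}=\mathbf{A}_{i,j-1}-\mathbf{A}_{j,j-1}\mathbf{E}_j^{-1}\langle\mathbf{B}_j\mathbf{A}_{i,j-1}\rangle_j$ ($j<i\le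 N$). For invertible $\mathcal{A}$ all $\pi_j$ are nowhere zero, so the recursion makes sense. $\mathcal{C}_j$ is the algebra of continuous functions $f:[0,1]^{N-j}\to\mathbb{C}$ for $j=0,\dots,N-1$ (of the variables $(k_{j+1},\dots,k_N)$), $\mathcal{C}_N=\mathbb{C}$, and $\mathcal{C}=\mathcal{C}_0\times\dots\times\mathcal{C}_N$ with component-wise multiplication; $\mathrm{Inv}(\mathcal{C})$ is its group of invertible elements (tuples of nowhere vanishing functions). *)

(* Defs.v *)
From HB Require Import structures.
From mathcomp Require Import all_boot all_order all_algebra generic_quotient.
From mathcomp Require Import ring_quotient complex.
From mathcomp Require Import ring.
From mathcomp Require Import all_classical all_reals all_analysis.
From mathcomp Require Import measurable_realfun.
Set Implicit Arguments.
Unset Strict Implicit.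
Unset Printing Implicit Defensive.
Import Order.TTheory GRing.Theory Num.Theory.
Import numFieldNormedType.Exports.
Import ComplexField.Normc.
Local Open Scope classical_set_scope.
Local Open Scope ring_scope.
Local Open Scope complex_scope.

Notation rtuple R n := (n.-tuple (measurableTypeR R)).

Section Cube.
Context {R : realType}.

Definition cube (n : nat) : set (rtuple R n) :=
  [set k | forall i, 0 <= (tnth k i : R) <= 1].
Arguments cube : clear implicits.

Lemma measurable_cube n : measurable (cube n).
Proof.
rewrite (_ : cube n = \bigcap_(i in [set: 'I_n]) ((fun k => tnth k i) @^-1`
    (`[0, 1]%classic : set (measurableTypeR R)))).
  apply: fin_bigcap_measurable => // i _.
  rewrite -[X in measurable X]setTI.
  by apply: measurable_tnth => //; exact: measurable_itv.
apply/seteqP; split => k /= h.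
  by move=> i _ /=; rewrite in_itv /=; exact: h.
by move=> i; have := h i I; rewrite /= in_itv.
Qed.

Definition cons_point (n : nat) (p : measurableTypeR R * rtuple R n) :
  rtuple R n.+1 := [tuple of p.1 :: p.2].

Lemma measurable_cons_point n : measurable_fun setT (@cons_point n).
Proof. exact: (measurable_cons measurable_fst measurable_snd). Qed.

HB.instance Definition _ n :=
  isMeasurableFun.Build _ _ _ _ (@cons_point n) (@measurable_cons_point n).

(* Lebesgue measure on [0,1]^n: the n-fold product of the uniform probability
   on [0,1], seen as a measure on R^n carried by the cube. *)
Fixpoint leb_cube (n : nat) : probability (rtuple R n) R :=
  match n with
  | 0 => dirac ([tuple] : rtuple R 0)
  | n'.+1 => distribution (uniform_prob (@ltr01 R) \x leb_cube n')%E
               (@cons_point n')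
  end.

(* Tuples carry no topology in the library; row vectors carry the product
   topology. *)
Definition point_of_row (n : nat) (v : 'rV[R]_n) : rtuple R n :=
  [tuple (v ord0 i : measurableTypeR R) | i < n].

Definition cube_continuous (n : nat) (Y : topologicalType)
    (f : rtuple R n -> Y) : Prop :=
  {within [set v | cube n (point_of_row v)],
    continuous (fun v => f (point_of_row v))}.

Definition continuous_mx (n p q : nat) (A : rtuple R n -> 'M[R[i]]_(p, q)) :=
  cube_continuous (A : rtuple R n -> 'M[R[i]^o]_(p, q)).

End Cube.
Arguments cube {R} n _.
Arguments leb_cube {R} n.

Section L2.
Context {R : realType} (N M : nat).
Local Notation vfun := (rtuple R N -> 'cV[R[i]]_M).

(* Squared Euclidean norm on C^M. *)
Definition sqnorm (v : 'cV[R[i]]_M) : R := \sum_(i < M) normc (v i ord0) ^+ 2.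

Definition measurable_vec (u : vfun) : Prop := forall i,
  measurable_fun (cube N) (fun k => complex.Re (u k i ord0)) /\
  measurable_fun (cube N) (fun k => complex.Im (u k i ord0)).

Definition sq_integrable (u : vfun) : Prop := measurable_vec u /\
  (\int[leb_cube N]_(k in cube N) (sqnorm (u k))%:E < +oo)%E.

Definition sqint : {pred vfun} := mem [set u | sq_integrable u].

Lemma normc_ge0 (z : R[i]) : 0 <= normc z.
Proof. by case: z => a b; exact: sqrtr_ge0. Qed.

Lemma normc_sqr (z : R[i]) :
  normc z ^+ 2 = complex.Re z ^+ 2 + complex.Im z ^+ 2.
Proof. by case: z => a b /=; rewrite sqr_sqrtr// addr_ge0// sqr_ge0. Qed.

Lemma sqnorm_ge0 v : 0 <= sqnorm v.
Proof. by apply: sumr_ge0 => i _; rewrite exprn_ge0// normc_ge0. Qed.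

Lemma sqnormD u v : sqnorm (u + v) <= 2 * (sqnorm u + sqnorm v).
Proof.
rewrite /sqnorm -big_split mulr_sumr; apply: ler_sum => i _ /=.
rewrite mxE; set x := u i _; set y := v i _.
apply: (@le_trans _ _ ((normc x + normc y) ^+ 2)).
  by rewrite ler_sqr ?nnegrE ?addr_ge0 ?normc_ge0//; exact: le_normcD.
rewrite -subr_ge0 (_ : _ - _ = (normc x - normc y) ^+ 2) ?sqr_ge0//.
by move: (normc x) (normc y) => a b; ring.
Qed.

Lemma sqnormZ a v : sqnorm (a *: v) = normc a ^+ 2 * sqnorm v.
Proof.
by rewrite /sqnorm mulr_sumr; apply: eq_bigr => i _; rewrite mxE normcM exprMn.
Qed.

Lemma measurable_sqnorm (u : vfun) :
  measurable_vec u -> measurable_fun (cube N) (fun k => sqnorm (u k)).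
Proof.
move=> mu; apply: measurable_sum => i.
under eq_fun do rewrite normc_sqr.
by have [mr mi] := mu i; apply: measurable_funD; exact: measurable_funX.
Qed.

Lemma measurable_vec_lin a (u v : vfun) :
  measurable_vec u -> measurable_vec v -> measurable_vec (a *: u + v).
Proof.
case: a => ar ai mu mv i; have [ru iu] := mu i; have [rv iv] := mv i; split.
  rewrite (_ : (fun _ => _) = fun k : rtuple R N =>
      (ar * complex.Re (u k i ord0) - ai * complex.Im (u k i ord0)) +
      complex.Re (v k i ord0)).
    apply: measurable_funD => //.
    by apply: measurable_funB; exact: measurable_funM.
  apply/funext => k; rewrite !mxE.
  by case: (u k i ord0) => ? ?; case: (v k i ord0).
rewrite (_ : (fun _ => _) = fun k : rtuple R N =>
    (ar * complex.Im (u k i ord0) + ai * complex.Re (u k i ord0)) +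
    complex.Im (v k i ord0)).
  apply: measurable_funD => //.
  by apply: measurable_funD; exact: measurable_funM.
apply/funext => k; rewrite !mxE.
by case: (u k i ord0) => ? ?; case: (v k i ord0).
Qed.

Lemma sqint_submod_closed : submod_closed sqint.
Proof.
split.
  rewrite inE /=; split.
    by move=> i; split; rewrite (_ : (fun _ => _) = cst 0) //;
      apply/funext => k; rewrite mxE.
  rewrite (_ : (fun _ => _) = cst 0%E) ?integral0 ?ltry//.
  apply/funext => k /=; congr EFin; apply: big1 => i _.
  by rewrite mxE /= expr0n /= addr0 sqrtr0 expr0n.
move=> a u v; rewrite !inE /= => -[mu iu] [mv iv].
split; first exact: measurable_vec_lin.
have na : 0 <= 2 * normc a ^+ 2 by rewrite mulr_ge0// exprn_ge0// normc_ge0.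
have msq (c : R) (w : vfun) : measurable_vec w ->
    measurable_fun (cube N) (fun k => (c%:E * (sqnorm (w k))%:E)%E).
  move=> mw; apply/measurable_EFinP; apply: measurable_funM => //.
  exact: measurable_sqnorm.
have sq0 (c : R) (w : vfun) : 0 <= c ->
    forall k, cube N k -> (0 <= c%:E * (sqnorm (w k))%:E)%E.
  by move=> c0 k _; rewrite -EFinM lee_fin mulr_ge0// sqnorm_ge0.
have mcube := @measurable_cube R N.
apply: (@le_lt_trans _ _ (\int[leb_cube N]_(k in cube N)
   ((2 * normc a ^+ 2)%:E * (sqnorm (u k))%:E + 2%:E * (sqnorm (v k))%:E)))%E.
  apply: ge0_le_integral => //.
  - by move=> k _; rewrite lee_fin sqnorm_ge0.
  - apply/measurable_EFinP; apply: measurable_sqnorm.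
    exact: measurable_vec_lin.
  - by apply: emeasurable_funD; exact: msq.
  - move=> k _; rewrite -!EFinM -EFinD lee_fin.
    by rewrite -mulrA -sqnormZ -mulrDr; exact: sqnormD.
rewrite ge0_integralD//=; [|exact: sq0|exact: msq|exact: sq0|exact: msq].
rewrite !ge0_integralZl//; first by
  apply: lte_add_pinfty; apply: lte_mul_pinfty => //; rewrite lee_fin.
all: try by move=> k _; rewrite lee_fin sqnorm_ge0.
all: by apply/measurable_EFinP; exact: measurable_sqnorm.
Qed.

HB.instance Definition _ :=
  GRing.isSubmodClosed.Build _ _ sqint sqint_submod_closed.

Record sqintType := SqInt {
  sqint_fun :> vfun;
  sqint_funP : sqint_fun \in sqint }.

HB.instance Definition _ := [isSub of sqintType for sqint_fun].
HB.instance Definition _ := [Choice of sqintType by <:].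
HB.instance Definition _ := [SubChoice_isSubLmodule of sqintType by <:].

Definition ae_null : {pred sqintType} := mem [set u : sqintType |
  {ae leb_cube N, forall k, cube N k -> sqint_fun u k = 0}].

Lemma ae_null_submod_closed : submod_closed ae_null.
Proof.
split; first by rewrite inE; exact: aeW.
move=> a u v; rewrite !inE /= => hu hv.
apply: filterS2 hu hv => k hu hv kc /=.
by rewrite -[LHS]/(a *: sqint_fun u k + sqint_fun v k) hu// hv// scaler0 addr0.
Qed.

HB.instance Definition _ :=
  GRing.isSubmodClosed.Build _ _ ae_null ae_null_submod_closed.

(* L^2([0,1]^N, C^M): functions are defined on R^N, but only their values on
   the cube, up to a null set, matter. *)
Definition L2 : Type := Quotient.quot ae_null.
HB.instance Definition _ := GRing.Zmodule.on L2.

Definition L2_class (u : sqintType) : L2 :=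
  (\pi_(Quotient.quot ae_null) u)%qT.

Definition L2_repr (u : L2) : sqintType := repr (u : Quotient.quot ae_null).

Lemma L2_reprK : cancel L2_repr L2_class.
Proof. exact: reprK. Qed.

Lemma L2_classP u v : reflect (L2_class u = L2_class v) (u - v \in ae_null).
Proof. by rewrite Quotient.idealrBE; apply: eqP. Qed.

Lemma L2_classD u v : L2_class (u + v) = L2_class u + L2_class v.
Proof. exact: Quotient.pi_add. Qed.

Definition L2_scale (a : R[i]) (u : L2) : L2 := L2_class (a *: L2_repr u).

Lemma L2_classZ a u : L2_class (a *: u) = L2_scale a (L2_class u).
Proof.
apply/L2_classP; rewrite -scalerBr rpredZ//.
by apply/L2_classP; rewrite L2_reprK.
Qed.

Let L2_scaleA a b v : L2_scale a (L2_scale b v) = L2_scale (a * b) v.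
Proof. by rewrite -[v]L2_reprK -!L2_classZ scalerA. Qed.

Let L2_scale1 : left_id 1 L2_scale.
Proof. by move=> v; rewrite -[v]L2_reprK -!L2_classZ scale1r. Qed.

Let L2_scaleDr : right_distributive L2_scale +%R.
Proof.
move=> a u v; rewrite -[u]L2_reprK -[v]L2_reprK.
by rewrite -!L2_classZ -!L2_classD -L2_classZ scalerDr.
Qed.

Let L2_scaleDl v : {morph L2_scale^~ v : a b / a + b}.
Proof.
by move=> a b; rewrite -[v]L2_reprK -!L2_classZ -L2_classD scalerDl.
Qed.

HB.instance Definition _ := GRing.Zmodule_isLmodule.Build R[i] L2
  L2_scaleA L2_scale1 L2_scaleDr L2_scaleDl.

Definition L2_norm (u : L2) : R :=
  Num.sqrt (\int[leb_cube N]_(k in cube N) sqnorm (L2_repr u k)).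

Definition bounded_op (T : L2 -> L2) : Prop :=
  linear T /\ exists c : R, forall u, L2_norm (T u) <= c * L2_norm u.

(* The operator on classes induced by an operation on functions; the default
   value 0 of insubd is never reached for the operations used below, which
   preserve square integrability. *)
Definition L2_lift (F : vfun -> vfun) (u : L2) : L2 :=
  L2_class (insubd 0 (F (L2_repr u))).

End L2.
Arguments L2 R N M : clear implicits.

Section Average.
Context {R : realType} {N : nat}.

(* (x_1, ..., x_j, k_{j+1}, ..., k_N); the index i < N stands for k_{i+1}. *)
Definition subst_point (j : nat) (x : rtuple R j) (k : rtuple R N) :
    rtuple R N :=
  [tuple (if (i < j)%N then nth (0 : R) x i else tnth k i) | i < N].

Definition avg (j : nat) {p q : nat} (F : rtuple R N -> 'M[R[i]]_(p, q))
    (k : rtuple R N) : 'M[R[i]]_(p, q) :=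
  \matrix_(a, b)
    ((\int[leb_cube j]_(x in cube j) complex.Re (F (subst_point x k) a b)) +i*
     (\int[leb_cube j]_(x in cube j) complex.Im (F (subst_point x k) a b))).
End Average.

Section Operators.
Context {R : realType} {N M : nat}.
Local Notation op := (L2 R N M -> L2 R N M).

Definition mul_op (A : rtuple R N -> 'M[R[i]]_M) : op :=
  L2_lift (fun u k => A k *m u k).

Definition avg_op (j : nat) : op := L2_lift (avg j).

(* u |-> A <B u>_j *)
Definition int_op (j m : nat) (A : rtuple R N -> 'M[R[i]]_(M, m))
    (B : rtuple R N -> 'M[R[i]]_(m, M)) : op :=
  L2_lift (fun u k => A k *m avg j (fun k' => B k' *m u k') k).

Definition mul_ops : set op :=
  [set T | exists2 A, continuous_mx A & T = mul_op A].

Definition avg_ops : set op :=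
  [set T | exists2 j, (1 <= j <= N)%N & T = avg_op j].

Definition op_subalgebra (S : set op) : Prop :=
  [/\ S `<=` @bounded_op R N M,
      forall T U, S T -> S U -> S (fun u => T u + U u),
      forall (c : R[i]) T, S T -> S (fun u => c *: T u) &
      forall T U, S T -> S U -> S (T \o U)].

Definition alg_H : set op := smallest op_subalgebra (mul_ops `|` avg_ops).

Definition Inv_op (S : set op) : set op :=
  [set T | S T /\ exists U, [/\ bounded_op U, T \o U = id & U \o T = id]].

Definition id_int_ops (j : nat) : set op :=
  [set T | exists m (A : rtuple R N -> 'M[R[i]]_(M, m))
                    (B : rtuple R N -> 'M[R[i]]_(m, M)),
     [/\ (0 < m)%N, continuous_mx A, continuous_mx B &
         T = fun u => u + int_op j A B u]].

Definition F_ (j : nat) : set op :=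
  Inv_op (if j is 0 then mul_ops else id_int_ops j).

Definition op_group (G : set op) : Prop :=
  [/\ G id,
      forall T U, G T -> G U -> G (T \o U) &
      forall T, G T -> exists U, [/\ G U, T \o U = id & U \o T = id]].

End Operators.

Section Pi.
Context (R : realType) (N M : nat).

(* Data of the expression A_0 + A_1 <B_1 .>_1 + ... + A_N <B_N .>_N; only the
   indices 1 <= j <= N of nf_dim, nf_A and nf_B are relevant. *)
Record normal_form := NormalForm {
  nf_dim : nat -> nat;
  nf_A0 : rtuple R N -> 'M[R[i]]_M;
  nf_A : forall j, rtuple R N -> 'M[R[i]]_(M, nf_dim j);
  nf_B : forall j, rtuple R N -> 'M[R[i]]_(nf_dim j, M) }.

Definition nf_op (r : normal_form) (u : L2 R N M) : L2 R N M :=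
  mul_op (nf_A0 r) u +
  \sum_(1 <= j < N.+1) int_op j (@nf_A r j) (@nf_B r j) u.

Definition represents (r : normal_form) (T : L2 R N M -> L2 R N M) : Prop :=
  [/\ continuous_mx (nf_A0 r),
      forall j, (1 <= j <= N)%N -> [/\ (0 < nf_dim r j)%N,
        continuous_mx (@nf_A r j) & continuous_mx (@nf_B r j)] &
      T = nf_op r].

Definition E_of (r : normal_form) (j : nat)
    (Aj : rtuple R N -> 'M[R[i]]_(M, nf_dim r j)) (k : rtuple R N) :
    'M[R[i]]_(nf_dim r j) :=
  1%:M + avg j (fun k' => nf_B r j k' *m Aj k') k.

(* nf_Aij r j i is A_{i,j}. *)
Fixpoint nf_Aij (r : normal_form) (j i : nat) (k : rtuple R N) :
    'M[R[i]]_(M, nf_dim r i) :=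
  match j with
  | 0 => invmx (nf_A0 r k) *m nf_A r i k
  | j'.+1 =>
      nf_Aij r j' i k -
      nf_Aij r j' j'.+1 k *m invmx (E_of (nf_Aij r j' j'.+1) k) *m
      avg j'.+1 (fun k' => nf_B r j'.+1 k' *m nf_Aij r j' i k') k
  end.

Definition nf_pi (r : normal_form) (j : nat) (k : rtuple R N) : R[i] :=
  match j with
  | 0 => \det (nf_A0 r k)
  | j'.+1 => \det (E_of (nf_Aij r j' j'.+1) k)
  end.

(* C_j, realized as the continuous functions on [0,1]^N which are constant in
   k_1, ..., k_j. *)
Definition in_C (j : nat) (f : rtuple R N -> R[i]) : Prop :=
  cube_continuous (f : rtuple R N -> R[i]^o) /\
  forall k k', cube N k -> cube N k' ->
    (forall i : 'I_N, (j <= i)%N -> tnth k i = tnth k' i) -> f k = f k'.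

Definition in_InvC (f : 'I_N.+1 -> rtuple R N -> R[i]) : Prop :=
  forall j : 'I_N.+1, in_C j (f j) /\ forall k, cube N k -> f j k != 0.

End Pi.

(* Main.v *)
(* Let e_j be the average over k_1, ..., k_j, acting on the ring of continuous
   functions on the cube; then e_i (e_j f * g) = e_j f * e_i g for i <= j. Write
   T_l = A_0 + A_1 <B_1 .>_1 + ... + A_l <B_l .>_l for the truncations of T. Then
   T_l = T_(l-1) (I + P_l <B_l .>_l) with P_l = T_(l-1)^-1 A_l, and pi_l is the
   determinant of E_l = I + <B_l P_l>_l, so T is invertible, with an explicit
   inverse of the same kind, as soon as all pi_l are invertible. The number
   det (I + <Q P>) depends only on the operator I + P <Q .> and is
   multiplicative in it: this is block elimination, plus det (I + X) = 1 when
   X^2 = 0. Conjugating by T_(l-1), the identity W = R T of operators becomes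
   multiplicativity of pi_l, provided that it holds for the truncations.

   Analysis enters twice: an operator determines its truncations, and a bounded
   inverse forces all pi_l to be nowhere zero. Both follow by multiplying by
   bumps concentrated near a slice where some of the last coordinates are
   fixed, which makes the averages over these coordinates negligible. For the
   second, a zero of pi_l yields a vector in the kernel of T_l on one fibre,
   contradicting the fact that T is bounded below. *)
From HB Require Import structures.
Require Import Defs.
From mathcomp Require Import all_boot all_order all_algebra.
From mathcomp Require Import complex ring lra.
From mathcomp Require Import all_classical all_reals all_analysis.
From mathcomp Require Import measurable_realfun.

Set Implicit Arguments.
Unset Strict Implicit.
Unset Printing Implicit Defensive.
Import Order.TTheory GRing.Theory Num.Theory.
Import numFieldNormedType.Exports.
Import ComplexField.Normc.
Local Open Scope classical_set_scope.
Local Open Scope ring_scope.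
Local Open Scope complex_scope.
Local Notation Re := (@complex.Re _).
Local Notation Im := (@complex.Im _).

(** * Averaging modules *)

(** The recursion for A_{i,j} is the inversion of the truncations in disguise: A_{i,j} is T_j^-1
    A_i. It makes sense only once the determinants of lower level are units, so the nonvanishing of
    pi_l is an induction on l whose analytic input must speak of T_l without any inverse. The
    bounded inverse in the definition of Inv(H) is not known to lie in H, so no formula applies to
    it; it enters only through an estimate |u|^2 <= C |T u|^2. That Inv(H) is closed under inverses
    comes out afterwards, from the explicit inverse.

    The other obstacle is that operators on L^2 are known up to null sets, while determinants need
    values at every point. The algebra is therefore done in an abstract module with averages, which
    covers both L^2 and matrices of continuous functions. Continuous columns embed injectively in
    L^2, and this carries identities of operators to identities of matrices. Independence of the
    representation is not a separate argument: it is multiplicativity with the identity as a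
    factor. *)

Record averaging (C : comUnitRingType) (e : nat -> C -> C) : Prop := {
  averagingD : forall j f g, e j (f + g) = e j f + e j g;
  averagingM : forall i j f g, (i <= j)%N -> e i (e j f * g) = e j f * e i g;
  averagingT : forall i j f, (i <= j)%N -> e j (e i f) = e j f;
  averaging1 : forall j, e j 1 = 1 }.

Section AveragingMatrices.
Variables (C : comUnitRingType) (e : nat -> C -> C).
Hypothesis he : averaging e.

Definition mxavg j p q (A : 'M[C]_(p, q)) : 'M[C]_(p, q) := map_mx (e j) A.

Lemma avg0 j : e j 0 = 0.
Proof. by apply: (addrI (e j 0)); rewrite -(averagingD he) !addr0. Qed.

Lemma avg_sum j I (r : seq I) (P : pred I) (F : I -> C) :
  e j (\sum_(i <- r | P i) F i) = \sum_(i <- r | P i) e j (F i).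
Proof. exact: (big_morph _ (averagingD he j) (avg0 j)). Qed.

Lemma mxavgD j p q (A B : 'M[C]_(p, q)) :
  mxavg j (A + B) = mxavg j A + mxavg j B.
Proof. by apply/matrixP => a b; rewrite !mxE (averagingD he). Qed.

Lemma avgN j f : e j (- f) = - e j f.
Proof. by apply: (addIr (e j f)); rewrite -(averagingD he) !addNr avg0. Qed.

Lemma mxavgN j p q (A : 'M[C]_(p, q)) : mxavg j (- A) = - mxavg j A.
Proof. by apply/matrixP => a b; rewrite !mxE avgN. Qed.

Lemma mxavg0 j p q : mxavg j (0 : 'M[C]_(p, q)) = 0.
Proof. by apply/matrixP => a b; rewrite !mxE avg0. Qed.

Lemma mxavg1 j p : mxavg j (1%:M : 'M[C]_p) = 1%:M.
Proof.
apply/matrixP => a b; rewrite !mxE.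
by case: (_ == _) => /=; rewrite ?mulr1n ?mulr0n ?avg0 ?(averaging1 he).
Qed.

Lemma mxavgMl i j p q r (A : 'M[C]_(p, q)) (B : 'M[C]_(q, r)) :
  (i <= j)%N -> mxavg i (mxavg j A *m B) = mxavg j A *m mxavg i B.
Proof.
move=> ij; apply/matrixP => a b; rewrite !mxE avg_sum.
by apply: eq_bigr => c _; rewrite !mxE (averagingM he).
Qed.

Lemma mxavgMr i j p q r (A : 'M[C]_(p, q)) (B : 'M[C]_(q, r)) :
  (i <= j)%N -> mxavg i (A *m mxavg j B) = mxavg i A *m mxavg j B.
Proof.
move=> ij; apply/matrixP => a b; rewrite !mxE avg_sum.
by apply: eq_bigr => c _; rewrite !mxE mulrC (averagingM he)// mulrC.
Qed.

Lemma mxavgT i j p q (A : 'M[C]_(p, q)) :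
  (i <= j)%N -> mxavg j (mxavg i A) = mxavg j A.
Proof. by move=> ij; apply/matrixP => a b; rewrite !mxE (averagingT he). Qed.

Lemma mxavgK i j p q (A : 'M[C]_(p, q)) :
  (i <= j)%N -> mxavg i (mxavg j A) = mxavg j A.
Proof. by move=> ij; rewrite -[mxavg j A]mulmx1 mxavgMl// mxavg1. Qed.

(** Averaging [A *m invmx A = 1] pulls the invariant [A] out of the average. *)
Lemma mxavg_invmx j p (A : 'M[C]_p) :
  A \in unitmx -> mxavg j A = A -> mxavg j (invmx A) = invmx A.
Proof.
move=> uA eA; have := mxavgMl A (invmx A) (leqnn j).
rewrite eA mulmxV// mxavg1 => /(congr1 (mulmx (invmx A))).
by rewrite mulmx1 mulKmx.
Qed.

End AveragingMatrices.

(* The two instances are matrices over the ring of symbols, on which the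
   multiplications and averages act exactly, and the spaces L^2([0,1]^N, C^p),
   on which they act up to null sets. *)
Record avg_module (C : comUnitRingType) (e : nat -> C -> C) := AvgModule {
  amod :> nat -> zmodType;
  amul : forall p q, 'M[C]_(p, q) -> amod q -> amod p;
  aavg : nat -> forall p, amod p -> amod p;
  amulDl : forall p q (A B : 'M[C]_(p, q)) u,
    amul (A + B) u = amul A u + amul B u;
  amulDr : forall p q (A : 'M[C]_(p, q)) u v,
    amul A (u + v) = amul A u + amul A v;
  amulA : forall p q r (A : 'M[C]_(p, q)) (B : 'M[C]_(q, r)) u,
    amul A (amul B u) = amul (A *m B) u;
  amul1 : forall p (u : amod p), amul 1%:M u = u;
  aavgD : forall j p (u v : amod p), aavg j (u + v) = aavg j u + aavg j v;
  aavgMl : forall i j p q (A : 'M[C]_(p, q)) u, (i <= j)%N ->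
    aavg i (amul (mxavg e j A) u) = amul (mxavg e j A) (aavg i u);
  aavgMr : forall i j p q (A : 'M[C]_(p, q)) u, (i <= j)%N ->
    aavg i (amul A (aavg j u)) = amul (mxavg e i A) (aavg j u);
  aavgT : forall i j p (u : amod p), (i <= j)%N -> aavg j (aavg i u) = aavg j u }.
Arguments amul {C e a p q}.
Arguments aavg {C e a} j {p}.

Definition mx_module (C : comUnitRingType) (e : nat -> C -> C)
  (he : averaging e) (s : nat) : avg_module e :=
  @AvgModule C e (fun p => 'M[C]_(p, s)) (fun p q A X => A *m X)
    (fun j p X => mxavg e j X)
    (fun p q A B u => mulmxDl A B u) (fun p q A u v => mulmxDr A u v)
    (fun p q r A B u => mulmxA A B u) (fun p u => mul1mx u)
    (fun j p u v => mxavgD he j u v)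
    (fun i j p q A u ij => mxavgMl he A u ij)
    (fun i j p q A u ij => mxavgMr he A u ij)
    (fun i j p u ij => mxavgT he u ij).

(* The coefficients of A_0 + A_1 <B_1 .>_1 + A_2 <B_2 .>_2 + ... *)
Record symbol (C : comUnitRingType) (M : nat) := Symbol {
  sdim : nat -> nat;
  sA0 : 'M[C]_M;
  sA : forall j, 'M[C]_(M, sdim j);
  sB : forall j, 'M[C]_(sdim j, M) }.

(** * Symbols, their truncations, products and inverses *)

Section Action.
Variables (C : comUnitRingType) (e : nat -> C -> C).
Hypothesis he : averaging e.
Variable M : nat.
Implicit Types r t : symbol C M.
Local Notation sym := (symbol C M).

Section Module.
Variable V : avg_module e.

Lemma amul0r p q (A : 'M[C]_(p, q)) : amul A (0 : V q) = 0.
Proof. by apply: (addrI (amul A (0 : V q))); rewrite -amulDr !addr0. Qed.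

Lemma amul0l p q (u : V q) : amul (0 : 'M[C]_(p, q)) u = 0.
Proof. by apply: (addrI (amul (0 : 'M[C]_(p, q)) u)); rewrite -amulDl !addr0. Qed.

Lemma amulNl p q (A : 'M[C]_(p, q)) (u : V q) : amul (- A) u = - amul A u.
Proof. by apply: (addIr (amul A u)); rewrite -amulDl !addNr amul0l. Qed.

Lemma amulNr p q (A : 'M[C]_(p, q)) (u : V q) : amul A (- u) = - amul A u.
Proof. by apply: (addIr (amul A u)); rewrite -amulDr !addNr amul0r. Qed.

Lemma aavg0 j p : aavg j (0 : V p) = 0.
Proof. by apply: (addrI (aavg j (0 : V p))); rewrite -aavgD !addr0. Qed.

Lemma aavgN j p (u : V p) : aavg j (- u) = - aavg j u.
Proof. by apply: (addIr (aavg j u)); rewrite -aavgD !addNr aavg0. Qed.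

Lemma amul_fix i p q (A : 'M[C]_(p, q)) (u : V q) :
  mxavg e i A = A -> aavg i (amul A u) = amul A (aavg i u).
Proof. by move=> <-; rewrite aavgMl. Qed.

Lemma mxavg_row_mx10 i p q : mxavg e i (row_mx (1%:M : 'M[C]_p) (0 : 'M[C]_(p, q))) =
  row_mx 1%:M 0.
Proof. by rewrite /mxavg map_row_mx; congr row_mx; [exact: mxavg1|exact: mxavg0]. Qed.

Lemma mxavg_row_mx01 i p q : mxavg e i (row_mx (0 : 'M[C]_(p, q)) (1%:M : 'M[C]_p)) =
  row_mx 0 1%:M.
Proof. by rewrite /mxavg map_row_mx; congr row_mx; [exact: mxavg0|exact: mxavg1]. Qed.

(** The blocks are extracted by [row_mx 1 0] and [row_mx 0 1], whose constant entries commute with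
    every average. This is what lets sums and products of operators be encoded by concatenating
    coefficients. *)
Lemma amul_block i p q1 q2 n (X : 'M[C]_(p, q1)) (Y : 'M[C]_(p, q2))
    (D : 'M[C]_(q1, n)) (E : 'M[C]_(q2, n)) (u : V n) :
  amul (row_mx X Y) (aavg i (amul (col_mx D E) u)) =
  amul X (aavg i (amul D u)) + amul Y (aavg i (amul E u)).
Proof.
have -> : row_mx X Y = X *m row_mx 1%:M 0 + Y *m row_mx 0 1%:M.
  by rewrite !mul_mx_row !mulmx1 !mulmx0 add_row_mx addr0 add0r.
rewrite amulDl -!amulA; congr (amul X _ + amul Y _).
  by rewrite -amul_fix ?mxavg_row_mx10// amulA mul_row_col mul1mx mul0mx addr0.
by rewrite -amul_fix ?mxavg_row_mx01// amulA mul_row_col mul1mx mul0mx add0r.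
Qed.

Fixpoint act r l (u : V M) : V M :=
  if l is l'.+1 then
    act r l' u + amul (sA r l) (aavg l (amul (sB r l) u))
  else amul (sA0 r) u.

Lemma actD r l u v : act r l (u + v) = act r l u + act r l v.
Proof.
elim: l => [|l IH] /=; first by rewrite amulDr.
by rewrite IH !(amulDr, aavgD) addrACA.
Qed.

Lemma actN r l u : act r l (- u) = - act r l u.
Proof.
by elim: l => [|l IH] /=; rewrite ?amulNr// IH !(amulNr, aavgN) opprD.
Qed.

End Module.

Definition mact r l s (X : 'M[C]_(M, s)) : 'M[C]_(M, s) :=
  act (V := mx_module he s) r l X.

(* The transpose of the truncated operator. *)
Fixpoint ract r l p (B : 'M[C]_(p, M)) : 'M[C]_(p, M) :=
  if l is l'.+1 then
    ract r l' B + mxavg e l (B *m sA r l) *m sB r l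
  else B *m sA0 r.

Section Module2.
Variable V : avg_module e.

(** Averages are self-adjoint: for l <= j, <X <Y>_l>_j = <<X>_l Y>_j, because both equal <<X>_l
    <Y>_l>_j. Under an outer average, T_l can therefore be moved onto the left factor. *)
Lemma aavg_act r l j p (B : 'M[C]_(p, M)) (u : V M) : (l <= j)%N ->
  aavg j (amul B (act r l u)) = aavg j (amul (ract r l B) u).
Proof.
elim: l => [|l IH] lj /=; first by rewrite amulA.
rewrite amulDr aavgD IH 1?ltnW// amulDl aavgD; congr (_ + _).
rewrite -(aavgT _ lj) amulA aavgMr// -(aavgMl _ _ (leqnn _)) amulA.
by rewrite (aavgT _ lj).
Qed.

(** T_l averages over the first l <= j coordinates only, so factors constant in k_1, ..., k_j pass
    through it. *)
Lemma act_avg r l j p (X : 'M[C]_(M, p)) (u : V p) : (l <= j)%N ->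
  act r l (amul X (aavg j u)) = amul (mact r l X) (aavg j u).
Proof.
rewrite /mact; elim: l => [|l IH] lj /=; first by rewrite amulA.
by rewrite amulDl IH 1?ltnW// amulA aavgMr// amulA.
Qed.

End Module2.

(** Telescoping: R_l T_l - R_(l-1) T_(l-1) = R_(l-1) A_l <B_l .>_l + A'_l <B'_l T_l .>_l, where
    primes mark the coefficients of [r]. Every truncation of the product is thus the product of the
    truncations. *)
Definition sym_prod r t : sym :=
  @Symbol C M (fun l => sdim t l + sdim r l)%N (sA0 r *m sA0 t)
    (fun l => row_mx (mact r l.-1 (sA t l)) (sA r l))
    (fun l => col_mx (sB t l) (ract t l (sB r l))).

Lemma act_prod (V : avg_module e) r t l (u : V M) :
  act (sym_prod r t) l u = act r l (act t l u).
Proof.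
elim: l u => [|l IH] u; first by rewrite /= amulA.
have -> : act (sym_prod r t) l.+1 u = act (sym_prod r t) l u +
    amul (row_mx (mact r l (sA t l.+1)) (sA r l.+1))
      (aavg l.+1 (amul (col_mx (sB t l.+1) (ract t l.+1 (sB r l.+1))) u)) by [].
rewrite IH amul_block -aavg_act//.
have -> : act r l.+1 (act t l.+1 u) = act r l (act t l.+1 u) +
    amul (sA r l.+1) (aavg l.+1 (amul (sB r l.+1) (act t l.+1 u))) by [].
by rewrite addrA; congr (_ + _); rewrite /= actD act_avg.
Qed.

(** The recursion defining A_{i,j}, with an arbitrary X in place of A_i. It computes T_l^-1 X, so
    [minv r l (sA r i)] is A_{i,l}, and [symP r l] is A_{l,l-1}. *)
Fixpoint minv r l s (X : 'M[C]_(M, s)) : 'M[C]_(M, s) :=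
  if l is l'.+1 then
    minv r l' X - minv r l' (sA r l) *m
      invmx (1%:M + mxavg e l (sB r l *m minv r l' (sA r l))) *m
      mxavg e l (sB r l *m minv r l' X)
  else invmx (sA0 r) *m X.

Definition symP r l := minv r l.-1 (sA r l).
Definition symE r l := 1%:M + mxavg e l (sB r l *m symP r l).

Definition sym_pi r l := if l is 0 then \det (sA0 r) else \det (symE r l).

Definition sym_unit r l := forall i, (i <= l)%N -> sym_pi r i \is a GRing.unit.

Lemma sym_unit0 r l : sym_unit r l -> sA0 r \in unitmx.
Proof. by move=> h; have := h 0 (leq0n _); rewrite unitmxE. Qed.

Lemma sym_unitE r l i : sym_unit r l -> (0 < i <= l)%N -> symE r i \in unitmx.
Proof. by move=> h /andP[]; case: i => // i _ /h; rewrite unitmxE. Qed.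

Lemma sym_unitW r l : sym_unit r l.+1 -> sym_unit r l.
Proof. by move=> h i il; apply: h; exact: ltnW. Qed.

Lemma mxavg_symE r l : mxavg e l (symE r l) = symE r l.
Proof. by rewrite /symE mxavgD// mxavg1// mxavgK. Qed.

Section Inverse.
Variable V : avg_module e.

(** The formula of [minv] in an arbitrary module; on L^2 it is the inverse operator, visibly built
    from multiplications and averages. *)
Fixpoint ainv r l (u : V M) : V M :=
  if l is l'.+1 then
    ainv r l' u - amul (symP r l *m invmx (symE r l))
      (aavg l (amul (sB r l) (ainv r l' u)))
  else amul (invmx (sA0 r)) u.

Lemma ainvS r l u : ainv r l.+1 u = ainv r l u -
  amul (symP r l.+1 *m invmx (symE r l.+1))
    (aavg l.+1 (amul (sB r l.+1) (ainv r l u))).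
Proof. by []. Qed.

End Inverse.

Lemma minvE r l s (X : 'M[C]_(M, s)) : minv r l X = ainv (V := mx_module he s) r l X.
Proof. by elim: l X => [|l IH] X //=; rewrite IH. Qed.

(* I + P <B .>_l has inverse I - P E^-1 <B .>_l with E = I + <B P>_l. *)
Section Rank.
Variables (V : avg_module e) (l m : nat) (P : 'M[C]_(M, m)) (B : 'M[C]_(m, M)).
Let E := 1%:M + mxavg e l (B *m P).
Hypothesis uE : E \in unitmx.

Let avgE : mxavg e l E = E.
Proof. by rewrite /E mxavgD// mxavg1// mxavgK. Qed.

Let avgV : mxavg e l (invmx E) = invmx E.
Proof. exact: mxavg_invmx. Qed.

Lemma rank_pertK (u : V M) :
  let w := u + amul P (aavg l (amul B u)) in
  w - amul (P *m invmx E) (aavg l (amul B w)) = u.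
Proof.
set b := aavg l (amul B u) => w.
have -> : aavg l (amul B w) = amul E b.
  rewrite /w amulDr aavgD amulA /b aavgMr// -/b.
  by rewrite /E amulDl amul1.
by rewrite amulA -mulmxA mulVmx// mulmx1 /w addrK.
Qed.

Lemma rank_pertVK (w : V M) :
  let z := w - amul (P *m invmx E) (aavg l (amul B w)) in
  z + amul P (aavg l (amul B z)) = w.
Proof.
set b := aavg l (amul B w) => z.
suff -> : aavg l (amul B z) = amul (invmx E) b.
  by rewrite amulA /z subrK.
rewrite /z amulDr amulNr aavgD aavgN amulA mulmxA {2}/b aavgMr// -/b.
rewrite -avgV mxavgMr// avgV.
have -> : mxavg e l (B *m P) = E - 1%:M by rewrite /E addrC addKr.
by rewrite mulmxBl mulmxV// mul1mx amulDl amulNl amul1 opprB addrC subrK.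
Qed.

End Rank.

Lemma act_inv (V : avg_module e) r l : sym_unit r l ->
  (forall u : V M, ainv r l (act r l u) = u) /\
  (forall u : V M, act r l (ainv r l u) = u).
Proof.
(* The induction ranges over [V]: the factorization of T_(l+1) uses T_l P = A_(l+1), which is the
   induction hypothesis for a matrix module even when [V] is L^2. *)
elim: l V => [|l IH] V hu.
  have u0 := sym_unit0 hu.
  by split=> u /=; rewrite amulA ?mulVmx ?mulmxV ?amul1.
have hl := sym_unitW hu.
have uE : symE r l.+1 \in unitmx by apply: (sym_unitE hu); rewrite /=.
have factor (u : V M) : act r l.+1 u =
    act r l (u + amul (symP r l.+1) (aavg l.+1 (amul (sB r l.+1) u))).
  rewrite actD act_avg//= /symP minvE /mact.
  by rewrite (IH (mx_module he (sdim r l.+1)) hl).2.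
split=> u; rewrite ainvS.
  by rewrite factor (IH V hl).1 rank_pertK.
by rewrite factor rank_pertVK// (IH V hl).2.
Qed.

Lemma mactK r l s : sym_unit r l -> cancel (@mact r l s) (minv r l (s := s)).
Proof. by move=> h X; rewrite minvE (act_inv (mx_module he s) h).1. Qed.

Lemma minvK r l s : sym_unit r l -> cancel (minv r l (s := s)) (@mact r l s).
Proof. by move=> h X; rewrite minvE /mact (act_inv (mx_module he s) h).2. Qed.

(** The factorization T_(l+1) = T_l (I + P <B .>) asks for units up to level [l] only, so it is
    available before [sym_pi r l.+1] is known to be a unit. *)
Lemma mactS r l s (X : 'M[C]_(M, s)) : sym_unit r l ->
  mact r l.+1 X =
  mact r l (X + symP r l.+1 *m mxavg e l.+1 (sB r l.+1 *m X)).
Proof.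
move=> h; rewrite {2}/mact actD -!/(mact _ _ _) /=; congr (_ + _).
rewrite {1}/mact (act_avg (V := mx_module he s))//= /symP /=.
by rewrite minvK.
Qed.

(** * The determinant of I + P <Q .> *)

Section RankOne.
Variable l : nat.

Definition rdet m (P : 'M[C]_(M, m)) (Q : 'M[C]_(m, M)) : C :=
  \det (1%:M + mxavg e l (Q *m P)).

(* (I + P1<Q1>)(I + P2<Q2>) = I + P<Q> with P and Q the blocks below. *)
Lemma rdet_block m1 m2 (P1 : 'M[C]_(M, m1)) (Q1 : 'M[C]_(m1, M))
    (P2 : 'M[C]_(M, m2)) (Q2 : 'M[C]_(m2, M)) :
  rdet (row_mx P1 (P2 + P1 *m mxavg e l (Q1 *m P2))) (col_mx Q1 Q2) =
  rdet P1 Q1 * rdet P2 Q2.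
Proof.
rewrite /rdet mul_col_row /mxavg map_block_mx -!/(mxavg _ _ _).
rewrite !mulmxDr !mxavgD// !mulmxA !mxavgMr//.
set a := mxavg e l (Q1 *m P1); set b := mxavg e l (Q1 *m P2).
set c := mxavg e l (Q2 *m P1); set d := mxavg e l (Q2 *m P2).
rewrite scalar_mx_block add_block_mx !add0r.
have -> : block_mx (1%:M + a) (b + a *m b) c (1%:M + (d + c *m b)) =
    block_mx (1%:M + a) 0 c (1%:M + d) *m block_mx 1%:M b 0 1%:M.
  rewrite mulmx_block !mulmx1 !mulmx0 !addr0.
  by rewrite mulmxDl mul1mx [c *m b + _]addrC addrA.
by rewrite det_mulmx det_lblock det_ublock !det1 !mulr1.
Qed.

(* True over any reduced ring; the ring of symbols embeds in a power of a
   field. *)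
Hypothesis det_nil2 : forall n (X : 'M[C]_n), X *m X = 0 -> \det (1%:M + X) = 1.

(** If P <Q .> is the zero operator, then X = <Q P> has square <Q P <Q P>> = 0. *)
Lemma rdet_zero m (P : 'M[C]_(M, m)) (Q : 'M[C]_(m, M)) :
  (forall s (X : 'M[C]_(M, s)), P *m mxavg e l (Q *m X) = 0) -> rdet P Q = 1.
Proof.
move=> PQ0; apply: det_nil2.
by rewrite -mxavgMr// -mulmxA PQ0 mulmx0 mxavg0.
Qed.

(** With F = -E^-1, the operator I + P F <Q .> inverts I + P <Q .>, hence also I + P' <Q' .>. The
    product acts as the identity, so its determinant is 1 by [rdet_zero]; by [rdet_block] it is also
    det(E^-1) times [rdet P' Q']. *)
Lemma rdet_eq m m' (P : 'M[C]_(M, m)) (Q : 'M[C]_(m, M))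
    (P' : 'M[C]_(M, m')) (Q' : 'M[C]_(m', M)) :
  (forall s (X : 'M[C]_(M, s)),
     P *m mxavg e l (Q *m X) = P' *m mxavg e l (Q' *m X)) ->
  rdet P Q \is a GRing.unit -> rdet P Q = rdet P' Q'.
Proof.
move=> PQ uPQ.
set E := 1%:M + mxavg e l (Q *m P).
have uE : E \in unitmx by rewrite unitmxE.
pose F := - invmx E.
have avgF : mxavg e l F = F.
  by rewrite mxavgN// mxavg_invmx// /E mxavgD// mxavg1// mxavgK.
pose P2 := P *m F.
have QP2 q (B : 'M[C]_(q, M)) : mxavg e l (B *m P2) = mxavg e l (B *m P) *m F.
  by rewrite /P2 -avgF mulmxA mxavgMr.
have := rdet_block P' Q' P2 Q.
rewrite rdet_zero => [|s X].
  have -> : rdet P2 Q = \det (invmx E).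
    rewrite /rdet QP2; congr (\det _).
    have -> : mxavg e l (Q *m P) = E - 1%:M by rewrite /E addrC addKr.
    by rewrite mulmxN mulmxBl mulmxV// mul1mx opprB addrC subrK.
  rewrite det_inv -/E -/(rdet P Q) => /(congr1 ( *%R^~ (rdet P Q))).
  by rewrite mul1r divrK.
rewrite mul_col_mx /mxavg map_col_mx mul_row_col -!/(mxavg _ _ _).
rewrite -!PQ -mulmxDl QP2 /P2.
suff -> : P *m F + P *m (mxavg e l (Q *m P) *m F) = - P.
  by rewrite subrr mul0mx.
rewrite -mulmxDr -{1}[F]mul1mx -mulmxDl -/E.
by rewrite mulmxN mulmxV// mulmxN mulmx1.
Qed.

End RankOne.

Hypothesis det_nil2 : forall n (X : 'M[C]_n), X *m X = 0 -> \det (1%:M + X) = 1.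

Lemma sym_pi_prod r t w l :
  (forall i s (X : 'M[C]_(M, s)), (i <= l)%N ->
     mact w i X = mact r i (mact t i X)) ->
  sym_unit r l -> sym_unit t l -> sym_unit w l ->
  sym_pi w l = sym_pi r l * sym_pi t l.
Proof.
case: l => [|l] wE ur ut uw.
  have := wE 0 _ 1%:M (leqnn _); rewrite /mact /= !mulmx1 => ->.
  by rewrite det_mulmx.
have [[ur' ut'] uw'] := (sym_unitW ur, sym_unitW ut, sym_unitW uw).
(* Cancelling W_l = R_l T_l from the factored forms of W_(l+1) = R_(l+1) T_(l+1) leaves I + P_w <Q_w
   .> = (I + T_l^-1 P_r <Q_r T_l .>) (I + P_t <Q_t .>). *)
have key s (X : 'M[C]_(M, s)) : let Y :=
    X + symP t l.+1 *m mxavg e l.+1 (sB t l.+1 *m X) in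
    X + symP w l.+1 *m mxavg e l.+1 (sB w l.+1 *m X) =
    Y + minv t l (symP r l.+1) *m mxavg e l.+1 (ract t l (sB r l.+1) *m Y).
  move=> Y; have := wE l.+1 _ X (leqnn _).
  rewrite !mactS// -/Y wE// => /(can_inj (mactK ur')) => eqS.
  apply: (can_inj (mactK ut')); rewrite eqS.
  rewrite {3}/mact actD -!/(mact _ _ _); congr (_ + _).
  rewrite {2}/mact (act_avg (V := mx_module he s))//= minvK//.
  by congr (_ *m _); exact: (aavg_act (V := mx_module he s)).
rewrite [LHS](_ : _ = rdet l.+1 (symP w l.+1) (sB w l.+1))//.
rewrite (rdet_eq det_nil2 (P' := row_mx (minv t l (symP r l.+1))
  (symP t l.+1 + minv t l (symP r l.+1) *m
     mxavg e l.+1 (ract t l (sB r l.+1) *m symP t l.+1)))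
  (Q' := col_mx (ract t l (sB r l.+1)) (sB t l.+1))).
- rewrite rdet_block; congr (_ * _).
  rewrite [RHS](_ : _ = rdet l.+1 (symP r l.+1) (sB r l.+1))// /rdet.
  congr (\det (_ + _)).
  (* Conjugation preserves the determinant: <(Q_r T_l) (T_l^-1 P_r)> = <Q_r P_r> by self-adjointness
     of the averages. *)
  rewrite -[symP r l.+1 in RHS](minvK ut').
  by apply: esym; exact: (aavg_act (V := mx_module he _)).
- move=> s X; apply: (addrI X); rewrite key.
  rewrite mul_col_mx /mxavg map_col_mx mul_row_col -!/(mxavg _ _ _).
  rewrite -addrA; congr (_ + _).
  rewrite mulmxDr mxavgD// !mulmxDr mulmxDl !mulmxA mxavgMr// !mulmxA.
  by rewrite addrCA.
- exact: (uw l.+1).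
Qed.

End Action.

(** * The ring of continuous functions on the cube *)

Section Clamp.
Context {R : realType}.

Definition clamp01 (x : R) : R := Num.max 0 (Num.min 1 x).

Lemma clamp01_itv x : 0 <= clamp01 x <= 1.
Proof. by rewrite /clamp01 le_max lexx/= ge_max ler01 ge_min lexx. Qed.

Lemma clamp01_id x : 0 <= x <= 1 -> clamp01 x = x.
Proof. by move=> /andP[x0 x1]; rewrite /clamp01 (min_idPr x1) (max_idPr x0). Qed.

Lemma clamp01_lip x y : `|clamp01 x - clamp01 y| <= `|x - y|.
Proof.
rewrite /clamp01 ler_norml; case: (ger0P (x - y)) => ?;
  case: (leP 1 x) => ?; case: (leP 1 y) => ?; do ?[case: (leP 0 _) => ?]; lra.
Qed.

Definition clamp n (k : rtuple R n) : rtuple R n :=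
  [tuple (clamp01 (tnth k i) : measurableTypeR R) | i < n].

Lemma cube_clamp n (k : rtuple R n) : cube n (clamp k).
Proof. by move=> i; rewrite tnth_mktuple clamp01_itv. Qed.

Lemma clamp_id n (k : rtuple R n) : cube n k -> clamp k = k.
Proof.
by move=> kc; apply: eq_from_tnth => i; rewrite tnth_mktuple clamp01_id.
Qed.

Lemma clampK n (k : rtuple R n) : clamp (clamp k) = clamp k.
Proof. by rewrite clamp_id//; exact: cube_clamp. Qed.

Lemma clamp_lip n (k k' : rtuple R n) i :
  `|tnth (clamp k) i - tnth (clamp k') i| <= `|tnth k i - tnth k' i|.
Proof. by rewrite !tnth_mktuple clamp01_lip. Qed.

Definition close n (d : R) (k k' : rtuple R n) : Prop :=
  forall i, `|tnth k i - tnth k' i| < d.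

Lemma close_clamp n d (k k' : rtuple R n) :
  close d k k' -> close d (clamp k) (clamp k').
Proof. by move=> h i; apply: le_lt_trans (h i); exact: clamp_lip. Qed.

(** Boundedness makes this class stable under products; a uniform modulus makes it stable under
    averages, since the modulus survives integration. *)
Definition ucb n (f : rtuple R n -> R) : Prop :=
  (exists c, forall k, `|f k| <= c) /\
  forall eps, 0 < eps -> exists2 d, 0 < d &
    forall k k', close d k k' -> `|f k - f k'| < eps.

Lemma ucb_cst n (c : R) : ucb (fun _ : rtuple R n => c).
Proof.
split; first by exists `|c|.
by move=> e e0; exists 1 => // k k' _; rewrite subrr normr0.
Qed.

Lemma ucbD n (f g : rtuple R n -> R) :
  ucb f -> ucb g -> ucb (fun k => f k + g k).
Proof.
move=> [[a fa] uf] [[b gb] ug]; split.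
  by exists (a + b) => k; rewrite (le_trans (ler_normD _ _))// lerD.
move=> e e0; have e2 : 0 < e / 2 by rewrite divr_gt0.
have [d d0 hd] := uf _ e2; have [d' d'0 hd'] := ug _ e2.
exists (Num.min d d'); first by rewrite lt_min d0.
move=> k k' kk'; rewrite opprD addrACA (le_lt_trans (ler_normD _ _))//.
rewrite [ltRHS]splitr ltrD//; [apply: hd|apply: hd'] => i.
  by apply: lt_le_trans (kk' i) _; rewrite ge_min lexx.
by apply: lt_le_trans (kk' i) _; rewrite ge_min lexx orbT.
Qed.

Lemma ucbM n (f g : rtuple R n -> R) :
  ucb f -> ucb g -> ucb (fun k => f k * g k).
Proof.
move=> [[a fa] uf] [[b gb] ug]; split.
  by exists (a * b) => k; rewrite normrM ler_pM.
move=> e e0.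
(* [c] bounds both functions and is positive even when they vanish, so that it can be divided by. *)
pose c := `|a| + `|b| + 1.
have c0 : 0 < c by rewrite /c ltr_wpDl// addr_ge0.
have e2 : 0 < e / (2 * c) by rewrite divr_gt0// mulr_gt0.
have [d d0 hd] := uf _ e2; have [d' d'0 hd'] := ug _ e2.
exists (Num.min d d'); first by rewrite lt_min d0.
move=> k k' kk'.
have fk : `|f k| <= c.
  by apply: le_trans (fa k) _; rewrite /c; have := ler_norm a; have := normr_ge0 b; lra.
have gk : `|g k'| <= c.
  by apply: le_trans (gb k') _; rewrite /c; have := ler_norm b; have := normr_ge0 a; lra.
have h1 : `|f k - f k'| < e / (2 * c).
  by apply: hd => i; apply: lt_le_trans (kk' i) _; rewrite ge_min lexx.
have h2 : `|g k - g k'| < e / (2 * c).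
  by apply: hd' => i; apply: lt_le_trans (kk' i) _; rewrite ge_min lexx orbT.
have -> : f k * g k - f k' * g k' = f k * (g k - g k') + (f k - f k') * g k' by ring.
apply: (le_lt_trans (ler_normD _ _)); rewrite !normrM.
have ec : e / (2 * c) * c = e / 2 by field; rewrite gt_eqF.
rewrite [ltRHS]splitr; apply: ltr_leD.
  apply: (@le_lt_trans _ _ (c * `|g k - g k'|)); first exact: ler_wpM2r.
  by rewrite -ec mulrC ltr_pM2r.
rewrite -ec; apply: ler_pM => //; exact: ltW.
Qed.

Lemma ucbN n (f : rtuple R n -> R) : ucb f -> ucb (fun k => - f k).
Proof.
move=> uf; have := ucbM (ucb_cst n (-1)) uf.
by under eq_fun do rewrite mulN1r.
Qed.

Lemma ucb_coord n (g : R -> R) (i : 'I_n) :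
  (exists c, forall x, `|g x| <= c) ->
  (exists2 c, 0 < c & forall x y, `|g x - g y| <= c * `|x - y|) ->
  ucb (fun k : rtuple R n => g (tnth k i)).
Proof.
move=> [c gc] [b b0 gb]; split; first by exists c.
move=> e e0; exists (e / b); first by rewrite divr_gt0.
move=> k k' kk'; apply: le_lt_trans (gb _ _) _.
by rewrite mulrC -ltr_pdivlMr.
Qed.

Lemma ucb_clamp n (f : rtuple R n -> R) : ucb f -> ucb (f \o @clamp n).
Proof.
move=> [[c fc] uf]; split; first by exists c => k /=.
move=> e /uf[d d0 hd]; exists d => // k k' kk' /=.
by apply: hd; exact: close_clamp.
Qed.

Lemma tnth_point n (v : 'rV[R]_n) i : tnth (point_of_row v) i = v ord0 i.
Proof. by rewrite tnth_mktuple. Qed.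

Definition row_of_point n (k : rtuple R n) : 'rV[R]_n :=
  \row_i (tnth k i : R).

Lemma row_of_pointK n : cancel (@row_of_point n) (@point_of_row R n).
Proof.
by move=> k; apply: eq_from_tnth => i; rewrite tnth_point mxE.
Qed.

Local Notation cubeR n := [set v : 'rV[R]_n | cube n (point_of_row v)].

Lemma compact_cubeR n : compact (cubeR n).
Proof.
rewrite (_ : cubeR n = [set v : 'rV[R]_n | forall i, `[0%R, 1%R]%classic (v ord0 i)]).
  by apply: (@rV_compact R n (fun=> `[0, 1]%classic)) => i; exact: segment_compact.
apply/seteqP; split => v /= h i.
  by have := h i; rewrite tnth_point in_itv.
by rewrite tnth_point; have := h i; rewrite in_itv.
Qed.

Lemma ucb_continuous n (f : rtuple R n -> R) :
  ucb f -> continuous (f \o @point_of_row R n).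
Proof.
move=> [_ uf] v U /nbhs_ballP[e e0 hU].
have [d d0 hd] := uf _ e0.
apply/nbhs_ballP; exists d => // w [_ vw] /=.
apply: hU; apply: hd => i; rewrite !tnth_point.
by have := vw ord0 i.
Qed.

(** In the near-covering form of compactness, [P d v] says that [d] is a modulus at [v] for the
    tolerance [e]. Continuity at [x] gives this for all small [d] at all points of the cube near
    [x], and compactness makes one [d] serve everywhere. Clamping does not increase distances, so
    the modulus extends to R^n. *)
Lemma heine_cantor n (f : rtuple R n -> R) :
  {within cubeR n, continuous (f \o @point_of_row R n)} ->
  ucb (f \o @clamp n).
Proof.
move=> cf; have cK := @compact_cubeR n; split.
  have /compact_bounded [M [_ hM]] : compact ((f \o @point_of_row R n) @` cubeR n : set R^o).
    exact: continuous_compact.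
  exists (M + 1) => k /=; apply: hM; first by rewrite ltrDl.
  exists (row_of_point (clamp k)); last by rewrite /= row_of_pointK.
  by rewrite /= row_of_pointK; exact: cube_clamp.
move=> e e0.
have /compact_near_coveringP/near_covering_withinP cov := cK.
pose P (d : R) (v : 'rV[R]_n) := forall w, cubeR n w ->
  (forall i, `|v ord0 i - w ord0 i| < d) ->
  `|f (point_of_row v) - f (point_of_row w)| < e.
have : \forall d \near 0^'+, cubeR n `<=` P d.
  apply: cov => x xc.
  have e2 : 0 < e / 2 by rewrite divr_gt0.
  have /subspace_continuousP/(_ x xc) cx := cf.
  have hx : nbhs x [set y | cubeR n y ->
      ball (f (point_of_row x)) (e / 2) (f (point_of_row y))].
    by apply: (cx (ball (f (point_of_row x)) (e / 2))); exact: nbhsx_ballx.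
  have /nbhs_ballP[r /= r0 hr] := hx.
  have r2 : 0 < r / 2 by rewrite divr_gt0.
  exists (ball x (r / 2), [set d : R | 0 < d < r / 2]) => /=.
    split; first exact: nbhsx_ballx.
    apply/nbhs_ballP; exists (r / 2) => //= d; rewrite /ball/= sub0r normrN.
    by move=> dr d0; rewrite d0/= (le_lt_trans (ler_norm _)).
  move=> [y d] /= [[_ xy] /andP[d0 dr]] yc w wc yw.
  have /= hy : ball (f (point_of_row x)) (e / 2) (f (point_of_row y)).
    apply: hr yc; split => // i j; apply: lt_le_trans (xy i j) _.
    by rewrite ler_pdivrMr// ler_peMr ?ltW// ltr1n.
  have /= hw : ball (f (point_of_row x)) (e / 2) (f (point_of_row w)).
    apply: hr wc; split => // i j; rewrite ord1 /ball/=.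
    rewrite [r]splitr -(subrKA (y ord0 j)) (le_lt_trans (ler_normD _ _))// ltrD//.
      exact: xy.
    exact: lt_trans (yw j) dr.
  rewrite [e]splitr -(subrKA (f (point_of_row x))) (le_lt_trans (ler_normD _ _))//.
  by rewrite ltrD// distrC.
move=> /nbhs_ballP[d /= d0 hd]; have d2 : 0 < d / 2 by rewrite divr_gt0.
exists (d / 2) => // k k' kk'.
have hP : cubeR n `<=` P (d / 2).
  apply: hd => //; rewrite /ball/= sub0r normrN gtr0_norm//.
  by rewrite ltr_pdivrMr// ltr_pMr// ltr1n.
have := hP (row_of_point (clamp k)) _ (row_of_point (clamp k')).
rewrite /= !row_of_pointK; apply; try exact: cube_clamp.
by move=> i; rewrite !mxE; exact: close_clamp.
Qed.

End Clamp.

Section ComplexParts.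
Context {R : realType}.
Implicit Types z w : R[i].

Lemma cReD z w : Re (z + w) = Re z + Re w. Proof. by case: z; case: w. Qed.
Lemma cImD z w : Im (z + w) = Im z + Im w. Proof. by case: z; case: w. Qed.
Lemma cReN z : Re (- z) = - Re z. Proof. by case: z. Qed.
Lemma cImN z : Im (- z) = - Im z. Proof. by case: z. Qed.
Lemma cReM z w : Re (z * w) = Re z * Re w - Im z * Im w.
Proof. by case: z; case: w. Qed.
Lemma cImM z w : Im (z * w) = Re z * Im w + Im z * Re w.
Proof. by case: z => a b; case: w => c d. Qed.
Lemma cReV z : Re z^-1 = Re z * (Re z ^+ 2 + Im z ^+ 2)^-1.
Proof. by case: z. Qed.
Lemma cImV z : Im z^-1 = - (Im z * (Re z ^+ 2 + Im z ^+ 2)^-1).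
Proof. by case: z. Qed.

Lemma cRe_sum I (r : seq I) (P : pred I) (F : I -> R[i]) :
  Re (\sum_(i <- r | P i) F i) = \sum_(i <- r | P i) Re (F i).
Proof. by apply: (big_morph Re cReD). Qed.

Lemma cIm_sum I (r : seq I) (P : pred I) (F : I -> R[i]) :
  Im (\sum_(i <- r | P i) F i) = \sum_(i <- r | P i) Im (F i).
Proof. by apply: (big_morph Im cImD). Qed.

Lemma eqReIm z w : Re z = Re w -> Im z = Im w -> z = w.
Proof. by case: z => a b; case: w => c d /= -> ->. Qed.

Lemma norm_Re z : `|Re z| <= normc z.
Proof. by rewrite -lecR; exact: normc_ge_Re. Qed.

Lemma norm_Im z : `|Im z| <= normc z.
Proof.
case: z => a b /=; rewrite -sqrtr_sqr; apply: ler_wsqrtr.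
by rewrite lerDr sqr_ge0.
Qed.

Lemma normc_ReIm z : normc z <= `|Re z| + `|Im z|.
Proof.
case: z => a b /=; rewrite -[leRHS]ger0_norm ?addr_ge0// -sqrtr_sqr.
apply: ler_wsqrtr; rewrite sqrrD !real_normK ?num_real// -addrA lerD2l lerDr.
by rewrite mulrn_wge0// mulr_ge0.
Qed.

Lemma normcE' z : `|z| = (normc z)%:C.
Proof. by case: z. Qed.

Lemma normc_gt0 z : z != 0 -> 0 < Re z ^+ 2 + Im z ^+ 2.
Proof.
rewrite lt_def addr_ge0 ?sqr_ge0// andbT; apply: contraNneq => h.
case: z h => a b /= /eqP.
by rewrite paddr_eq0 ?sqr_ge0// !sqrf_eq0 => /andP[/eqP-> /eqP->].
Qed.

Lemma Re_continuous : continuous (Re : R[i]^o -> R).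
Proof.
move=> z U /nbhs_ballP[e /= e0 hU].
apply/nbhs_ballP; exists e%:C => /=; first by rewrite ltcR.
move=> w; rewrite /ball/= normcE' ltcR => zw; apply: hU.
by apply: le_lt_trans zw; rewrite -cReN -cReD norm_Re.
Qed.

Lemma Im_continuous : continuous (Im : R[i]^o -> R).
Proof.
move=> z U /nbhs_ballP[e /= e0 hU].
apply/nbhs_ballP; exists e%:C => /=; first by rewrite ltcR.
move=> w; rewrite /ball/= normcE' ltcR => zw; apply: hU.
by apply: le_lt_trans zw; rewrite -cImN -cImD norm_Im.
Qed.

End ComplexParts.

Section SymbolRing.
Context {R : realType} {N : nat}.
Local Notation cfun := (rtuple R N -> R[i]).

(* Continuous functions on the cube, extended to R^N by clamping each
   coordinate to [0,1]. *)
Definition csym : {pred cfun} := mem [set f : cfun |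
  [/\ ucb (Re \o f), ucb (Im \o f) & forall k, f (clamp k) = f k]].

Lemma csym_subring_closed : subring_closed csym.
Proof.
split.
- by rewrite inE /=; split => //; exact: ucb_cst.
- move=> f g; rewrite !inE /= => -[rf jf cf] [rg ig cg]; split.
  + rewrite (_ : _ \o _ = fun k => Re (f k) + - Re (g k)).
      by apply: ucbD => //; exact: ucbN.
    by apply/funext => k /=; rewrite cReD cReN.
  + rewrite (_ : _ \o _ = fun k => Im (f k) + - Im (g k)).
      by apply: ucbD => //; exact: ucbN.
    by apply/funext => k /=; rewrite cImD cImN.
  + by move=> k; rewrite -[LHS]/(f (clamp k) - g (clamp k)) cf cg.
- move=> f g; rewrite !inE /= => -[rf jf cf] [rg ig cg]; split.
  + rewrite (_ : _ \o _ = fun k => Re (f k) * Re (g k) + - (Im (f k) * Im (g k))).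
      by apply: ucbD; [exact: ucbM|apply: ucbN; exact: ucbM].
    by apply/funext => k /=; rewrite cReM.
  + rewrite (_ : _ \o _ = fun k => Re (f k) * Im (g k) + Im (f k) * Re (g k)).
      by apply: ucbD; exact: ucbM.
    by apply/funext => k /=; rewrite cImM.
  + by move=> k; rewrite -[LHS]/(f (clamp k) * g (clamp k)) cf cg.
Qed.

HB.instance Definition _ :=
  GRing.isSubringClosed.Build _ csym csym_subring_closed.

Record CF := MkCF { CF_fun :> cfun; CF_funP : CF_fun \in csym }.

HB.instance Definition _ := [isSub of CF for CF_fun].
HB.instance Definition _ := [Choice of CF by <:].
HB.instance Definition _ := [SubChoice_isSubComNzRing of CF by <:].

Lemma CF_eqP (f g : CF) : (forall k, f k = g k) -> f = g.
Proof. by move=> fg; apply: val_inj; exact/funext. Qed.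

Lemma CF_clamp (f : CF) k : f (clamp k) = f k.
Proof. by have := CF_funP f; rewrite inE => -[]. Qed.

Lemma CF_eq_cube (f g : CF) : (forall k, cube N k -> f k = g k) -> f = g.
Proof.
move=> fg; apply: CF_eqP => k; rewrite -(CF_clamp f) -(CF_clamp g).
by apply: fg; exact: cube_clamp.
Qed.

Lemma CF_Re (f : CF) : ucb (fun k => Re (f k)).
Proof. by have := CF_funP f; rewrite inE => -[]. Qed.

Lemma CF_Im (f : CF) : ucb (fun k => Im (f k)).
Proof. by have := CF_funP f; rewrite inE => -[]. Qed.

Lemma csymP (f : cfun) : ucb (fun k => Re (f k)) -> ucb (fun k => Im (f k)) ->
  (forall k, f (clamp k) = f k) -> f \in csym.
Proof. by move=> rf jf cf; rewrite inE. Qed.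

(* The default value is never reached for functions continuous on the cube. *)
Definition mkCF (f : cfun) : CF := insubd 0 (f \o @clamp R N).

Lemma mkCFE (f : cfun) k :
  ucb (fun k => Re (f (clamp k))) -> ucb (fun k => Im (f (clamp k))) ->
  mkCF f k = f (clamp k).
Proof.
move=> rf jf; rewrite /mkCF /insubd insubT//=.
by apply: csymP => // k' /=; rewrite clampK.
Qed.

Definition ev k (f : CF) : R[i] := f k.

Lemma CF_D (f g : CF) k : (f + g) k = f k + g k. Proof. by []. Qed.
Lemma CF_M (f g : CF) k : (f * g) k = f k * g k. Proof. by []. Qed.
Lemma CF_N (f : CF) k : (- f) k = - f k. Proof. by []. Qed.
Lemma CF_1 k : (1 : CF) k = 1. Proof. by []. Qed.
Lemma CF_0 k : (0 : CF) k = 0. Proof. by []. Qed.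

Definition CF_unit : {pred CF} := mem [set f : CF | forall k, f k != 0].

(** Since 1/f is the conjugate of f divided by |f|^2, only the reciprocal of |f|^2 needs a modulus.
    It is continuous and invariant under clamping, so [heine_cantor] provides one. *)
Lemma csym_inv (f : CF) : (forall k, f k != 0) -> (fun k => (f k)^-1) \in csym.
Proof.
move=> f0; pose g k := Re (f k) ^+ 2 + Im (f k) ^+ 2.
have gu : ucb g.
  by apply: ucbD; apply: ucbM; first [exact: CF_Re|exact: CF_Im].
have gV : ucb (fun k => (g k)^-1).
  rewrite (_ : (fun _ => _) = (fun k => (g k)^-1) \o @clamp R N).
    apply: heine_cantor; apply: continuous_subspaceT => v.
    apply: (@continuousV _ _ (g \o @point_of_row R N)); last exact: ucb_continuous.
    by rewrite gt_eqF// normc_gt0.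
  by apply/funext => k; rewrite /g /= CF_clamp.
apply: csymP.
- under eq_fun do rewrite cReV.
  by apply: ucbM => //; exact: CF_Re.
- under eq_fun do rewrite cImV.
  by apply: ucbN; apply: ucbM => //; exact: CF_Im.
- by move=> k; rewrite CF_clamp.
Qed.

Definition CF_inv (f : CF) : CF :=
  if f \in CF_unit then insubd 0 (fun k => (f k)^-1) else f.

Lemma CF_invE (f : CF) k : (forall k, f k != 0) -> CF_inv f k = (f k)^-1.
Proof.
move=> f0; rewrite /CF_inv ifT; last by rewrite inE.
by rewrite /insubd insubT//; exact: csym_inv.
Qed.

Let CF_mulVx : {in CF_unit, left_inverse 1 CF_inv *%R}.
Proof.
move=> f; rewrite inE /= => f0; apply: CF_eqP => k.
by rewrite CF_M CF_invE// mulVf// CF_1.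
Qed.

Let CF_unitPl (f g : CF) : g * f = 1 -> CF_unit f.
Proof.
move=> gf; rewrite -[is_true _]/(is_true (f \in CF_unit)) inE => k /=.
have := congr1 (ev k) gf; rewrite /ev CF_M CF_1.
by apply: contra_eqN => /eqP ->; rewrite mulr0 eq_sym oner_eq0.
Qed.

Let CF_invr_out : {in [predC CF_unit], CF_inv =1 id}.
Proof. by move=> f; rewrite !inE /CF_inv => /negbTE h; rewrite ifF// -h inE. Qed.

HB.instance Definition _ :=
  GRing.ComNzRing_hasMulInverse.Build CF CF_mulVx CF_unitPl CF_invr_out.

Lemma CF_unitP (f : CF) :
  (f \is a GRing.unit) <-> (forall k, cube N k -> f k != 0).
Proof.
rewrite -[f \is a _]/(f \in CF_unit) inE /=; split=> [h k _|h k]; first exact: h.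
by rewrite -CF_clamp; apply: h; exact: cube_clamp.
Qed.

Let ev_zmod k : zmod_morphism (ev k). Proof. by []. Qed.
HB.instance Definition _ k :=
  GRing.isZmodMorphism.Build CF R[i] (ev k) (@ev_zmod k).
Let ev_monoid k : monoid_morphism (ev k). Proof. by []. Qed.
HB.instance Definition _ k :=
  GRing.isMonoidMorphism.Build CF R[i] (ev k) (@ev_monoid k).

Definition mxev p q k (A : 'M[CF]_(p, q)) : 'M[R[i]]_(p, q) := map_mx (ev k) A.

Lemma mxev_inv p (A : 'M[CF]_p) k :
  A \in unitmx -> mxev k (invmx A) = invmx (mxev k A).
Proof.
move=> uA; have uk : mxev k A \in unitmx.
  by rewrite unitmxE det_map_mx rmorph_unit// -unitmxE.
have := congr1 (mxev k) (mulmxV uA).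
rewrite /mxev map_mxM map_mx1 => /(congr1 (mulmx (invmx (mxev k A)))).
by rewrite mulKmx// mulmx1.
Qed.

(** At each point, P(t) = det(1 + tX) satisfies P(t) P(-t) = det(1 - t^2 X^2) = 1. It is therefore a
    unit of C[t], hence constant, and P(1) = P(0) = 1. *)
Lemma CF_det_nil2 n (X : 'M[CF]_n) : X *m X = 0 -> \det (1%:M + X) = 1.
Proof.
move=> XX; apply: CF_eqP => k.
rewrite -[LHS]/(ev k _) -det_map_mx map_mxD map_mx1.
have : mxev k X *m mxev k X = 0 by rewrite -map_mxM XX map_mx0.
rewrite -/(mxev k X); move: (mxev k X) => {XX}X XX.
pose P : {poly R[i]} := \det (1%:M + 'X *: map_mx polyC X).
have PM : P * (P \Po - 'X) = 1.
  have -> : P \Po - 'X = \det (1%:M - 'X *: map_mx polyC X).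
    rewrite /P -det_map_mx; congr (\det _); apply/matrixP => i j.
    rewrite !mxE rmorphD rmorphM /= comp_polyC comp_polyX mulNr.
    by congr (_ - _); case: (_ == _) => /=; rewrite ?mulr1n ?mulr0n ?rmorph1 ?rmorph0.
  rewrite /P -det_mulmx; set A := 'X *: _.
  have AA : A *m A = 0.
    by rewrite -scalemxAl -scalemxAr -map_mxM XX map_mx0 !scaler0.
  by rewrite mulmxBr mulmx1 mulmxDl mul1mx AA addr0 addrK det1.
have /size_poly1P[c _ Pc] : size P == 1%N.
  have : P \is a GRing.unit by apply/unitrP; exists (P \Po - 'X); rewrite mulrC.
  by rewrite poly_unitE => /andP[].
have Ph a : P.[a] = \det (1%:M + a *: X).
  rewrite /P -horner_evalE -det_map_mx; congr (\det _); apply/matrixP => i j.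
  rewrite !mxE rmorphD rmorphM /= !horner_evalE hornerX hornerC.
  by congr (_ + _); case: (_ == _) => /=; rewrite ?mulr1n ?mulr0n ?hornerC.
have := Ph 1; rewrite scale1r => <-.
have := Ph 0; rewrite scale0r addr0 det1 Pc !hornerC => ->.
by rewrite CF_1.
Qed.

Lemma CF_cube_continuous (f : CF) :
  cube_continuous ((f : rtuple R N -> R[i]) : rtuple R N -> R[i]^o).
Proof.
apply: continuous_subspaceT => v U /nbhs_ballP[e /= e0 hU].
have e2 : 0 < Re e / 2.
  by rewrite divr_gt0//; move: e0; rewrite ltcE => /andP[].
have eE : e = (Re e)%:C.
  by rewrite RRe_real// gtr0_real.
have [_ /(_ _ e2)[d d0 hd]] := CF_Re f.
have [_ /(_ _ e2)[d' d'0 hd']] := CF_Im f.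
apply/nbhs_ballP; exists (Num.min d d'); first by rewrite /= lt_min d0.
move=> w [_ vw] /=; apply: hU; rewrite /ball/= normcE' eE ltcR.
apply: le_lt_trans (normc_ReIm _) _; rewrite [ltRHS]splitr cReD cReN cImD cImN.
rewrite ltrD//.
  apply: hd => i; rewrite !tnth_point; apply: lt_le_trans (vw ord0 i) _.
  by rewrite ge_min lexx.
apply: hd' => i; rewrite !tnth_point; apply: lt_le_trans (vw ord0 i) _.
by rewrite ge_min lexx orbT.
Qed.

Lemma cube_continuous_ucb (f : cfun) :
  cube_continuous (f : rtuple R N -> R[i]^o) ->
  ucb (fun k => Re (f (clamp k))) /\ ucb (fun k => Im (f (clamp k))).
Proof.
move=> /subspace_continuousP cf; split.
  apply: (@heine_cantor R N (Re \o f)); apply/subspace_continuousP => v vc.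
  apply: cvg_trans (@Re_continuous R (f (point_of_row v))).
  move=> U /= hU; exact: (cf v vc _ hU).
apply: (@heine_cantor R N (Im \o f)); apply/subspace_continuousP => v vc.
apply: cvg_trans (@Im_continuous R (f (point_of_row v))).
move=> U /= hU; exact: (cf v vc _ hU).
Qed.

Lemma mkCF_continuous (f : cfun) k :
  cube_continuous (f : rtuple R N -> R[i]^o) -> cube N k -> mkCF f k = f k.
Proof. by move=> /cube_continuous_ucb[rf jf] kc; rewrite mkCFE// clamp_id. Qed.

Lemma continuous_mx_entry p q (A : rtuple R N -> 'M[R[i]]_(p, q)) i j :
  continuous_mx A ->
  cube_continuous ((fun k => A k i j) : rtuple R N -> R[i]^o).
Proof.
move=> /subspace_continuousP cA; apply/subspace_continuousP => v vc U hU.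
apply: (cA v vc [set M : 'M[R[i]^o]_(p, q) | U (M i j)]).
exists (fun i' j' => [set x | (i', j') = (i, j) -> U x]).
  move=> i' j' /=; have [[-> ->]|ne] := pselect ((i', j') = (i, j)).
    by apply: filterS hU => x Ux _.
  by apply: filterE => x /ne.
by move=> M /= hM; exact: hM.
Qed.

Definition mkmx p q (A : rtuple R N -> 'M[R[i]]_(p, q)) : 'M[CF]_(p, q) :=
  \matrix_(i, j) mkCF (fun k => A k i j).

Lemma mxev_mkmx p q (A : rtuple R N -> 'M[R[i]]_(p, q)) k :
  continuous_mx A -> cube N k -> mxev k (mkmx A) = A k.
Proof.
move=> cA kc; apply/matrixP => i j; rewrite !mxE /ev mkCF_continuous//.
exact: continuous_mx_entry.
Qed.

Lemma mxev_continuous p q (A : 'M[CF]_(p, q)) :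
  continuous_mx (fun k => mxev k A).
Proof.
apply/subspace_continuousP => v vc U [P hP hU].
have h : \forall w \near within [set v | cube N (point_of_row v)] (nbhs v),
    forall i j, P i j (A i j (point_of_row w)).
  apply: filter_forall => i; apply: filter_forall => j.
  have /subspace_continuousP/(_ v vc) ch := @CF_cube_continuous (A i j).
  by apply: ch; have := hP i j; rewrite /from_subspace mxE.
apply: filterS h => w h /=; apply: hU => i j /=; rewrite mxE; exact: h.
Qed.

End SymbolRing.
Arguments CF : clear implicits.

(** * Integration over the cube *)

Section CubeMeasure.
Context {R : realType}.
Local Notation mu n := (@leb_cube R n).
Local Notation unif := (uniform_prob (@ltr01 R)).

Lemma unif_itv (A : set (measurableTypeR R)) : measurable A ->
  unif A = lebesgue_measure (A `&` `[0%R, 1%R]%classic).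
Proof.
move=> mA; rewrite /uniform_prob integral_uniform_pdf.
transitivity (\int[lebesgue_measure]_(x in A `&` `[0%R, 1%R]%classic) (cst 1%E : _ -> \bar R) x)%E.
  apply: eq_integral => x; rewrite inE => -[_ /= x01].
  by move: x01; rewrite in_itv /uniform_pdf => ->; rewrite subr0 invr1.
rewrite integral_cst ?mul1e//; apply: measurableI => //.
Qed.

Lemma unif_ball_le (c e : R) : 0 <= e ->
  (unif [set x : measurableTypeR R | (`|(x : R) - c| <= e)%R] <= (2 * e)%:E)%E.
Proof.
move=> e0; rewrite (_ : [set _ | _] = `[c - e, c + e]%classic); last first.
  by apply/seteqP; split => x /=; rewrite in_itv/= ler_distl.
rewrite unif_itv//.
apply: (@le_trans _ _ (lebesgue_measure (`[(c - e)%R, (c + e)%R]%classic : set R))).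
  apply: le_measure; rewrite ?inE//; apply: measurableI => //.
rewrite lebesgue_measure_itv/=; case: ifPn => _; last first.
  by rewrite lee_fin mulr_ge0.
by rewrite -EFinB lee_fin opprB addrA; lra.
Qed.

Lemma unif_ball_gt0 (c e : R) : (0 <= c <= 1)%R -> (0 < e)%R ->
  (0 < unif [set x : measurableTypeR R | (`|(x : R) - c| < e)%R])%E.
Proof.
move=> /andP[c0 c1] e0.
have -> : [set x : measurableTypeR R | (`|(x : R) - c| < e)%R] =
    `]c - e, c + e[%classic.
  by apply/seteqP; split => x /=; rewrite in_itv/= ltr_distl.
rewrite unif_itv//.
pose a := Num.max 0 (c - e); pose b := Num.min 1 (c + e).
have ab : a < b.
  by rewrite /a /b gt_max !lt_min ltr01/=; apply/andP; split; [lra|apply/andP; split; lra].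
apply: (@lt_le_trans _ _ (lebesgue_measure (`]a, b[%classic : set R))).
  by rewrite lebesgue_measure_itv/= lte_fin ab -EFinB lte_fin subr_gt0.
apply: le_measure; rewrite ?inE//; first exact: measurableI.
move=> x /=; rewrite !in_itv/= => /andP[]; rewrite /a /b gt_max lt_min.
by move=> /andP[x0 cx] /andP[x1 xc]; rewrite cx xc (ltW x0) (ltW x1).
Qed.

Lemma leb_cubeS n (A : set (measurableTypeR R)) (B : set (rtuple R n))
    (S : set (rtuple R n.+1)) :
  measurable A -> measurable B -> @cons_point R n @^-1` S = A `*` B ->
  mu n.+1 S = (unif A * mu n B)%E.
Proof.
move=> mA mB SAB; rewrite [LHS]/= /distribution /pushforward SAB.
exact: product_measure1E.
Qed.

Lemma leb_cube_cube n : mu n (@cube R n) = 1%E.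
Proof.
elim: n => [|n IH].
  rewrite (_ : cube 0 = setT); first exact: probability_setT.
  by apply/seteqP; split => // x _ [].
rewrite (@leb_cubeS n `[0%R, 1%R]%classic (cube n))//; first last.
- apply/seteqP; split => -[a x] /= h.
    split=> /=; first by have := h ord0; rewrite in_itv.
    by move=> i; have := h (lift ord0 i); rewrite tnthS.
  move=> i; have [h1 h2] := h; case: (unliftP ord0 i) => [j ->|->].
    by rewrite tnthS; exact: h2.
  by move: h1; rewrite /= in_itv.
- exact: measurable_cube.
by rewrite IH mule1 unif_itv// setIid lebesgue_measure_itv/= lte_fin ltr01 oppr0 adde0.
Qed.

(** The source of the factors d in the localization estimates: functions concentrated near a slice
    have small square norm. *)
Lemma leb_cube_slab n (i : 'I_n) (c e : R) : 0 <= e ->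
  (mu n [set x | (`|tnth x i - c| <= e)%R] <= (2 * e)%:E)%E.
Proof.
move=> e0; have mslab m (j : 'I_m) :
    measurable [set x : rtuple R m | (`|tnth x j - c| <= e)%R].
  have -> : [set x : rtuple R m | (`|tnth x j - c| <= e)%R] =
     (fun k => tnth k j) @^-1` (`[c - e, c + e]%classic : set (measurableTypeR R)).
    by apply/seteqP; split => x /=; rewrite in_itv/= ler_distl.
  rewrite -[X in measurable X]setTI.
  by apply: measurable_tnth => //; exact: measurable_itv.
elim: n i => [[]//|n IH i]; case: (unliftP ord0 i) => [j ->|->].
  rewrite (@leb_cubeS n setT [set x | (`|tnth x j - c| <= e)%R])//.
    by rewrite probability_setT mul1e.
  by apply/seteqP; split => -[a x] /=; rewrite tnthS// => -[].
rewrite (@leb_cubeS n [set x | (`|(x : R) - c| <= e)%R] setT)//.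
- by rewrite probability_setT mule1 unif_ball_le.
- have -> : [set x : R | `|x - c| <= e] = `[c - e, c + e]%classic.
    by apply/seteqP; split => x /=; rewrite in_itv/= ler_distl.
  exact: measurable_itv.
- by apply/seteqP; split => -[a x] //= [].
Qed.

(** Neighbourhoods of points of the cube have positive mass, also at the boundary; this makes the
    full average faithful on nonnegative continuous functions. *)
Lemma leb_cube_box n (c : rtuple R n) (e : R) : cube n c -> 0 < e ->
  measurable [set x | close e x c] /\ (0 < mu n [set x | close e x c])%E.
Proof.
move=> cc e0; have mball (d : R) :
    measurable [set x : measurableTypeR R | (`|(x : R) - d| < e)%R].
  have -> : [set x : R | `|x - d| < e] = `]d - e, d + e[%classic.
    by apply/seteqP; split => x /=; rewrite in_itv/= ltr_distl.
  exact: measurable_itv.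
have mbox m (d : rtuple R m) : measurable [set x | close e x d].
  rewrite (_ : [set x | close e x d] = \bigcap_(i in [set: 'I_m])
    ((fun k => tnth k i) @^-1` [set x | (`|(x : R) - tnth d i| < e)%R])).
    apply: fin_bigcap_measurable => // i _.
    by rewrite -[X in measurable X]setTI; apply: measurable_tnth.
  by apply/seteqP; split => x /= h i; [move=> _|]; exact: h.
split=> //; elim: n c cc => [|n IH] c cc.
  rewrite (_ : [set _ | _] = setT) ?probability_setT ?lte01//.
  by apply/seteqP; split => // x _ [].
rewrite (@leb_cubeS n [set x | (`|(x : R) - tnth c ord0| < e)%R]
   [set x | close e x [tuple of behead c]])//.
  by rewrite mule_gt0//; [exact: unif_ball_gt0|apply: IH => i; rewrite tnth_behead].
have tb (i : 'I_n) : tnth [tuple of behead c] i = tnth c (lift ord0 i).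
  by rewrite tnth_behead; congr (tnth c _); apply: val_inj; rewrite /= inordK// ltnS.
apply/seteqP; split => -[a x] /= h.
  split=> [|i]; first exact: (h ord0).
  by rewrite tb; have := h (lift ord0 i); rewrite tnthS.
case: h => h1 h2 i; case: (unliftP ord0 i) => [j ->|->] //.
by have := h2 j; rewrite tb tnthS.
Qed.

Lemma measurable_clamp n : measurable_fun setT (@clamp R n).
Proof.
apply/measurable_fun_tnthP => i.
rewrite (_ : _ \o _ = clamp01 \o (fun k => tnth k i)); last first.
  by apply/funext => k /=; rewrite tnth_mktuple.
apply: measurableT_comp; last exact: measurable_tnth.
apply: measurable_maxr; first exact: measurable_cst.
by apply: measurable_minr => //; exact: measurable_cst.
Qed.

Lemma subst_point_lt n j (x : rtuple R j) (k : rtuple R n) (i : 'I_n)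
  (ij : (i < j)%N) : tnth (subst_point x k) i = tnth x (Ordinal ij).
Proof. by rewrite tnth_mktuple ij (tnth_nth (0 : R)). Qed.

Lemma subst_point_ge n j (x : rtuple R j) (k : rtuple R n) (i : 'I_n) :
  (j <= i)%N -> tnth (subst_point x k) i = tnth k i.
Proof. by move=> ij; rewrite tnth_mktuple ltnNge ij. Qed.

Lemma measurable_subst_point n j :
  measurable_fun setT (fun p : rtuple R j * rtuple R n => subst_point p.1 p.2).
Proof.
apply/measurable_fun_tnthP => i; case: (ltnP i j) => ij.
  rewrite (_ : _ \o _ = (fun x => tnth x (Ordinal ij)) \o fst).
    by apply: measurableT_comp; [exact: measurable_tnth|exact: measurable_fst].
  by apply/funext => p /=; rewrite subst_point_lt.
rewrite (_ : _ \o _ = (fun x => tnth x i) \o snd).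
  by apply: measurableT_comp; [exact: measurable_tnth|exact: measurable_snd].
by apply/funext => p /=; rewrite subst_point_ge.
Qed.

Lemma subst_point_cons n j (a b : measurableTypeR R) (x : rtuple R j)
    (k : rtuple R n) :
  subst_point (cons_point (a, x)) (cons_point (b, k)) =
  cons_point (a, subst_point x k).
Proof.
apply: eq_from_tnth => i; case: (unliftP ord0 i) => [l ->|->]; last first.
  by rewrite tnth_mktuple.
have tS m (c : measurableTypeR R) (z : rtuple R m) (i' : 'I_m) :
    tnth (cons_point (c, z)) (lift ord0 i') = tnth z i' by exact: tnthS.
rewrite tS; case: (ltnP l j) => lj.
  have lj' : (lift ord0 l < j.+1)%N by rewrite lift0.
  rewrite subst_point_lt (subst_point_lt _ _ lj).
  by rewrite [LHS](tnth_nth (0 : R)) [RHS](tnth_nth (0 : R)).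
by rewrite (subst_point_ge _ _ lj) subst_point_ge ?lift0// tS.
Qed.

Lemma subst_point_subst n j i (x : rtuple R j) (y : rtuple R i)
    (k : rtuple R n) : (j <= i)%N ->
  subst_point x (subst_point y k) = subst_point (subst_point x y) k.
Proof.
move=> ji; apply: eq_from_tnth => l; case: (ltnP l j) => lj.
  have li := leq_trans lj ji.
  by rewrite !subst_point_lt.
rewrite subst_point_ge//; case: (ltnP l i) => li.
  by rewrite (subst_point_lt y k li) (subst_point_lt _ k li) subst_point_ge.
by rewrite !subst_point_ge.
Qed.

Lemma subst_point_absorb n j i (x : rtuple R j) (y : rtuple R i)
    (k : rtuple R n) : (i <= j)%N ->
  subst_point x (subst_point y k) = subst_point x k.
Proof.
move=> ij; apply: eq_from_tnth => l; case: (ltnP l j) => lj.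
  by rewrite !subst_point_lt.
by rewrite !subst_point_ge// (leq_trans ij).
Qed.

Lemma subst_point_full n (x k : rtuple R n) : subst_point x k = x.
Proof.
apply: eq_from_tnth => i; rewrite subst_point_lt.
by congr tnth; exact: val_inj.
Qed.

Lemma subst_point_tail n j (x : rtuple R j) (k k' : rtuple R n) :
  (forall i : 'I_n, (j <= i)%N -> tnth k i = tnth k' i) ->
  subst_point x k = subst_point x k'.
Proof.
move=> kk'; apply: eq_from_tnth => i; case: (ltnP i j) => ij.
  by rewrite !subst_point_lt.
by rewrite !subst_point_ge// kk'.
Qed.

Lemma cube_subst_point n j (x : rtuple R j) (k : rtuple R n) :
  cube j x -> cube n k -> cube n (subst_point x k).
Proof.
move=> xc kc i; case: (ltnP i j) => ij; first by rewrite subst_point_lt.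
by rewrite subst_point_ge.
Qed.

Lemma clamp_subst_point n j (x : rtuple R j) (k : rtuple R n) :
  clamp (subst_point x k) = subst_point (clamp x) (clamp k).
Proof.
apply: eq_from_tnth => i; rewrite tnth_mktuple; case: (ltnP i j) => ij.
  by rewrite !subst_point_lt tnth_mktuple.
by rewrite !subst_point_ge// tnth_mktuple.
Qed.

Local Open Scope ereal_scope.

Lemma integral_prob_cst d (T : measurableType d) (P : probability T R) r :
  \int[P]_x r = r.
Proof. by rewrite integral_cst//= probability_setT mule1. Qed.

Lemma ge0_integral_cubeS n (F : rtuple R n.+1 -> \bar R) :
  measurable_fun setT F -> (forall x, 0 <= F x) ->
  \int[mu n.+1]_x F x = \int[unif]_a \int[mu n]_x F (cons_point (a, x)).
Proof.
move=> mF F0; rewrite [LHS]ge0_integral_distribution// fubini_tonelli1//.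
  by apply: measurableT_comp => //; exact: measurable_cons_point.
by move=> x; exact: F0.
Qed.

Lemma measurable_avg_ge0 n j (F : rtuple R n -> \bar R) :
  measurable_fun setT F -> (forall x, 0 <= F x) ->
  measurable_fun setT (fun k => \int[mu j]_x F (subst_point x k)).
Proof.
move=> mF F0.
apply: (@measurable_fun_fubini_tonelli_G _ _ _ _ _ _
  (fun p : rtuple R j * rtuple R n => F (subst_point p.1 p.2))) => //.
by apply: measurableT_comp => //; exact: measurable_subst_point.
Qed.

(** The induction peels the first coordinate off both points: that of [k] is overwritten and
    integrates to the total mass 1, and that of [x] takes its place after an exchange of
    integrals. *)
Lemma ge0_integral_subst n j (F : rtuple R n -> \bar R) : (j <= n)%N ->
  measurable_fun setT F -> (forall x, 0 <= F x) ->
  \int[mu n]_k \int[mu j]_x F (subst_point x k) = \int[mu n]_k F k.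
Proof.
elim: n j F => [|n IH] [|j] F //= jn mF F0.
- apply: eq_integral => k _; rewrite integral_dirac//.
    rewrite diracT mul1e; congr F; apply: eq_from_tnth => i.
    by rewrite subst_point_ge.
  apply: measurableT_comp => //.
  exact: (measurableT_comp (@measurable_subst_point 0 0) (pair2_measurable k)).
- apply: eq_integral => k _; rewrite integral_dirac//.
    rewrite diracT mul1e; congr F; apply: eq_from_tnth => i.
    by rewrite subst_point_ge.
  apply: measurableT_comp => //.
  exact: (measurableT_comp (@measurable_subst_point n.+1 0) (pair2_measurable k)).
rewrite -[RHS]/(\int[mu n.+1]_k F k) -[LHS]/(\int[mu n.+1]_k \int[mu j.+1]_x F (subst_point x k)).
rewrite !ge0_integral_cubeS//; [|exact: measurable_avg_ge0|]; last first.
  by move=> k; apply: integral_ge0.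
pose G (p : rtuple R n * measurableTypeR R) :=
  \int[mu j]_x F (cons_point (p.2, subst_point x p.1)).
have mG : measurable_fun setT G.
  apply: (@measurable_fun_fubini_tonelli_F _ _ _ _ _ _
    (fun q : (rtuple R n * measurableTypeR R) * rtuple R j =>
      F (cons_point (q.1.2, subst_point q.2 q.1.1)))) => //.
  apply: measurableT_comp => //.
  apply: measurableT_comp; first exact: measurable_cons_point.
  apply: measurable_fun_pair => /=.
    by apply: measurableT_comp; [exact: measurable_snd|exact: measurable_fst].
  apply: (measurableT_comp (@measurable_subst_point n j)
    (@measurable_fun_pair _ _ _ _ _ _
      (fun q : (rtuple R n * measurableTypeR R) * rtuple R j => q.2)
      (fun q => q.1.1) _ _)); first exact: measurable_snd.
  by apply: measurableT_comp; [exact: measurable_fst|exact: measurable_fst].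
have G0 p : 0 <= G p by apply: integral_ge0.
transitivity (\int[unif]_b \int[mu n]_k \int[unif]_a G (k, a)).
  apply: eq_integral => b _; apply: eq_integral => k _.
  rewrite ge0_integral_cubeS//; last first.
    apply: measurableT_comp => //.
    exact: (measurableT_comp (@measurable_subst_point n.+1 j.+1) (pair2_measurable _)).
  apply: eq_integral => a _; apply: eq_integral => x _.
  by rewrite subst_point_cons.
rewrite [LHS]integral_prob_cst fubini_tonelli//.
apply: eq_integral => a _.
rewrite [LHS](IH j (fun k => F (cons_point (a, k))))//.
apply: measurableT_comp => //.
exact: (measurableT_comp (@measurable_cons_point R n) (pair1_measurable _)).
Qed.

End CubeMeasure.

(** * Fubini for averages over the first coordinates *)

Section CubeIntegral.
Context {R : realType}.
Local Notation mu n := (@leb_cube R n).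
Local Notation cube := (@cube R).
Local Open Scope ereal_scope.

Lemma ae_cube n : {ae mu n, forall x, cube n x}.
Proof.
have h0 : mu n (~` cube n) = 0.
  rewrite (probability_setC _ (@measurable_cube R n)) leb_cube_cube.
  by rewrite subee.
by exists (~` cube n); split => //; apply: measurableC; exact: (@measurable_cube R n).
Qed.

Lemma measurable_comp_clamp n d (T : measurableType d) (f : rtuple R n -> T) :
  measurable_fun (cube n) f -> measurable_fun setT (f \o @clamp R n).
Proof.
move=> mf; apply: (measurable_comp _ _ mf (@measurable_clamp R n)).
  exact: measurable_cube.
by move=> _ [x _ <-]; exact: cube_clamp.
Qed.

(** The measure is carried by the cube, so clamping does not change the integral, and it yields a
    function measurable everywhere, to which the theorems on product measures apply. *)
Lemma integral_cube n (F : rtuple R n -> \bar R) :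
  measurable_fun (cube n) F ->
  \int[mu n]_(x in cube n) F x = \int[mu n]_x F (clamp x).
Proof.
move=> mF; rewrite integral_mkcond; apply: ae_eq_integral => //.
- exact/(measurable_restrictT _ (@measurable_cube R n)).
- exact: measurable_comp_clamp.
- have := ae_cube n; apply: filterS => x xc _.
  by rewrite patchT ?inE// clamp_id.
Qed.

Lemma integrable_clamp n (F : rtuple R n -> \bar R) :
  measurable_fun (cube n) F ->
  (mu n).-integrable (cube n) F <-> (mu n).-integrable setT (F \o @clamp R n).
Proof.
move=> mF; have mT := measurable_comp_clamp mF.
have mN : measurable_fun (cube n) (fun x => `|F x|).
  exact: measurableT_comp.
split=> /integrableP[_ h]; apply/integrableP; split => //.
  by move: h; rewrite (integral_cube mN).
by rewrite (integral_cube mN).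
Qed.

Lemma measurable_close n (e : R) (d : rtuple R n) :
  measurable [set x | close e x d].
Proof.
rewrite (_ : [set x | close e x d] = \bigcap_(i in [set: 'I_n])
  ((fun k => tnth k i) @^-1`
     (`](tnth d i - e)%R, (tnth d i + e)%R[%classic : set (measurableTypeR R)))).
  apply: fin_bigcap_measurable => // i _.
  rewrite -[X in measurable X]setTI.
  by apply: measurable_tnth => //; exact: measurable_itv.
apply/seteqP; split => x /= h i; first by move=> _ /=; rewrite in_itv/= -ltr_distl.
by have := h i I; rewrite /= in_itv/= -ltr_distl.
Qed.

(* The set {f > a} is a union of boxes with rational centres and radii 1/m. *)
Lemma measurable_ucb n (f : rtuple R n -> R) : ucb f -> measurable_fun setT f.
Proof.
move=> [_ uf] mT; apply: (measurability _ (RGenOInfty.measurableE R)) => //.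
move=> _ [_ [a ->] <-]; rewrite setTI preimage_itvoy.
pose q (t : n.-tuple rat) : rtuple R n := [tuple (ratr (tnth t i) : measurableTypeR R) | i < n].
pose B (p : n.-tuple rat * nat) := [set x | close (p.2.+1%:R^-1 : R) x (q p.1)].
pose U m := if unpickle m is Some p then
  (if `[< B p `<=` [set x | (a < f x)%R] >] then B p else set0) else set0.
rewrite (_ : [set x | (a < f x)%R] = \bigcup_m U m).
  apply: bigcupT_measurable => m; rewrite /U; case: unpickle => // p.
  by case: ifP => // _; exact: measurable_close.
apply/seteqP; split => [x /= ax|x [m _]]; last first.
  rewrite /U; case: unpickle => // p; case: ifP => // /asboolP h; exact: h.
have [d d0 hd] : exists2 d, (0 < d)%R &
    forall k k' : rtuple R n, close d k k' -> (`|f k - f k'| < f x - a)%R.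
  by apply: uf; rewrite subr_gt0.
have [m hm] : exists m, (m.+1%:R^-1 < d / 2)%R.
  by have [|m] := @ltr_add_invr R 0 (d / 2)%R; rewrite ?divr_gt0// add0r; exists m.
have hq i : exists r : rat, (`|tnth x i - ratr r| < m.+1%:R^-1 :> R)%R.
  have [|r] := @rat_in_itvoo R (tnth x i) (tnth x i + m.+1%:R^-1)%R.
    by rewrite ltrDl invr_gt0.
  rewrite in_itv/= => /andP[h1 h2]; exists r; rewrite distrC ltr_distl h2 andbT.
  by rewrite (lt_trans _ h1)// gtrBl invr_gt0.
pose t : n.-tuple rat := [tuple sval (cid (hq i)) | i < n].
have tx : close (m.+1%:R^-1) x (q t).
  by move=> i; rewrite !tnth_mktuple; exact: (svalP (cid (hq i))).
exists (pickle (t, m)) => //; rewrite /U pickleK ifT//.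
apply/asboolP => y /= yt.
have : (`|f x - f y| < f x - a)%R.
  apply: hd => i; rewrite -(subrKA (tnth (q t) i)) (le_lt_trans (ler_normD _ _))//.
  rewrite [d]splitr ltrD//; apply: lt_trans hm; first exact: tx.
  by rewrite distrC; exact: yt.
by rewrite ltr_distlC => /andP[]; rewrite subKr.
Qed.

Section Subst.
Variables (n j : nat) (jn : (j <= n)%N).

Lemma measurable_section d (T : measurableType d) (f : rtuple R n -> T) k :
  cube n k -> measurable_fun (cube n) f ->
  measurable_fun (cube j) (fun x => f (subst_point x k)).
Proof.
move=> kc mf; apply: (measurable_comp (@measurable_cube R n) _ mf).
  by move=> _ [x xc <-]; exact: cube_subst_point.
apply: measurable_funTS.
exact: (measurableT_comp (@measurable_subst_point R n j) (pair2_measurable k)).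
Qed.

Section Ge0.
Variable F : rtuple R n -> \bar R.
Hypothesis mF : measurable_fun (cube n) F.
Hypothesis F0 : forall x, cube n x -> 0 <= F x.

Let G k := \int[mu j]_(x in cube j) F (subst_point x k).

Let GE k : cube n k -> G k = \int[mu j]_x (F \o @clamp R n) (subst_point x k).
Proof.
move=> kc; rewrite /G integral_cube; last exact: measurable_section.
by apply: eq_integral => x _ /=; rewrite clamp_subst_point (clamp_id kc).
Qed.

Let mFc : measurable_fun setT (F \o @clamp R n).
Proof. exact: measurable_comp_clamp. Qed.

Let Fc0 x : 0 <= (F \o @clamp R n) x.
Proof. by apply: F0; exact: cube_clamp. Qed.

Lemma measurable_cube_avg_ge0 : measurable_fun (cube n) G.
Proof.
apply: (eq_measurable_fun
  (fun k => \int[mu j]_x (F \o @clamp R n) (subst_point x k))).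
  by move=> k; rewrite inE => kc; rewrite GE.
by apply: measurable_funTS; exact: measurable_avg_ge0.
Qed.

Lemma ge0_integral_cube_subst :
  \int[mu n]_(k in cube n) \int[mu j]_(x in cube j) F (subst_point x k) =
  \int[mu n]_(k in cube n) F k.
Proof.
rewrite [RHS]integral_cube// -[RHS](ge0_integral_subst jn mFc Fc0).
rewrite -[LHS]/(\int[mu n]_(k in cube n) G k).
rewrite integral_cube; last exact: measurable_cube_avg_ge0.
apply: eq_integral => k _; rewrite GE; last exact: cube_clamp.
by apply: eq_integral => x _ /=; rewrite !clamp_subst_point clampK.
Qed.

End Ge0.

Section Integrable.
Variable f : rtuple R n -> R.
Hypothesis If : (mu n).-integrable (cube n) (EFin \o f).

Let mf : measurable_fun (cube n) (EFin \o f).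
Proof. by case/integrableP : If. Qed.

Let Phi (p : rtuple R j * rtuple R n) := subst_point p.1 p.2.
Let Fc := (EFin \o f) \o @clamp R n.

Let mFc : measurable_fun setT Fc.
Proof. exact: measurable_comp_clamp. Qed.

Let mFPhi : measurable_fun setT (Fc \o Phi).
Proof. by apply: measurableT_comp => //; exact: measurable_subst_point. Qed.

Let tonelli (H : rtuple R n -> \bar R) : measurable_fun setT H ->
  (forall x, 0 <= H x) -> \int[mu j \x mu n]_p H (Phi p) = \int[mu n]_k H k.
Proof.
move=> mH H0; rewrite -(ge0_integral_subst jn mH H0) fubini_tonelli2//.
by apply: measurableT_comp => //; exact: measurable_subst_point.
Qed.

Let IFc : (mu n).-integrable setT Fc.
Proof. by apply/integrable_clamp. Qed.

Let IPhi : (mu j \x mu n).-integrable setT (Fc \o Phi).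
Proof.
apply/integrableP; split => //.
have mN : measurable_fun setT (fun x => `|Fc x|) by exact: measurableT_comp.
by rewrite (tonelli mN)//; case/integrableP : IFc.
Qed.

Let section_clamp k (x : rtuple R j) : cube n k ->
  Fc (subst_point x k) = (f (subst_point (clamp x) k))%:E.
Proof. by move=> kc; rewrite /Fc /= clamp_subst_point (clamp_id kc). Qed.

Let sectionE k : cube n k -> Fc \o (fun x : rtuple R j => subst_point x k) =
  (fun x => (f (subst_point x k))%:E) \o @clamp R j.
Proof. by move=> kc; apply/funext => x; exact: section_clamp. Qed.

Lemma ae_integrable_section : {ae mu n, forall k, cube n k ->
  (mu j).-integrable (cube j) (EFin \o (fun x => f (subst_point x k)))}.
Proof.
apply: filterS (ae_integrable2 IPhi) => k Ik kc.
have ms : measurable_fun (cube j) (EFin \o (fun x => f (subst_point x k))).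
  exact: (@measurable_section _ _ (EFin \o f) k kc mf).
have : (mu j).-integrable setT (Fc \o (fun x => subst_point x k)) by exact: Ik.
by rewrite (sectionE kc) => Ik'; apply/(integrable_clamp ms).
Qed.

Let int_section k : cube n k -> \int[mu j]_(x in cube j) (f (subst_point x k))%:E =
  \int[mu j]_x Fc (subst_point x k).
Proof.
move=> kc; rewrite integral_cube; last exact: (measurable_section kc mf).
by apply: eq_integral => x _; rewrite section_clamp.
Qed.

Let G : rtuple R n -> R := fun k => (\int[mu j]_(x in cube j) f (subst_point x k))%R.

Lemma measurable_cube_avg : measurable_fun (cube n) G.
Proof.
apply: (eq_measurable_fun
  (fun k => fine (\int[mu j]_x Fc (subst_point x k)))).
  by move=> k; rewrite inE => kc; rewrite /G /Rintegral int_section.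
apply: measurable_funTS; apply: measurableT_comp => //.
exact: (measurable_fubini_G IPhi).
Qed.

(** The equality can fail on fibres where the section is not integrable, since [fine] sends infinite
    values to 0. *)
Let GE : {ae mu n, forall k, cube n k ->
  (G k)%:E = \int[mu j]_x Fc (subst_point x k)}.
Proof.
apply: filterS ae_integrable_section => k Ik kc.
rewrite /G /Rintegral fineK ?int_section// -int_section//.
exact: (integral_fune_fin_num (@measurable_cube R j) (Ik kc)).
Qed.

Lemma integral_cube_subst : (\int[mu n]_(k in cube n) G k = \int[mu n]_(k in cube n) f k)%R.
Proof.
rewrite /Rintegral; congr fine.
transitivity (\int[mu n]_k \int[mu j]_x Fc (subst_point x k)).
  rewrite integral_cube; last by apply/measurable_EFinP; exact: measurable_cube_avg.
  apply: ae_eq_integral => //.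
  - have /measurable_EFinP := measurable_cube_avg; exact: measurable_comp_clamp.
  - exact: (measurable_fubini_G IPhi).
  - apply: filterS2 (ae_cube n) GE => k kc hG _.
    by rewrite /= clamp_id// hG.
rewrite (integral_cube mf) -[RHS]/(\int[mu n]_x Fc x).
transitivity (\int[mu j \x mu n]_p (Fc \o Phi) p).
  exact: (integral21_prod_meas1 IPhi).
(* The local [tonelli] covers nonnegative functions, so positive and negative parts are treated
   separately. *)
rewrite integralE [RHS]integralE funepos_comp funeneg_comp.
rewrite -(tonelli (measurable_funepos mFc))// -(tonelli (measurable_funeneg mFc))//.
Qed.

End Integrable.
End Subst.

Lemma bounded_integrable n (f : rtuple R n -> R) (c : R) :
  measurable_fun (cube n) f -> (forall x, cube n x -> (`|f x| <= c)%R) ->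
  (mu n).-integrable (cube n) (EFin \o f).
Proof.
move=> mf fc; apply: measurable_bounded_integrable => //.
- exact: measurable_cube.
- by rewrite [X in X < _]leb_cube_cube ltry.
- exists c; split => [|r cr x xc]; first exact: num_real.
  exact: le_trans (fc _ xc) (ltW cr).
Qed.

Lemma ucb_integrable n (f : rtuple R n -> R) : ucb f ->
  (mu n).-integrable (cube n) (EFin \o f).
Proof.
move=> uf; have [[c fc] _] := uf; apply: (@bounded_integrable _ _ c) => //.
by apply: measurable_funTS; exact: measurable_ucb.
Qed.

Lemma ucb_section n j (f : rtuple R n -> R) k : ucb f ->
  ucb (fun x : rtuple R j => f (subst_point x k)).
Proof.
move=> [[c fc] uf]; split; first by exists c.
move=> e /uf[d d0 hd]; exists d => // x y xy; apply: hd => i.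
case: (ltnP i j) => ij; first by rewrite !subst_point_lt; exact: xy.
by rewrite !subst_point_ge// subrr normr0.
Qed.

Lemma Rintegral_cube_cst n (c : R) : (\int[mu n]_(x in cube n) c = c)%R.
Proof.
rewrite (Rintegral_cst _ (@measurable_cube R n)).
by rewrite [X in fine X]leb_cube_cube mulr1.
Qed.

Lemma Rintegral_cube_le n (f : rtuple R n -> R) (c : R) :
  (mu n).-integrable (cube n) (EFin \o f) ->
  (forall x, cube n x -> (`|f x| <= c)%R) ->
  (`|\int[mu n]_(x in cube n) f x| <= c)%R.
Proof.
move=> If fc; apply: le_trans (le_normr_Rintegral (@measurable_cube R n) If) _.
rewrite -[leRHS](Rintegral_cube_cst n); apply: le_Rintegral => //.
- exact: (@measurable_cube R n).
- exact: integrable_norm.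
- apply: (@bounded_integrable _ (cst c) `|c|%R) => //; exact: measurable_cst.
Qed.

Lemma ucb_avg n j (f : rtuple R n -> R) : ucb f ->
  ucb (fun k => (\int[mu j]_(x in cube j) f (subst_point x k))%R).
Proof.
move=> uf; have Is k := ucb_integrable (@ucb_section n j f k uf).
have [[c fc] hf] := uf; split.
  by exists c => k; apply: Rintegral_cube_le => // x _.
(* Half of [e] leaves room for integration, which turns the strict bound into a weak one. *)
move=> e e0; have [|d d0 hd] := hf (e / 2)%R; first by rewrite divr_gt0.
exists d => // k k' kk'; rewrite -RintegralB//; last exact: (@measurable_cube R j).
apply: (@le_lt_trans _ _ (e / 2)%R); last by rewrite ltr_pdivrMr// ltr_pMr// ltr1n.
apply: Rintegral_cube_le => [|x _].
  have := integrableB (@measurable_cube R j) (Is k) (Is k').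
  by apply: eq_integrable => //; exact: (@measurable_cube R j).
apply/ltW/hd => i; case: (ltnP i j) => ij.
  by rewrite !subst_point_lt subrr normr0.
by rewrite !subst_point_ge.
Qed.

End CubeIntegral.

(** * Averages of continuous functions *)

Section ComplexIntegral.
Context {R : realType}.
Local Notation mu n := (@leb_cube R n).
Local Notation cube := (@cube R).

Definition Cint n (g : rtuple R n -> R[i]) : R[i] :=
  (\int[mu n]_(x in cube n) Re (g x)) +i* (\int[mu n]_(x in cube n) Im (g x)).

Definition Cintegrable n (g : rtuple R n -> R[i]) : Prop :=
  (mu n).-integrable (cube n) (EFin \o (fun x => Re (g x))) /\
  (mu n).-integrable (cube n) (EFin \o (fun x => Im (g x))).

Lemma eq_Cint n (f g : rtuple R n -> R[i]) :
  (forall x, cube n x -> f x = g x) -> Cint f = Cint g.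
Proof.
by move=> fg; rewrite /Cint; congr (_ +i* _); apply: eq_Rintegral => x;
  rewrite inE => xc; rewrite fg.
Qed.

Let eq_int n (f g : rtuple R n -> R) : f =1 g ->
  (mu n).-integrable (cube n) (EFin \o f) ->
  (mu n).-integrable (cube n) (EFin \o g).
Proof. by move=> /funext ->. Qed.

Let intD n (f g : rtuple R n -> R) :
  (mu n).-integrable (cube n) (EFin \o f) ->
  (mu n).-integrable (cube n) (EFin \o g) ->
  (mu n).-integrable (cube n) (EFin \o (fun x => f x + g x)).
Proof. by move=> If Ig; exact: (integrableD (@measurable_cube R n) If Ig). Qed.

Let intZ n (c : R) (f : rtuple R n -> R) :
  (mu n).-integrable (cube n) (EFin \o f) ->
  (mu n).-integrable (cube n) (EFin \o (fun x => c * f x)).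
Proof. by move=> If; exact: (integrableZl (@measurable_cube R n) c If). Qed.

Lemma CintegrableD n (f g : rtuple R n -> R[i]) :
  Cintegrable f -> Cintegrable g -> Cintegrable (fun x => f x + g x).
Proof.
move=> [rf jf] [rg jg]; split.
  by apply: eq_int (intD rf rg) => x; rewrite cReD.
by apply: eq_int (intD jf jg) => x; rewrite cImD.
Qed.

Lemma CintegrableZ n c (f : rtuple R n -> R[i]) :
  Cintegrable f -> Cintegrable (fun x => c * f x).
Proof.
move=> [rf jf]; split.
  by apply: eq_int (intD (intZ (Re c) rf) (intZ (- Im c) jf)) => x; rewrite cReM mulNr.
by apply: eq_int (intD (intZ (Re c) jf) (intZ (Im c) rf)) => x; rewrite cImM.
Qed.

Lemma CintD n (f g : rtuple R n -> R[i]) : Cintegrable f -> Cintegrable g ->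
  Cint (fun x => f x + g x) = Cint f + Cint g.
Proof.
move=> [rf jf] [rg jg]; have mc := @measurable_cube R n.
rewrite /Cint -[RHS]/((_ + _) +i* (_ + _)) -!RintegralD//.
by congr (_ +i* _); apply: eq_Rintegral => x _; rewrite ?cReD ?cImD.
Qed.

Lemma CintZ n c (f : rtuple R n -> R[i]) : Cintegrable f ->
  Cint (fun x => c * f x) = c * Cint f.
Proof.
move=> [rf jf]; have mc := @measurable_cube R n.
apply: eqReIm; rewrite ?cReM ?cImM /=.
  rewrite -!RintegralZl// -RintegralB//; try exact: intZ.
  by apply: eq_Rintegral => x _; rewrite cReM.
rewrite -!RintegralZl// -RintegralD//; try exact: intZ.
by apply: eq_Rintegral => x _; rewrite cImM.
Qed.

Lemma Cint_cst n c : Cint (fun _ : rtuple R n => c) = c.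
Proof. by rewrite /Cint !Rintegral_cube_cst; case: c. Qed.

Lemma Cintegrable_cst n c : Cintegrable (fun _ : rtuple R n => c).
Proof. by split; apply: ucb_integrable; exact: ucb_cst. Qed.

Lemma Cintegrable_sum n (I : eqType) (r : seq I) (f : I -> rtuple R n -> R[i]) :
  (forall i, i \in r -> Cintegrable (f i)) ->
  Cintegrable (fun x => \sum_(i <- r) f i x).
Proof.
elim: r => [|i r IH] h.
  by under eq_fun do rewrite big_nil; exact: Cintegrable_cst.
under eq_fun do rewrite big_cons.
apply: CintegrableD; first by apply: h; rewrite mem_head.
by apply: IH => j jr; apply: h; rewrite in_cons jr orbT.
Qed.

Lemma Cint_sum n (I : eqType) (r : seq I) (f : I -> rtuple R n -> R[i]) :
  (forall i, i \in r -> Cintegrable (f i)) ->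
  Cint (fun x => \sum_(i <- r) f i x) = \sum_(i <- r) Cint (f i).
Proof.
elim: r => [|i r IH] h.
  by under eq_fun do rewrite big_nil; rewrite big_nil Cint_cst.
under eq_fun do rewrite big_cons.
have hr j : j \in r -> Cintegrable (f j).
  by move=> jr; apply: h; rewrite in_cons jr orbT.
rewrite big_cons CintD ?IH//; first by apply: h; rewrite mem_head.
exact: Cintegrable_sum.
Qed.

Lemma Cint_subst n j (g : rtuple R n -> R[i]) : (j <= n)%N -> Cintegrable g ->
  Cint (fun k => Cint (fun x : rtuple R j => g (subst_point x k))) = Cint g.
Proof.
move=> jn [rg jg]; rewrite /Cint /=; congr (_ +i* _).
  exact: (integral_cube_subst jn rg).
exact: (integral_cube_subst jn jg).
Qed.

Lemma Cint_ge0 n (g : rtuple R n -> R[i]) :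
  (forall x, cube n x -> 0 <= g x) -> 0 <= Cint g.
Proof.
move=> g0; rewrite lecE /=; apply/andP; split; last first.
  by apply: Rintegral_ge0 => x /g0; rewrite lecE => /andP[].
apply/eqP; rewrite -[RHS](Rintegral_cube_cst n 0); apply: eq_Rintegral => x.
by rewrite inE => /g0; rewrite lecE => /andP[/eqP].
Qed.

Lemma Cint_conj n (g : rtuple R n -> R[i]) : Cintegrable g ->
  Cint (fun x => (conjc (g x))) = (conjc (Cint g)).
Proof.
move=> [rg jg]; apply: eqReIm => /=.
  by apply: eq_Rintegral => x _; case: (g x).
rewrite -mulN1r -RintegralZl//; last exact: (@measurable_cube R n).
by apply: eq_Rintegral => x _; case: (g x) => a b /=; rewrite mulN1r.
Qed.

Lemma ReCint n (g : rtuple R n -> R[i]) :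
  Re (Cint g) = \int[mu n]_(x in cube n) Re (g x).
Proof. by []. Qed.

End ComplexIntegral.

Section Averages.
Context {R : realType} {N : nat}.
Local Notation CF := (@CF R N).
Local Notation cube := (@cube R).

Lemma CF_Cintegrable j (f : CF) k :
  Cintegrable (fun x : rtuple R j => f (subst_point x k)).
Proof.
split; apply: ucb_integrable.
  exact: (@ucb_section R N j (fun k => Re (f k)) k (CF_Re f)).
exact: (@ucb_section R N j (fun k => Im (f k)) k (CF_Im f)).
Qed.

(** The level is capped at N so that the laws of [averaging] hold for all natural numbers. *)
Definition eavg j (f : CF) : CF :=
  mkCF (fun k => Cint (fun x : rtuple R (minn j N) => f (subst_point x k))).

Lemma eavgE j (f : CF) k :
  eavg j f k = Cint (fun x : rtuple R (minn j N) => f (subst_point x k)).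
Proof.
rewrite /eavg mkCFE.
- apply: eq_Cint => x xc.
  by rewrite -[RHS]CF_clamp clamp_subst_point (clamp_id xc).
- by apply: (ucb_clamp (@ucb_avg R N (minn j N) _ (CF_Re f))).
- by apply: (ucb_clamp (@ucb_avg R N (minn j N) _ (CF_Im f))).
Qed.

Lemma eavg_subst i j (f : CF) (x : rtuple R i) k : (i <= minn j N)%N ->
  eavg j f (subst_point x k) = eavg j f k.
Proof.
move=> ij; rewrite !eavgE; apply: eq_Cint => y _.
by rewrite subst_point_absorb.
Qed.

Lemma leq_minnN i j : (i <= j)%N -> (minn i N <= minn j N)%N.
Proof. by move=> ij; rewrite leq_min geq_minr (leq_trans (geq_minl _ _) ij). Qed.

Lemma averaging_eavg : averaging eavg.
Proof.
split.
- move=> j f g; apply: CF_eqP => k; rewrite CF_D !eavgE -CintD//; exact: CF_Cintegrable.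
- move=> i j f g ij; apply: CF_eqP => k; rewrite CF_M !(eavgE i) -CintZ; last first.
    exact: CF_Cintegrable.
  by apply: eq_Cint => x _; rewrite CF_M eavg_subst// leq_minnN.
- move=> i j f ij; apply: CF_eqP => k; rewrite !(eavgE j).
  rewrite -[RHS](Cint_subst (leq_minnN ij) (@CF_Cintegrable (minn j N) f k)).
  apply: eq_Cint => y _; rewrite eavgE; apply: eq_Cint => x _.
  by rewrite subst_point_subst// leq_minnN.
- by move=> j; apply: CF_eqP => k; rewrite eavgE Cint_cst.
Qed.

Lemma eavg_tail j (f : CF) k k' :
  (forall i : 'I_N, (j <= i)%N -> tnth k i = tnth k' i) -> eavg j f k = eavg j f k'.
Proof.
move=> kk'; rewrite !eavgE; apply: eq_Cint => x _; congr (f _).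
apply: subst_point_tail => i; rewrite geq_min => /orP[/kk'//|].
by rewrite leqNgt ltn_ord.
Qed.

Lemma eavg_ge0 j (f : CF) : (forall k, 0 <= f k) -> forall k, 0 <= eavg j f k.
Proof. by move=> f0 k; rewrite eavgE; apply: Cint_ge0 => x _. Qed.

Lemma eavg_le j (f g : CF) : (forall k, f k <= g k) ->
  forall k, eavg j f k <= eavg j g k.
Proof.
move=> fg k; rewrite -subr_ge0.
have -> : eavg j g k - eavg j f k = eavg j (g - f) k.
  by rewrite (averagingD averaging_eavg) (avgN averaging_eavg).
by apply: eavg_ge0 => k'; rewrite CF_D CF_N subr_ge0.
Qed.

Lemma csym_conj (f : CF) : (fun k => (conjc (f k))) \in csym.
Proof.
apply: csymP; last by move=> k; rewrite CF_clamp.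
  have -> : (fun k => Re ((conjc (f k)))) = fun k => Re (f k).
    by apply/funext => k; case: (f k).
  exact: CF_Re.
have -> : (fun k => Im ((conjc (f k)))) = fun k => - Im (f k).
  by apply/funext => k; case: (f k).
by apply: ucbN; exact: CF_Im.
Qed.

Definition CF_conj (f : CF) : CF := insubd 0 (fun k => (conjc (f k))).

Lemma CF_conjE f k : CF_conj f k = (conjc (f k)).
Proof. by rewrite /CF_conj /insubd insubT//; exact: csym_conj. Qed.

Lemma eavg_conj j (f : CF) : eavg j (CF_conj f) = CF_conj (eavg j f).
Proof.
apply: CF_eqP => k; rewrite CF_conjE !eavgE -Cint_conj; last exact: CF_Cintegrable.
by apply: eq_Cint => x _; rewrite CF_conjE.
Qed.

Definition CF_cst (c : R[i]) : CF := insubd 0 (fun _ => c).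

Lemma CF_cstE c k : CF_cst c k = c.
Proof.
rewrite /CF_cst /insubd insubT//.
by apply: csymP => //; exact: ucb_cst.
Qed.

Lemma eavg_cst j c : eavg j (CF_cst c) = CF_cst c.
Proof.
apply: CF_eqP => k; rewrite CF_cstE eavgE -[RHS](Cint_cst (minn j N)).
by apply: eq_Cint => x _; rewrite CF_cstE.
Qed.

Lemma CF_bounded (f : CF) : exists2 c : R, 0 <= c & forall k, `|f k| <= c%:C.
Proof.
have [[a ha] _] := CF_Re f; have [[b hb] _] := CF_Im f.
exists (`|a| + `|b|); first by rewrite addr_ge0.
move=> k; rewrite normcE' lecR (le_trans (normc_ReIm _))// lerD//.
  exact: le_trans (ha k) (ler_norm _).
exact: le_trans (hb k) (ler_norm _).
Qed.

Lemma CF_near (f : CF) k (e : R) : 0 < e ->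
  exists2 d : R, 0 < d & forall k', close d k k' -> `|f k - f k'| < e%:C.
Proof.
move=> e0; have e2 : 0 < e / 2 by rewrite divr_gt0.
have [_ /(_ _ e2)[d d0 hd]] := CF_Re f.
have [_ /(_ _ e2)[d' d'0 hd']] := CF_Im f.
exists (Num.min d d') => [|k' kk']; first by rewrite lt_min d0.
rewrite normcE' ltcR; apply: le_lt_trans (normc_ReIm _) _.
rewrite [e]splitr cReD cReN cImD cImN ltrD//.
  by apply: hd => i; apply: lt_le_trans (kk' i) _; rewrite ge_min lexx.
by apply: hd' => i; apply: lt_le_trans (kk' i) _; rewrite ge_min lexx orbT.
Qed.

Lemma Rintegral_slab n (i : 'I_n) (c e : R) (f : rtuple R n -> R) : 0 <= e ->
  ucb f -> (forall x, 0 <= f x <= 1) ->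
  (forall x, cube n x -> e < `|tnth x i - c| -> f x = 0) ->
  \int[leb_cube n]_(x in cube n) f x <= 2 * e.
Proof.
move=> e0 uf f01 f0.
pose S := [set x : rtuple R n | `|tnth x i - c| <= e].
have mS : measurable S.
  rewrite (_ : S = (fun k => tnth k i) @^-1`
     (`[c - e, c + e]%classic : set (measurableTypeR R))).
    by rewrite -[X in measurable X]setTI;
       apply: measurable_tnth => //; exact: measurable_itv.
  by apply/seteqP; split => x /=; rewrite /S/= in_itv/= ler_distl.
have mc := @measurable_cube R n.
have Iind : (leb_cube n).-integrable (cube n) (EFin \o (\1_S : rtuple R n -> R)).
  apply: (@bounded_integrable _ _ _ 1) => // x _.
  by rewrite indicE; case: (_ \in _); rewrite ?normr1 ?normr0.
apply: (@le_trans _ _ (\int[leb_cube n]_(x in cube n) (\1_S : rtuple R n -> R) x)).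
  apply: le_Rintegral => //; first exact: ucb_integrable.
  move=> x xc; rewrite indicE; case: (boolP (x \in S)) => [_|].
    by have /andP[] := f01 x.
  rewrite notin_setE /S /= => /negP; rewrite -ltNge => /(f0 _ xc) ->.
  by [].
rewrite /Rintegral integral_indic//.
have h : (leb_cube n (S `&` cube n) <= (2 * e)%:E)%E.
  apply: le_trans (leb_cube_slab i c e0).
  by apply: le_measure; rewrite ?inE//; exact: measurableI.
by rewrite -lee_fin fineK// fin_num_measure//; exact: measurableI.
Qed.

(** If f(k) > 0, then f >= f(k)/2 on a box around k, which has positive mass. *)
Lemma eavgN_eq0 (f : CF) k0 : (forall k, 0 <= f k) -> eavg N f k0 = 0 -> f = 0.
Proof.
move=> f0 ef0; apply: CF_eq_cube => k kc; apply/eqP.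
apply/negP => /negP fk; have fp : 0 < Re (f k).
  by have := f0 k; rewrite le_eqVlt eq_sym (negbTE fk)/= ltcE => /andP[].
have c2 : 0 < Re (f k) / 2 by rewrite divr_gt0.
have [_ /(_ _ c2)[d d0 hd]] := CF_Re f.
have mc := @measurable_cube R N.
have [mB Bpos] := leb_cube_box kc d0; set B := [set x | _] in mB Bpos.
have Iind : (leb_cube N).-integrable (cube N) (EFin \o (\1_B : rtuple R N -> R)).
  apply: (@bounded_integrable _ _ _ 1) => // x _.
  by rewrite indicE; case: (_ \in _); rewrite ?normr1 ?normr0.
have : \int[leb_cube N]_(x in cube N) (Re (f k) / 2 * (\1_B : rtuple R N -> R) x)
    <= Re (eavg N f k0).
  rewrite eavgE minnn ReCint; apply: le_Rintegral => //.
  - exact: (integrableZl mc _ Iind).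
  - apply: ucb_integrable; under eq_fun do rewrite subst_point_full.
    exact: CF_Re.
  - move=> x _; rewrite subst_point_full indicE; case: (boolP (x \in B)) => [|_].
      rewrite inE => /hd; rewrite ltr_distl mulr1 => /andP[+ _].
      by move: (Re (f k)) => a; lra.
    by rewrite mulr0; have := f0 x; rewrite lecE => /andP[].
rewrite ef0 RintegralZl// /Rintegral integral_indic// setIC.
apply/negP; rewrite -ltNge mulr_gt0// -lte_fin fineK; last first.
  by apply: fin_num_measure; exact: measurableI.
(* The box may stick out of the cube, but only by a null set. *)
suff eB : leb_cube N (cube N `&` B) = leb_cube N B by rewrite [ltRHS]eB.
have hC : leb_cube N (~` cube N) = 0%E.
  by rewrite (probability_setC _ mc) leb_cube_cube subee.
have mCB : measurable (~` cube N `&` B).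
  by apply: measurableI => //; exact: measurableC.
rewrite -[in RHS](setTI B) -(setUv (cube N)) setIUl measureU//.
- rewrite [X in (_ + X)%E](_ : _ = 0%E) ?adde0//.
  apply/eqP; rewrite eq_le measure_ge0 andbT -hC.
  by apply: le_measure; rewrite ?inE//; exact: measurableC.
- exact: measurableI.
- by rewrite setIACA setICr set0I.
Qed.

End Averages.

(** The quadratic a - z' b - z b' + z z' c of Cauchy-Schwarz at its minimizer z = b/c, with primes
    for conjugates. *)
Lemma CS_identity (F : fieldType) (a b b' c : F) : c != 0 ->
  a - b' / c * b - b / c * b' + b' * b * c^-1 ^+ 2 * c = a - b' * b / c.
Proof. by move=> c0; field. Qed.

(** The degenerate case c = 0: at z = (a+1)/|b|^2 b the quadratic would take a negative value, which
    forces b = 0. *)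
Lemma CS_identity0 (F : fieldType) (a b b' n : F) : n != 0 -> b' * b = n ->
  a - (a + 1) / n * b' * b - (a + 1) / n * b * b' = - (a + 2).
Proof.
by move=> n0 bn; rewrite -!mulrA [b * b']mulrC bn; field; exact: n0.
Qed.

Lemma norm2_identity (F : comNzRingType) (f g f' g' z z' : F) :
  (f - z * g') * (f' - z' * g) =
  f * f' - z' * (f * g) - z * (f' * g') + z * z' * (g * g').
Proof. by ring. Qed.

(** * Squared norms and Cauchy-Schwarz on fibres *)

Section SquaredNorm.
Context {R : realType}.

(** The crude factor comes from iterating |x + y|^2 <= 2 (|x|^2 + |y|^2); only the existence of a
    bound matters later. *)
Lemma normc_sum_sqr I (s : seq I) (z : I -> R[i]) :
  normc (\sum_(b <- s) z b) ^+ 2 <= 2 ^+ size s * \sum_(b <- s) normc (z b) ^+ 2.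
Proof.
elim: s => [|b s IH]; first by rewrite !big_nil mulr0 normc0 expr0n.
rewrite !big_cons /= [2 ^+ (size s).+1]exprS -mulrA.
have h : normc (z b + \sum_(j <- s) z j) ^+ 2 <=
    2 * (normc (z b) ^+ 2 + normc (\sum_(j <- s) z j) ^+ 2).
  have := le_normcD (z b) (\sum_(j <- s) z j).
  have := normc_ge0 (z b + \sum_(j <- s) z j).
  move: (normc (z b + _)) (normc (z b)) (normc (\sum_(j <- s) _)) => x a c x0 xac.
  have := sqr_ge0 (a - c); nra.
apply: le_trans h _; rewrite ler_pM2l// mulrDr lerD// ler_peMl ?exprn_ge0 ?normc_ge0//.
by rewrite exprn_ege1// ler1n.
Qed.

Lemma normc_le_sqnorm n (v : 'cV[R[i]]_n) i : normc (v i ord0) ^+ 2 <= sqnorm v.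
Proof.
rewrite /sqnorm (bigD1 i)//= lerDl sumr_ge0// => j _.
by rewrite exprn_ge0// normc_ge0.
Qed.

Lemma conjc_ge0 (z : R[i]) : 0 <= z -> conjc z = z.
Proof. by rewrite lecE; case: z => a b /= /andP[/eqP -> _]; rewrite oppr0. Qed.

Context {N : nat}.
Local Notation CF := (@CF R N).

Lemma mulmx_sqnorm_bound p q (A : 'M[CF]_(p, q)) : exists2 c : R, 0 <= c &
  forall k (w : 'cV[R[i]]_q), sqnorm (mxev k A *m w) <= c * sqnorm w.
Proof.
have hA i j : exists c : R, 0 <= c /\ forall k, `|A i j k| <= c%:C.
  by have [c c0 hc] := CF_bounded (A i j); exists c.
pose c i j := sval (cid (hA i j)).
have cP i j k : normc (A i j k) <= c i j.
  have [_ /(_ k)] := svalP (cid (hA i j)); by rewrite normcE' lecR.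
have c0 i j : 0 <= c i j by have [] := svalP (cid (hA i j)).
exists (\sum_i 2 ^+ q * \sum_j c i j ^+ 2).
  apply: sumr_ge0 => i _; apply: mulr_ge0; first exact: exprn_ge0.
  by apply: sumr_ge0 => j _; exact: exprn_ge0.
move=> k w; rewrite {1}/sqnorm mulr_suml; apply: ler_sum => i _.
rewrite mxE; apply: le_trans (normc_sum_sqr _ _) _.
rewrite /index_enum -enumT size_enum_ord -mulrA ler_pM2l ?exprn_gt0//.
rewrite enumT mulr_suml; apply: ler_sum => j _.
rewrite normcM exprMn ler_pM ?exprn_ge0 ?normc_ge0 ?normc_le_sqnorm//.
by rewrite ler_sqr ?nnegrE ?normc_ge0 ?c0// mxE; exact: cP.
Qed.

Definition sq n (X : 'cV[CF]_n) : CF :=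
  \sum_a X a ord0 * CF_conj (X a ord0).

Lemma CF_sum I (s : seq I) (P : pred I) (f : I -> CF) k :
  (\sum_(i <- s | P i) f i) k = \sum_(i <- s | P i) f i k.
Proof. exact: (raddf_sum (ev k)). Qed.

Lemma mul_conj_norm (f : CF) k : (f * CF_conj f) k = (normc (f k) ^+ 2)%:C.
Proof. by rewrite CF_M CF_conjE -sqr_normc normcE' rmorphXn. Qed.

Lemma sqE n (X : 'cV[CF]_n) k : sq X k = (sqnorm (mxev k X))%:C.
Proof.
rewrite /sq CF_sum /sqnorm rmorph_sum; apply: eq_bigr => a _.
by rewrite mul_conj_norm mxE.
Qed.

Lemma sq_ge0 n (X : 'cV[CF]_n) k : 0 <= sq X k.
Proof. by rewrite sqE ler0c sqnorm_ge0. Qed.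

Lemma CF_pos (f : CF) k : 0 <= f k -> f k = (Re (f k))%:C.
Proof. by rewrite lecE => /andP[/eqP h _]; case: (f k) h => a b /= ->. Qed.

Lemma sq_eq0 n (X : 'cV[CF]_n) k0 : eavg N (sq X) k0 = 0 -> X = 0.
Proof.
move=> h; have s0 : sq X = 0 by apply: (eavgN_eq0 _ h) => k; exact: sq_ge0.
apply/matrixP => a b; rewrite ord1 mxE; apply: CF_eqP => k.
have := sqE X k; rewrite s0 CF_0 => /(congr1 Re) /= /esym h0.
apply: eq0_normc; apply/eqP; rewrite -sqrf_eq0 eq_le.
have := normc_le_sqnorm (mxev k X) a; rewrite mxE h0 => ->.
by rewrite exprn_ge0// normc_ge0.
Qed.

Notation e := (@eavg R N).
Let he := @averaging_eavg R N.

Lemma eavgZ j (c : R[i]) (f : CF) k : e j (CF_cst c * f) k = c * e j f k.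
Proof.
have := averagingM he (CF_cst c) f (leqnn j).
by rewrite eavg_cst => ->; rewrite CF_M CF_cstE.
Qed.

Lemma eavgD j (f g : CF) k : e j (f + g) k = e j f k + e j g k.
Proof. by rewrite (averagingD he). Qed.

Lemma eavgN j (f : CF) k : e j (- f) k = - e j f k.
Proof. by rewrite (avgN he). Qed.

Lemma eavg4 j (f1 f2 f3 f4 : CF) k :
  e j (f1 - f2 - f3 + f4) k = e j f1 k - e j f2 k - e j f3 k + e j f4 k.
Proof.
rewrite (eavgD j (f1 - f2 - f3)) (eavgD j (f1 - f2)) (eavgD j f1).
by rewrite (eavgN j f2) (eavgN j f3).
Qed.

(** The average of |f - z g'|^2, with g' the conjugate of g, is nonnegative for every constant z.
    The inequality holds at each [k], that is, on each fibre. *)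
Lemma eavg_CS j (f g : CF) k :
  `|e j (f * g) k| ^+ 2 <= e j (f * CF_conj f) k * e j (g * CF_conj g) k.
Proof.
set a := e j (f * CF_conj f) k; set c := e j (g * CF_conj g) k.
set b := e j (f * g) k.
have a0 : 0 <= a.
  by apply: eavg_ge0 => k'; rewrite mul_conj_norm ler0c exprn_ge0// normc_ge0.
have c0 : 0 <= c.
  by apply: eavg_ge0 => k'; rewrite mul_conj_norm ler0c exprn_ge0// normc_ge0.
have key z : 0 <= a - (conjc z) * b - z * (conjc b) + `|z| ^+ 2 * c.
  pose h := f - CF_cst z * CF_conj g.
  have : 0 <= e j (h * CF_conj h) k.
    by apply: eavg_ge0 => k'; rewrite mul_conj_norm ler0c exprn_ge0// normc_ge0.
  have -> : h * CF_conj h = f * CF_conj f - CF_cst (conjc z) * (f * g)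
     - CF_cst z * CF_conj (f * g) + CF_cst (`|z| ^+ 2) * (g * CF_conj g).
    apply: CF_eqP => k'.
    rewrite !(CF_D, CF_N, CF_M, CF_conjE, CF_cstE) !(rmorphB, rmorphM) /= conjcK.
    by rewrite sqr_normc; exact: norm2_identity.
  rewrite eavg4 (eavgZ j (conjc z)) (eavgZ j z) (eavgZ j (`|z| ^+ 2)).
  by rewrite (eavg_conj j (f * g)) CF_conjE.
have bb : (conjc b) * b = `|b| ^+ 2 by rewrite sqr_normc mulrC.
have [cz|cnz] := eqVneq c 0; last first.
  have cp : 0 < c by rewrite lt_def cnz.
  have cR : conjc c = c by exact: conjc_ge0.
  have := key (b / c).
  have -> : (conjc (b / c)) = (conjc b) / c.
    by rewrite (rmorphM (@conjc R)) -[in RHS]cR; congr (_ * _); exact: conjc_inv.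
  rewrite normrM normfV exprMn (ger0_norm c0).
  have -> : a - (conjc b) / c * b - b / c * (conjc b) + `|b| ^+ 2 * c^-1 ^+ 2 * c = a - `|b| ^+ 2 / c.
    by rewrite -bb; exact: CS_identity.
  by rewrite subr_ge0 ler_pdivrMr.
rewrite cz mulr0; have [->|bnz] := eqVneq b 0; first by rewrite normr0 expr0n.
have := key ((a + 1) / `|b| ^+ 2 * b).
have n0 : `|b| ^+ 2 != 0 by rewrite expf_neq0// normr_eq0.
have -> : conjc ((a + 1) / `|b| ^+ 2 * b) = (a + 1) / `|b| ^+ 2 * conjc b.
  rewrite (rmorphM (@conjc R)); congr (_ * _); apply: conjc_ge0.
  by rewrite divr_ge0 ?exprn_ge0// addr_ge0.
rewrite cz mulr0 addr0.
have -> : a - (a + 1) / `|b| ^+ 2 * (conjc b) * b - (a + 1) / `|b| ^+ 2 * b * (conjc b) = - (a + 2).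
  exact: CS_identity0.
rewrite oppr_ge0 => h; exfalso; move: h; apply/negP; rewrite lt_geF//.
by rewrite ltr_wpDl.
Qed.

End SquaredNorm.

(** * Localization near slices *)

Section Localization.
Context {R : realType} {N : nat}.
Local Notation CF := (@CF R N).
Local Notation e := (@eavg R N).
Local Notation he := (@averaging_eavg R N).

(* The plateau has height 1 on |x - c| <= (a-1)d and vanishes for
   |x - c| >= ad. *)
Definition plateau (a d c x : R) : R := clamp01 (a - `|clamp01 x - c| / d).

Lemma plateau_itv a d c x : 0 <= plateau a d c x <= 1.
Proof. exact: clamp01_itv. Qed.

(** [bump 1] localizes. [bump 2] equals 1 on the support of [bump 1], so the equation f * [bump 2] =
    f expresses algebraically that f lives near the slice. *)
Definition bump (a d : R) (k0 : rtuple R N) (l : 'I_N) : CF :=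
  insubd 0 (fun k => (plateau a d (tnth k0 l) (tnth k l))%:C).

Lemma ucb_plateau a d c n (l : 'I_n) : 0 < d ->
  ucb (fun k : rtuple R n => plateau a d c (tnth k l)).
Proof.
move=> d0; apply: (@ucb_coord R n (plateau a d c)).
  by exists 1 => x; have /andP[h1 h2] := plateau_itv a d c x; rewrite ger0_norm.
exists d^-1; first by rewrite invr_gt0.
move=> x y; apply: le_trans (clamp01_lip _ _) _.
have -> : a - `|clamp01 x - c| / d - (a - `|clamp01 y - c| / d) =
    d^-1 * (`|clamp01 y - c| - `|clamp01 x - c|) by ring.
rewrite normrM gtr0_norm ?invr_gt0// ler_pM2l ?invr_gt0//.
apply: le_trans (ler_dist_dist _ _) _.
rewrite opprB addrA subrK distrC; exact: clamp01_lip.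
Qed.

Lemma bumpE a d k0 l k : 0 < d ->
  bump a d k0 l k = (plateau a d (tnth k0 l) (tnth k l))%:C.
Proof.
move=> d0; rewrite /bump /insubd insubT//.
apply: csymP => /=; [exact: ucb_plateau|exact: ucb_cst|].
by move=> k'; rewrite /plateau tnth_mktuple (clamp01_id (clamp01_itv _)).
Qed.

(** The index [l] stands for the coordinate k_(l+1), so averages of level j <= l leave the bump
    alone, and those of level above [l] integrate it. *)
Lemma eavg_bump a d k0 (l : 'I_N) j : 0 < d -> (j <= l)%N ->
  e j (bump a d k0 l) = bump a d k0 l.
Proof.
move=> d0 jl; apply: CF_eqP => k; rewrite eavgE -[RHS](Cint_cst (minn j N)).
apply: eq_Cint => x _; rewrite !bumpE// subst_point_ge//.
by rewrite (leq_trans (geq_minl _ _)).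
Qed.

Lemma eavg_plateau d k0 (l : 'I_N) i k : 0 < d -> cube N k0 -> (l < i)%N ->
  Re (e i (bump 2 d k0 l * CF_conj (bump 2 d k0 l)) k) <= 4 * d.
Proof.
move=> d0 kc li; have lm : (l < minn i N)%N by rewrite leq_min li ltn_ord.
rewrite eavgE ReCint.
rewrite (_ : (fun x => Re _) = fun x : rtuple R (minn i N) =>
   plateau 2 d (tnth k0 l) (tnth x (Ordinal lm)) *
   plateau 2 d (tnth k0 l) (tnth x (Ordinal lm))); last first.
  apply/funext => x; rewrite mul_conj_norm bumpE//= subst_point_lt.
  by rewrite expr0n addr0 sqr_sqrtr ?sqr_ge0// expr2.
(* The bump vanishes outside |x - c| <= 2d, a slab of mass at most 2 (2d). *)
have -> : 4 * d = 2 * (2 * d) by ring.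
apply: (@Rintegral_slab R _ (Ordinal lm) (tnth k0 l)).
- by rewrite mulr_ge0// ltW.
- by apply: ucbM; exact: ucb_plateau.
- move=> x; have := plateau_itv 2 d (tnth k0 l) (tnth x (Ordinal lm)).
  by move: (plateau _ _ _ _) => y /andP[y0 y1]; rewrite mulr_ge0//= mulr_ile1.
- move=> x xc h; suff -> : plateau 2 d (tnth k0 l) (tnth x (Ordinal lm)) = 0.
    by rewrite mulr0.
  rewrite /plateau [clamp01 (tnth _ _)]clamp01_id ?xc//.
  rewrite /clamp01; apply/max_idPl; rewrite ge_min; apply/orP; right.
  by rewrite subr_le0 ler_pdivlMr// ltW.
Qed.

(** Cauchy-Schwarz for f Y = (f Y) * [bump 2]: the first factor costs sup |Y|^2 times the average of
    |f|^2, the second has square mass at most 4d. *)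
Lemma eavg_small (Y : CF) : exists2 c : R, 0 <= c &
  forall d k0 (l : 'I_N) i f k, 0 < d -> cube N k0 -> (l < i)%N ->
    f * bump 2 d k0 l = f ->
    normc (e i (f * Y) k) ^+ 2 <= c * d * Re (e i (f * CF_conj f) k).
Proof.
have [c c0 hc] := CF_bounded Y; exists (4 * c ^+ 2).
  by rewrite mulr_ge0// exprn_ge0.
move=> d k0 l i f k d0 kc li fb.
pose u := f * Y; pose v := bump 2 d k0 l.
have -> : f * Y = u * v by rewrite /u mulrAC fb.
have CS := eavg_CS i u v k.
have pos (w : CF) : 0 <= e i (w * CF_conj w) k.
  by apply: eavg_ge0 => k'; rewrite mul_conj_norm ler0c exprn_ge0// normc_ge0.
have h1 : e i (u * CF_conj u) k <= (c ^+ 2)%:C * e i (f * CF_conj f) k.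
  rewrite -eavgZ; apply: eavg_le => k'.
  rewrite (mul_conj_norm u) (CF_M (CF_cst (c ^+ 2)%:C)) CF_cstE (mul_conj_norm f).
  rewrite -rmorphM lecR (CF_M f Y) normcM exprMn mulrC.
  rewrite ler_wpM2r ?exprn_ge0 ?normc_ge0// ler_sqr ?nnegrE ?normc_ge0//.
  by rewrite -lecR -normcE'.
have h2 := eavg_plateau k d0 kc li; rewrite -/v in h2.
have pu := pos u; have pv := pos v; have pf := pos f; move: CS.
rewrite normcE' (CF_pos pu) (CF_pos pv) -rmorphM -rmorphXn lecR => hCS.
move: h1; rewrite (CF_pos pu) (CF_pos pf) -rmorphM lecR => h1.
apply: le_trans hCS _.
have A0 : 0 <= Re (e i (u * CF_conj u) k) by move: pu; rewrite lecE => /andP[].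
have B0 : 0 <= Re (e i (v * CF_conj v) k) by move: pv; rewrite lecE => /andP[].
have -> : 4 * c ^+ 2 * d * Re (e i (f * CF_conj f) k) =
    c ^+ 2 * Re (e i (f * CF_conj f) k) * (4 * d) by ring.
exact: ler_pM.
Qed.

Lemma mact_scale M (r : symbol CF M) l p (X : 'M[CF]_(M, p)) (f : CF) :
  e l f = f -> mact he r l (f *: X) = f *: mact he r l X.
Proof.
move=> fl; rewrite -!mul_mx_scalar.
have -> : f%:M = mxavg e l (f%:M : 'M[CF]_p).
  apply/matrixP => a b; rewrite !mxE.
  by case: (_ == _); rewrite ?mulr1n ?mulr0n ?fl// (avg0 he).
exact: (act_avg he (V := mx_module he p) r X (f%:M) (leqnn l)).
Qed.

Lemma mactSE M (r : symbol CF M) l p (X : 'M[CF]_(M, p)) :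
  mact he r l.+1 X =
  mact he r l X + sA r l.+1 *m mxavg e l.+1 (sB r l.+1 *m X).
Proof. by []. Qed.

(** The errors made at different levels involve different averages of |f|^2. The sum majorizes them
    all, and e_N turns it back into (N+1) e_N(|f|^2). *)
Definition levels (f : CF) : CF := \sum_(i < N.+1) e i (f * CF_conj f).

Lemma avg_sq_ge0 i (f : CF) k : 0 <= e i (f * CF_conj f) k.
Proof.
by apply: eavg_ge0 => k'; rewrite mul_conj_norm ler0c exprn_ge0// normc_ge0.
Qed.

Lemma levels_ge (f : CF) i k : (i <= N)%N ->
  Re (e i (f * CF_conj f) k) <= Re (levels f k).
Proof.
move=> iN; have iN' : (i < N.+1)%N by [].
rewrite /levels CF_sum (bigD1 (Ordinal iN'))//= cReD lerDl cRe_sum.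
by apply: sumr_ge0 => j _; have := avg_sq_ge0 j f k; rewrite lecE => /andP[].
Qed.

(* If f is concentrated near the slice k_l = k0_l and does not depend on the
   first l coordinates, then the averages over more than l coordinates are
   negligible on f X, while the lower ones commute with f. *)
Lemma localization M (r : symbol CF M) (X : 'cV[CF]_M) (l : 'I_N) n :
  (l <= n <= N)%N -> exists2 c : R, 0 <= c &
  forall d k0 f k, 0 < d -> cube N k0 -> f * bump 2 d k0 l = f -> e l f = f ->
    sqnorm (mxev k (mact he r n (f *: X) - f *: mact he r l X)) <=
    c * d * Re (levels f k).
Proof.
have base m : m = l :> nat -> exists2 c : R, 0 <= c &
    forall d k0 f k, 0 < d -> cube N k0 -> f * bump 2 d k0 l = f -> e l f = f ->
    sqnorm (mxev k (mact he r m (f *: X) - f *: mact he r l X)) <=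
    c * d * Re (levels f k).
  move=> ->; exists 0 => // d k0 f k d0 kc fb fl.
  rewrite mact_scale// subrr /mxev map_mx0 /sqnorm big1 ?mul0r// => a _.
  by rewrite mxE normc0 expr0n.
elim: n => [|n IH] /andP[ln nN].
  by apply: base; apply/eqP; rewrite eq_sym -leqn0.
move: ln; rewrite leq_eqVlt => /orP[/eqP ln|ln]; first exact: base.
have ln' : (l <= n <= N)%N by rewrite -ltnS ln (ltnW nN).
have [c1 c10 h1] := IH ln'.
have [c2 c20 h2] := mulmx_sqnorm_bound (sA r n.+1).
pose Y := sB r n.+1 *m X.
have hY b : exists c : R, 0 <= c /\
  forall d k0 f k, 0 < d -> cube N k0 -> f * bump 2 d k0 l = f ->
    normc (e n.+1 (f * Y b ord0) k) ^+ 2 <= c * d * Re (e n.+1 (f * CF_conj f) k).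
  have [c c0 hc] := eavg_small (Y b ord0).
  by exists c; split=> // d k0 f k d0 kc fb; apply: (hc d k0 l).
pose c b := sval (cid (hY b)).
have c0 b : 0 <= c b by have [] := svalP (cid (hY b)).
have cP b := (svalP (cid (hY b))).2.
(* [c1] bounds the error up to level n, while [c2] and the [c b] bound the new term A <B f X>_(n+1).
   The factor 2 is lost in [sqnormD]. *)
exists (2 * (c1 + c2 * \sum_b c b)).
  by rewrite mulr_ge0// addr_ge0// mulr_ge0// sumr_ge0.
move=> d k0 f k d0 kc fb fl.
pose w := mxavg e n.+1 (sB r n.+1 *m (f *: X)).
have wE : w = mxavg e n.+1 (f *: Y) by rewrite /w -scalemxAr.
rewrite mactSE addrAC /mxev map_mxD map_mxM -!/(mxev k _) -/w.
apply: le_trans (sqnormD _ _) _.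
have L0 : 0 <= Re (levels f k).
  apply: le_trans (levels_ge f k nN).
  by have := avg_sq_ge0 n.+1 f k; rewrite lecE => /andP[].
have hw : sqnorm (mxev k w) <= (\sum_b c b) * d * Re (levels f k).
  rewrite /sqnorm -mulrA mulr_suml; apply: ler_sum => b _.
  rewrite wE 3!mxE /ev; apply: le_trans (cP b d k0 f k d0 kc fb) _.
  rewrite -mulrA; apply: ler_wpM2l; first exact: c0.
  by apply: ler_wpM2l; [exact: ltW|exact: levels_ge].
rewrite -!mulrA ler_pM2l//; apply: le_trans (lerD (h1 d k0 f k d0 kc fb fl) (h2 _ _)) _.
rewrite mulrDl -mulrA lerD2l -mulrA ler_wpM2l// mulrA; exact: hw.
Qed.

End Localization.

(** * Uniqueness of the truncations and lower bounds on fibres *)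

Section Uniqueness.
Context {R : realType} {N : nat}.
Local Notation CF := (@CF R N).
Local Notation e := (@eavg R N).
Local Notation he := (@averaging_eavg R N).

Lemma plateau_mul (d c x : R) : 0 < d -> plateau 1 d c x * plateau 2 d c x = plateau 1 d c x.
Proof.
move=> d0; rewrite /plateau; set y : R := `|_| / d.
have [y1|y1] := lerP 1 y.
  have -> : clamp01 (1 - y) = 0.
    by rewrite /clamp01; apply/max_idPl; rewrite ge_min; apply/orP; right; lra.
  by rewrite mul0r.
have -> : clamp01 (2 - y) = 1.
  rewrite /clamp01 (min_idPl _) ?(max_idPr _)//; lra.
by rewrite mulr1.
Qed.

Lemma bump_mul (d : R) k0 (l : 'I_N) : 0 < d -> bump 1 d k0 l * bump 2 d k0 l = bump 1 d k0 l.
Proof.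
move=> d0; apply: CF_eqP => k; rewrite (CF_M (bump 1 d k0 l)) !bumpE//.
by rewrite -rmorphM plateau_mul.
Qed.

Lemma bump_center (a d : R) k0 (l : 'I_N) : 1 <= a -> 0 < d -> cube N k0 -> bump a d k0 l k0 = 1.
Proof.
move=> a1 d0 kc; rewrite bumpE// /plateau [clamp01 (tnth _ _)]clamp01_id ?kc// subrr normr0 mul0r subr0.
by rewrite /clamp01 (min_idPl a1) (max_idPr ler01).
Qed.

Lemma levels_le (f : CF) k : (forall k, normc (f k) <= 1) ->
  Re (levels f k) <= N.+1%:R.
Proof.
move=> f1; rewrite /levels CF_sum cRe_sum.
have -> : N.+1%:R = \sum_(i < N.+1) 1 :> R by rewrite sumr_const card_ord.
apply: ler_sum => i _.
have : e i (f * CF_conj f) k <= e i (CF_cst 1) k.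
  apply: eavg_le => k'; rewrite mul_conj_norm CF_cstE -[1]/(1%:C) lecR.
  by rewrite exprn_ile1// normc_ge0.
by rewrite eavg_cst CF_cstE lecE => /andP[].
Qed.

Lemma sqnormN n (v : 'cV[R[i]]_n) : sqnorm (- v) = sqnorm v.
Proof. by rewrite -scaleN1r sqnormZ normcN normc1 expr1n mul1r. Qed.

Lemma mxevZ p q k (f : CF) (A : 'M[CF]_(p, q)) : mxev k (f *: A) = f k *: mxev k A.
Proof. by apply/matrixP => i j; rewrite !mxE. Qed.

Lemma le_eps_eq0 (x c : R) : 0 <= x -> (forall d, 0 < d -> x <= c * d) -> x = 0.
Proof.
move=> x0 h; apply/eqP; rewrite eq_le x0 andbT; apply/ler_addgt0Pr => eps e0.
have c1 : 0 < `|c| + 1 by rewrite ltr_wpDl.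
rewrite add0r (le_trans (h (eps / (`|c| + 1)) _)) ?divr_gt0//.
rewrite mulrA ler_pdivrMr// mulrC ler_pM2l//.
by rewrite (le_trans (ler_norm _))// lerDl.
Qed.

Lemma mact_mul_fix M (r : symbol CF M) l p q (X : 'M[CF]_(M, p)) (Y : 'M[CF]_(p, q)) :
  mxavg e l Y = Y -> mact he r l (X *m Y) = mact he r l X *m Y.
Proof.
move=> <-; exact: (act_avg he (V := mx_module he q) r X Y (leqnn l)).
Qed.

Lemma mxavg_delta l p q (a : 'I_p) (b : 'I_q) :
  mxavg e l (delta_mx a b : 'M[CF]_(p, q)) = delta_mx a b.
Proof.
apply/matrixP => i j; rewrite !mxE; case: (_ && _) => /=.
  exact: (averaging1 he).
exact: (avg0 he).
Qed.

(* For bumps f near a slice, T (f X) is close to f (T_l X), by localization. *)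
Lemma mact_levels M (r t : symbol CF M) :
  (forall X : 'cV[CF]_M, mact he r N X = mact he t N X) ->
  forall l p (X : 'M[CF]_(M, p)), (l <= N)%N -> mact he r l X = mact he t l X.
Proof.
move=> rt l p X lN.
have col_eq (Z : 'cV[CF]_M) : mact he r l Z = mact he t l Z.
  move: lN; rewrite leq_eqVlt => /orP[/eqP->//|lN].
  pose lO := Ordinal lN.
  have lNN : (lO <= N <= N)%N by rewrite ltnW/=.
  have [c1 c10 h1] := localization r Z lNN.
  have [c2 c20 h2] := localization t Z lNN.
  apply/matrixP => a b; rewrite ord1; apply: CF_eq_cube => k kc.
  pose D := mact he r l Z - mact he t l Z.
  suff D0 : sqnorm (mxev k D) = 0.
    apply/eqP; rewrite -subr_eq0; apply/eqP/eq0_normc/eqP; rewrite -sqrf_eq0.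
    have -> : mact he r l Z a ord0 k - mact he t l Z a ord0 k = mxev k D a ord0.
      by rewrite /mxev /D !mxE.
    by rewrite eq_le -{1}D0 normc_le_sqnorm/= exprn_ge0// normc_ge0.
  apply: (@le_eps_eq0 _ (2 * (c1 + c2) * N.+1%:R)); first exact: sqnorm_ge0.
  move=> d d0; pose f := bump 1 d k lO.
  have fb : f * bump 2 d k lO = f by exact: bump_mul.
  have fl : e lO f = f by exact: eavg_bump.
  have f1 : f k = 1 by exact: bump_center.
  have fle k' : normc (f k') <= 1.
    rewrite bumpE// /= expr0n addr0 sqrtr_sqr.
    by have /andP[p0 p1] := plateau_itv 1 d (tnth k lO) (tnth k' lO); rewrite ger0_norm.
  have hL := levels_le k fle.
  (* The two symbols agree at level N, so f D is the difference of the two localization errors. At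
     [k], where f = 1, this bounds D itself. *)
  pose Dr := mact he r N (f *: Z) - f *: mact he r l Z.
  pose Dt := mact he t N (f *: Z) - f *: mact he t l Z.
  have -> : mxev k D = mxev k Dt + - mxev k Dr.
    have -> : mxev k D = mxev k (f *: D) by rewrite mxevZ f1 scale1r.
    rewrite -map_mxB; congr (mxev k _); rewrite /Dt /Dr -rt scalerBr opprB.
    by rewrite [RHS]addrC addrA subrK.
  apply: le_trans (sqnormD _ _) _; rewrite sqnormN.
  have -> : 2 * (c1 + c2) * N.+1%:R * d = 2 * (c2 * d * N.+1%:R + c1 * d * N.+1%:R).
    by ring.
  rewrite ler_pM2l// lerD//.
    apply: le_trans (h2 d k f k d0 kc fb fl) _.
    by rewrite ler_wpM2l// mulr_ge0// ltW.
  apply: le_trans (h1 d k f k d0 kc fb fl) _.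
  by rewrite ler_wpM2l// mulr_ge0// ltW.
(* A column of X is X times a constant matrix, which passes through T_l, so columns suffice. *)
apply/matrixP => a b.
have := col_eq (col b X); rewrite colE !mact_mul_fix ?mxavg_delta// -!colE.
by move/matrixP/(_ a ord0); rewrite !mxE.
Qed.

(* On functions concentrated near a fibre, the levels above j disappear from
   the lower bound. *)
Lemma fibre_injective M (r : symbol CF M) (C : R) : 0 <= C ->
  (forall (X : 'cV[CF]_M) k, Re (e N (sq X) k) <= C * Re (e N (sq (mact he r N X)) k)) ->
  forall j (X : 'cV[CF]_M) k0, (j <= N)%N -> cube N k0 ->
  e j (sq (mact he r j X)) k0 = 0 -> e j (sq X) k0 = 0.
Proof.
move=> C0 below j X k0 jN kc T0.
pose h1 := e j (sq X); pose h2 := e j (sq (mact he r j X)).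
have h1_ge0 k : 0 <= h1 k by apply: eavg_ge0 => k'; exact: sq_ge0.
have h2_ge0 k : 0 <= h2 k by apply: eavg_ge0 => k'; exact: sq_ge0.
(* For j = N, f = 1 and c = 0 serve. Otherwise f localizes in every coordinate from k_(j+1) on, so
   that its support lies near the fibre of [k0]. *)
have [c c0 hc] : exists2 c : R, 0 <= c &
  forall d, 0 < d -> exists2 f : CF, [/\ e j f = f, f k0 = 1 &
      forall k, f k != 0 -> exists2 k', close d k' k0 &
        forall i : 'I_N, (j <= i)%N -> tnth k' i = tnth (clamp k) i] &
    forall k, sqnorm (mxev k (mact he r N (f *: X) - f *: mact he r j X)) <=
      c * d * Re (levels f k).
  move: (jN); rewrite leq_eqVlt => /orP[/eqP ejN|ltjN].
    exists 0 => // d d0; exists 1.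
      split; [exact: (averaging1 he)|by []|move=> k _].
      exists k0; first by move=> i; rewrite subrr normr0.
      by move=> i; rewrite ejN leqNgt ltn_ord.
    move=> k; rewrite ejN !scale1r subrr /mxev map_mx0 /sqnorm big1 ?mul0r// => a _.
    by rewrite mxE normc0 expr0n.
  pose lO := Ordinal ltjN.
  have lNN : (lO <= N <= N)%N by rewrite ltnW/=.
  have [c c0 hc] := localization r X lNN.
  (* The factor at [lO] alone provides the hypothesis of [localization]; the others shrink the
     support to the fibre. *)
  exists c => // d d0; pose f : CF := \prod_(i < N | (j <= i)%N) bump 1 d k0 i.
  have fE k : f k = \prod_(i < N | (j <= i)%N) bump 1 d k0 i k.
    exact: (rmorph_prod (ev k)).
  exists f; last first.
    move=> k; apply: (hc d k0 f k) => //.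
      rewrite /f (bigD1 lO)//= mulrAC; congr (_ * _); exact: bump_mul.
    rewrite /f -/(nat_of_ord lO); apply: (big_ind (fun g => e lO g = g)).
    - exact: (averaging1 he).
    - by move=> g g' gj gj'; rewrite -[in LHS]gj (averagingM he)// gj gj'.
    - by move=> i ji; exact: eavg_bump.
  split.
  - apply: (big_ind (fun g => e j g = g)).
    + exact: (averaging1 he).
    + by move=> g g' gj gj'; rewrite -[in LHS]gj (averagingM he)// gj gj'.
    + by move=> i ji; exact: eavg_bump.
  - by rewrite fE big1// => i _; exact: bump_center.
  (* [k'] has the tail of [clamp k], hence the same averages of level j as [k], and the head of
     [k0], hence is close to [k0] in every coordinate. *)
  - move=> k fk; pose k' : rtuple R N :=
      [tuple if (i < j)%N then tnth k0 i else tnth (clamp k) i | i < N].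
    exists k' => i; last by move=> ji; rewrite tnth_mktuple ltnNge ji.
    rewrite tnth_mktuple; case: (ltnP i j) => ij; first by rewrite subrr normr0.
    have bi : bump 1 d k0 i k != 0.
      by apply: contraNneq fk => b0; rewrite fE (bigD1 i)//= b0 mul0r.
    rewrite tnth_mktuple ltNge; apply: contra bi => h.
    rewrite bumpE// /plateau (_ : clamp01 _ = 0)//.
    rewrite /clamp01; apply/max_idPl; rewrite ge_min; apply/orP; right.
    by rewrite subr_le0 ler_pdivlMr// mul1r.
have eavgR_le i (g h : CF) k : (forall k, Re (g k) <= Re (h k)) ->
    Re (e i g k) <= Re (e i h k).
  move=> gh; rewrite !eavgE !ReCint; apply: le_Rintegral => //.
  - exact: (@measurable_cube R _).
  - by have [] := @CF_Cintegrable R N (minn i N) g k.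
  - by have [] := @CF_Cintegrable R N (minn i N) h k.
apply/eqP/negP => /negP h1k0.
have eta0 : 0 < Re (h1 k0).
  have := h1_ge0 k0; rewrite le_eqVlt eq_sym (negbTE h1k0)/= ltcE.
  by case/andP.
suff : Re (h1 k0) / 2 = 0 by move/eqP; rewrite mulf_eq0 gt_eqF//= invr_eq0 pnatr_eq0.
apply: (@le_eps_eq0 _ (C * (2 * (c * N.+1%:R) + 2))); first by rewrite divr_ge0// ltW.
move=> eps eps0.
have eta2 : 0 < Re (h1 k0) / 2 by rewrite divr_gt0.
have [d1 d10 hd1] := CF_near h1 k0 eta2.
have [d2 d20 hd2] := CF_near h2 k0 eps0.
pose d := Num.min eps (Num.min d1 d2).
have d0 : 0 < d by rewrite !lt_min eps0 d10.
have [f [fj f1 fsupp] hf] := hc d d0.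
pose g := f * CF_conj f.
have gj : e j g = g.
  by have := averagingM he f (CF_conj f) (leqnn j); rewrite fj eavg_conj fj.
have gE k : g k = (normc (f k) ^+ 2)%:C by rewrite /g mul_conj_norm.
have tail k k' (u : CF) : (forall i : 'I_N, (j <= i)%N -> tnth k' i = tnth (clamp k) i) ->
    e j u k = e j u k'.
  by move=> kk'; rewrite -CF_clamp; apply: eavg_tail => i /kk' ->.
(* As g is constant in the first j coordinates, integration against it only sees the fibre average
   of [u]. *)
have eN (u : CF) k : e N (g * u) k = e N (g * e j u) k.
  rewrite -(averagingT he (g * u) jN).
  by have := averagingM he g u (leqnn j); rewrite gj => ->.
have E0 : 0 < Re (e N g k0).
  have : e N g k0 != 0.
    apply/negP => /eqP/eavgN_eq0 g0; have /(congr1 (ev k0)) : g = 0.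
      by apply: g0 => k; rewrite gE ler0c exprn_ge0// normc_ge0.
    by rewrite /ev gE f1 normc1 expr1n => /eqP; rewrite oner_eq0.
  have : 0 <= e N g k0 by exact: avg_sq_ge0.
  by rewrite le_eqVlt eq_sym => /orP[->//|]; rewrite ltcE => /andP[].
(* Both bounds below carry the mass of g as a factor; it is positive because g(k0) = 1. *)
rewrite -(ler_pM2r E0).
have sqf (Z : 'cV[CF]_M) : sq (f *: Z) = g * sq Z.
  apply: CF_eqP => k; rewrite (CF_M g) gE !sqE -rmorphM -sqnormZ.
  by rewrite mxevZ.
(* On the support of f, h1 stays above half of its value at [k0]. *)
have low : Re (h1 k0) / 2 * Re (e N g k0) <= Re (e N (sq (f *: X)) k0).
  rewrite sqf eN -/h1.
  have -> : Re (h1 k0) / 2 * Re (e N g k0) = Re (e N (CF_cst (Re (h1 k0) / 2)%:C * g) k0).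
    by rewrite eavgZ cReM /= mul0r subr0.
  apply: eavgR_le => k; rewrite (CF_M g) (CF_M (CF_cst _)) CF_cstE gE !cReM /= !mul0r !subr0.
  have [->|fk] := eqVneq (f k) 0; first by rewrite normc0 expr0n !mul0r mulr0.
  have [k' kk' kt] := fsupp k fk; rewrite mulrC ler_wpM2l ?exprn_ge0 ?normc_ge0//.
  rewrite (tail k k')// -/h1.
  have : `|h1 k0 - h1 k'| < (Re (h1 k0) / 2)%:C.
    apply: hd1 => i; rewrite distrC (lt_le_trans (kk' i))//.
    by rewrite /d !ge_min lexx !orbT.
  rewrite normcE' ltcR => /(le_lt_trans (norm_Re _)); rewrite cReD cReN.
  by rewrite ltr_distl => /andP[_]; rewrite -ltrBlDr; lra.
(* T (f X) is the localization error, of square norm at most c d [levels f], plus f T_j X, whose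
   fibre average h2 is below [eps] on the support of f since h2 vanishes at [k0]. *)
have up : Re (e N (sq (mact he r N (f *: X))) k0) <=
    (2 * (c * N.+1%:R) + 2) * eps * Re (e N g k0).
  pose U := CF_cst (2 * (c * d))%:C * levels f + CF_cst 2%:C * sq (f *: mact he r j X).
  apply: (@le_trans _ _ (Re (e N U k0))).
    apply: eavgR_le => k; rewrite sqE /U.
    rewrite CF_D cReD (CF_M (CF_cst _)) CF_cstE (CF_M (CF_cst _)) CF_cstE !cReM /= !mul0r !subr0.
    rewrite sqE /= -!mulrA -mulrDr.
    rewrite -[mact he r N _](subrK (f *: mact he r j X)) [mxev k _]map_mxD.
    apply: le_trans (sqnormD _ _) _; rewrite ler_pM2l// lerD2r mulrA; exact: hf.
  rewrite /U (eavgD N (CF_cst _ * _)) (eavgZ N (2 * (c * d))%:C) (eavgZ N 2%:C).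
  rewrite sqf eN -/h2 cReD !cReM /= !mul0r !subr0.
  have -> : Re (e N (levels f) k0) = N.+1%:R * Re (e N g k0).
    have -> : e N (levels f) = \sum_(i < N.+1) e N g.
      rewrite /levels (avg_sum he); apply: eq_bigr => i _.
      by rewrite (averagingT he)// -ltnS.
    by rewrite CF_sum cRe_sum sumr_const card_ord mulr_natl.
  have h2le : Re (e N (g * h2) k0) <= eps * Re (e N g k0).
    have -> : eps * Re (e N g k0) = Re (e N (CF_cst eps%:C * g) k0).
      by rewrite eavgZ cReM /= mul0r subr0.
    apply: eavgR_le => k; rewrite (CF_M g) (CF_M (CF_cst _)) CF_cstE gE !cReM /= !mul0r !subr0.
    have [->|fk] := eqVneq (f k) 0; first by rewrite normc0 expr0n !mul0r mulr0.
    have [k' kk' kt] := fsupp k fk; rewrite mulrC ler_wpM2r ?exprn_ge0 ?normc_ge0//.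
    rewrite (tail k k')// -/h2.
    have : `|h2 k0 - h2 k'| < eps%:C.
      apply: hd2 => i; rewrite distrC (lt_le_trans (kk' i))//.
      by rewrite /d !ge_min lexx !orbT.
    rewrite [h2 k0]T0 sub0r normrN normcE' ltcR => /(le_lt_trans (norm_Re _)).
    by move=> /(le_lt_trans (ler_norm _))/ltW.
  have dle : d <= eps by rewrite /d ge_min lexx.
  have -> : (2 * (c * N.+1%:R) + 2) * eps * Re (e N g k0) =
      2 * (c * eps) * (N.+1%:R * Re (e N g k0)) + 2 * (eps * Re (e N g k0)) by ring.
  apply: lerD; last by rewrite ler_pM2l.
  apply: ler_wpM2r; first by rewrite mulr_ge0// ltW.
  by rewrite ler_pM2l// ler_wpM2l.
apply: le_trans low _; apply: le_trans (below _ k0) _.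
by rewrite -!mulrA ler_wpM2l// mulrA; exact: up.
Qed.

End Uniqueness.

(** * The square integrable functions as a module *)

Section SquareIntegrable.
Context {R : realType}.
Local Notation mu n := (@leb_cube R n).
Local Notation cube := (@cube R).
Local Notation vfun n p := (rtuple R n -> 'cV[R[i]]_p).

Definition N2 n p (u : vfun n p) : \bar R :=
  (\int[mu n]_(k in cube n) (sqnorm (u k))%:E)%E.

Lemma eq_sq_integrable n p (u v : vfun n p) :
  (forall k, cube n k -> u k = v k) -> sq_integrable u -> sq_integrable v.
Proof.
move=> uv [mu_ iu]; split.
  move=> i; have [mr mi] := mu_ i; split.
    by apply: eq_measurable_fun mr => k; rewrite inE => kc; rewrite uv.
  by apply: eq_measurable_fun mi => k; rewrite inE => kc; rewrite uv.
suff e : N2 u = N2 v by rewrite -[ltLHS]/(N2 v) -e.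
by apply: eq_integral => k; rewrite inE => kc; rewrite uv.
Qed.

Lemma N2_ge0 n p (u : vfun n p) : (0 <= N2 u)%E.
Proof. by apply: integral_ge0 => k _; rewrite lee_fin sqnorm_ge0. Qed.

(** The total mass is finite and |f| <= 1 + f^2. *)
Lemma sqr_integrable n (f : rtuple R n -> R) : measurable_fun (cube n) f ->
  (\int[mu n]_(k in cube n) (f k ^+ 2)%:E < +oo)%E ->
  (mu n).-integrable (cube n) (EFin \o (fun k => f k ^+ 2)) /\
  (mu n).-integrable (cube n) (EFin \o f).
Proof.
move=> mf f2; have mc := @measurable_cube R n.
have i2 : (mu n).-integrable (cube n) (EFin \o (fun k => f k ^+ 2)).
  apply/integrableP; split; first by apply/measurable_EFinP; exact: measurable_funX.
  rewrite (eq_integral (fun k => (f k ^+ 2)%:E))// => k _ /=.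
  by rewrite ger0_norm ?sqr_ge0.
split=> //.
have i1 : (mu n).-integrable (cube n) (EFin \o (fun k => 1 + f k ^+ 2)).
  have i0 : (mu n).-integrable (cube n) (EFin \o (fun=> 1)).
    by apply: ucb_integrable; exact: ucb_cst.
  exact: (integrableD mc i0 i2).
apply: le_integrable i1 => //; first exact/measurable_EFinP.
move=> x _ /=; rewrite lee_fin [leRHS]ger0_norm ?addr_ge0 ?sqr_ge0//.
by rewrite ler_norml; apply/andP; split; nra.
Qed.

(** The variance of f is nonnegative and the total mass is 1. *)
Lemma Rintegral_sqr_le n (f : rtuple R n -> R) :
  (mu n).-integrable (cube n) (EFin \o f) ->
  (mu n).-integrable (cube n) (EFin \o (fun k => f k ^+ 2)) ->
  (\int[mu n]_(k in cube n) f k) ^+ 2 <= \int[mu n]_(k in cube n) (f k ^+ 2).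
Proof.
move=> f1 f2; have mc := @measurable_cube R n.
set c := (\int[mu n]_(k in cube n) f k).
have i1 : (mu n).-integrable (cube n) (EFin \o (fun k => (2 * c) * f k)).
  exact: (integrableZl mc _ f1).
have i3 : (mu n).-integrable (cube n) (EFin \o (fun k => c ^+ 2)).
  by apply: ucb_integrable; exact: ucb_cst.
have i2 : (mu n).-integrable (cube n) (EFin \o (fun k => f k ^+ 2 - (2 * c) * f k)).
  exact: (integrableB mc f2 i1).
have : 0 <= \int[mu n]_(k in cube n) (f k ^+ 2 - (2 * c) * f k + c ^+ 2).
  apply: Rintegral_ge0 => k _.
  have -> : f k ^+ 2 - 2 * c * f k + c ^+ 2 = (f k - c) ^+ 2 by ring.
  exact: sqr_ge0.
rewrite RintegralD// RintegralB// RintegralZl// Rintegral_cube_cst -/c; lra.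
Qed.

Lemma normc_sqr_ge (z : R[i]) : Re z ^+ 2 <= normc z ^+ 2 /\ Im z ^+ 2 <= normc z ^+ 2.
Proof. by rewrite normc_sqr lerDl lerDr !sqr_ge0. Qed.

Section Components.
Variables (n p : nat) (u : vfun n p).
Hypothesis su : sq_integrable u.

Lemma comp_integrable i :
  [/\ (mu n).-integrable (cube n) (EFin \o (fun k => Re (u k i ord0) ^+ 2)),
      (mu n).-integrable (cube n) (EFin \o (fun k => Im (u k i ord0) ^+ 2)) &
      Cintegrable (fun k => u k i ord0)].
Proof.
have [mu_ iu] := su; have [mr mi] := mu_ i; have mc := @measurable_cube R n.
have bnd (f : rtuple R n -> R) : measurable_fun (cube n) f ->
    (forall k, f k ^+ 2 <= sqnorm (u k)) ->
    (\int[mu n]_(k in cube n) (f k ^+ 2)%:E < +oo)%E.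
  move=> mf fu; apply: le_lt_trans iu; apply: ge0_le_integral => //.
  - by move=> k _; rewrite lee_fin sqr_ge0.
  - by apply/measurable_EFinP; exact: measurable_funX.
  - by apply/measurable_EFinP; exact: measurable_sqnorm.
  - by move=> k _; rewrite lee_fin.
have [r2 r1] : _ /\ _ := sqr_integrable mr (bnd _ mr (fun k => le_trans (normc_sqr_ge _).1 (normc_le_sqnorm _ _))).
have [i2 i1] : _ /\ _ := sqr_integrable mi (bnd _ mi (fun k => le_trans (normc_sqr_ge _).2 (normc_le_sqnorm _ _))).
by split.
Qed.

Lemma sqnorm_mean_le :
  sqnorm (\col_i Cint (fun k => u k i ord0)) <= \int[mu n]_(k in cube n) sqnorm (u k).
Proof.
have mc := @measurable_cube R n.
have is2 i : (mu n).-integrable (cube n) (EFin \o (fun k => normc (u k i ord0) ^+ 2)).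
  have [r2 i2 _] := comp_integrable i.
  under eq_fun do rewrite normc_sqr.
  exact: (integrableD mc r2 i2).
have -> : \int[mu n]_(k in cube n) sqnorm (u k) =
    \sum_i \int[mu n]_(k in cube n) (normc (u k i ord0) ^+ 2).
  rewrite /sqnorm; elim: (index_enum _) => [|i s IH].
    rewrite big_nil -[RHS](Rintegral_cube_cst n 0).
    by apply: eq_Rintegral => k _; rewrite big_nil.
  rewrite big_cons -IH -RintegralD//.
    by apply: eq_Rintegral => k _; rewrite big_cons.
  rewrite (_ : _ \o _ = (fun k => (\sum_(j <- s) (normc (u k j ord0) ^+ 2)%:E)%E)).
    by apply: integrable_sum => // j _; exact: is2.
  by apply/funext => k; rewrite /= sumEFin.
apply: ler_sum => i _; rewrite mxE normc_sqr /=.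
have [r2 i2 [r1 i1]] := comp_integrable i.
apply: (le_trans (lerD (Rintegral_sqr_le r1 r2) (Rintegral_sqr_le i1 i2))).
rewrite -RintegralD//; apply: le_Rintegral => //.
  exact: (integrableD mc r2 i2).
by move=> k _; rewrite normc_sqr.
Qed.

End Components.

End SquareIntegrable.

(** * Averages of square integrable functions *)

Section AverageL2.
Context {R : realType} {N : nat}.
Local Notation mu n := (@leb_cube R n).
Local Notation cube := (@cube R).
Local Notation CF := (@CF R N).
Local Notation vfun p := (rtuple R N -> 'cV[R[i]]_p).

Definition aeq p (u v : vfun p) : Prop :=
  {ae mu N, forall k, cube N k -> u k = v k}.

Lemma sq_section j p (u : vfun p) : (j <= N)%N -> sq_integrable u ->
  {ae mu N, forall k, cube N k ->
     sq_integrable (fun x : rtuple R j => u (subst_point x k))}.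
Proof.
move=> jN [mu_ iu]; have mc := @measurable_cube R N.
have ms : measurable_fun (cube N) (fun k => (sqnorm (u k))%:E).
  by apply/measurable_EFinP; exact: measurable_sqnorm.
have s0 k : cube N k -> (0 <= (sqnorm (u k))%:E)%E by rewrite lee_fin sqnorm_ge0.
have mG := @measurable_cube_avg_ge0 R N j _ ms s0.
have IG : (mu N).-integrable (cube N)
    (fun k => \int[mu j]_(x in cube j) (sqnorm (u (subst_point x k)))%:E)%E.
  apply/integrableP; split=> //.
  rewrite (eq_integral (fun k => \int[mu j]_(x in cube j) (sqnorm (u (subst_point x k)))%:E)%E).
    by rewrite (ge0_integral_cube_subst jN ms s0).
  by move=> k _; rewrite gee0_abs// integral_ge0// => x _; rewrite lee_fin sqnorm_ge0.
apply: filterS (integrable_ae mc IG) => k hk kc; split.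
  move=> i; have [mr mi] := mu_ i; split.
    exact: (measurable_section kc mr).
  exact: (measurable_section kc mi).
by have := hk kc; rewrite fin_numElt => /andP[].
Qed.

Lemma avgE j p (u : vfun p) k :
  avg j u k = \col_i Cint (fun x : rtuple R j => u (subst_point x k) i ord0).
Proof. by apply/matrixP => a b; rewrite !mxE ord1. Qed.

(** Jensen on each fibre, then integration over the fibres. Where the square integral over a fibre
    is infinite the bound is trivial. *)
Lemma avg_sq_integrable j p (u : vfun p) : (j <= N)%N -> sq_integrable u ->
  sq_integrable (avg j u) /\ (N2 (avg j u) <= N2 u)%E.
Proof.
move=> jN su; have [mu_ iu] := su.
have ms : measurable_fun (cube N) (fun k => (sqnorm (u k))%:E).
  by apply/measurable_EFinP; exact: measurable_sqnorm.
have s0 k : cube N k -> (0 <= (sqnorm (u k))%:E)%E by rewrite lee_fin sqnorm_ge0.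
have mv : measurable_vec (avg j u).
  move=> i; have [_ _ [r1 i1]] := comp_integrable su i; split.
    rewrite (_ : (fun k => _) = (fun k => \int[mu j]_(x in cube j) Re (u (subst_point x k) i ord0))).
      exact: (measurable_cube_avg jN r1).
    by apply/funext => k; rewrite !mxE.
  rewrite (_ : (fun k => _) = (fun k => \int[mu j]_(x in cube j) Im (u (subst_point x k) i ord0))).
    exact: (measurable_cube_avg jN i1).
  by apply/funext => k; rewrite !mxE.
have le : (N2 (avg j u) <= N2 u)%E.
  rewrite /N2 -[leRHS](ge0_integral_cube_subst jN ms s0).
  apply: ge0_le_integral => //.
  - exact: (@measurable_cube R N).
  - by move=> k _; rewrite lee_fin sqnorm_ge0.
  - by apply/measurable_EFinP; exact: measurable_sqnorm.
  - exact: (@measurable_cube_avg_ge0 R N j _ ms s0).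
  - move=> k kc.
    have mk : measurable_vec (fun x : rtuple R j => u (subst_point x k)).
      move=> i; have [mr mi] := mu_ i; split; first exact: (measurable_section kc mr).
      exact: (measurable_section kc mi).
    have [fin|] := ltP (\int[mu j]_(x in cube j) (sqnorm (u (subst_point x k)))%:E)%E +oo%E.
      have sk : sq_integrable (fun x : rtuple R j => u (subst_point x k)) by split.
      rewrite avgE; apply: le_trans (_ : (_ <= (\int[mu j]_(x in cube j) sqnorm (u (subst_point x k)))%:E)%E) _.
        by rewrite lee_fin; exact: (sqnorm_mean_le sk).
      rewrite /Rintegral fineK// ge0_fin_numE//.
      by apply: integral_ge0 => x _; rewrite lee_fin sqnorm_ge0.
    by rewrite leye_eq => /eqP ->; rewrite leey.
split=> //; split=> //; apply: le_lt_trans le iu.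
Qed.

Lemma N2_eq0 p (u : vfun p) : measurable_vec u ->
  N2 u = 0%E <-> aeq u (fun=> 0).
Proof.
move=> mu_; have mc := @measurable_cube R N.
have ms : measurable_fun (cube N) (fun k => (sqnorm (u k))%:E).
  by apply/measurable_EFinP; exact: measurable_sqnorm.
have sq0 k : (sqnorm (u k) = 0) <-> u k = 0.
  split=> [h|->].
    apply/matrixP => a b; rewrite ord1 mxE; apply: eq0_normc; apply/eqP.
    rewrite -sqrf_eq0 eq_le exprn_ge0 ?normc_ge0// andbT -h.
    exact: normc_le_sqnorm.
  by rewrite /sqnorm big1// => a _; rewrite mxE normc0 expr0n.
have abs : N2 u = (\int[mu N]_(k in cube N) `|(sqnorm (u k))%:E|)%E.
  by apply: eq_integral => k _; rewrite /= ger0_norm ?sqnorm_ge0.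
split=> [N0|u0].
  have /(ae_eq_integral_abs _ mc ms) := etrans (esym abs) N0.
  by apply: filterS => k h kc; apply/sq0; case: (h kc).
rewrite abs; apply/(ae_eq_integral_abs _ mc ms).
by apply: filterS u0 => k h kc; congr EFin; apply/sq0/h.
Qed.

Lemma sq_integrable_lin p c (u v : vfun p) :
  sq_integrable u -> sq_integrable v -> sq_integrable (c *: u + v).
Proof.
have [_ h] := @sqint_submod_closed R N p.
by have := h c u v; rewrite !inE => h' su sv; exact: h'.
Qed.

Lemma sq_integrable0 p : sq_integrable (0 : vfun p).
Proof. by have [h _] := @sqint_submod_closed R N p; move: h; rewrite inE. Qed.

Lemma sq_integrableZ p c (u : vfun p) : sq_integrable u -> sq_integrable (c *: u).
Proof.
by move=> su; rewrite -[_ *: _]addr0; apply: sq_integrable_lin => //; exact: sq_integrable0.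
Qed.

Lemma sq_integrableD p (u v : vfun p) :
  sq_integrable u -> sq_integrable v -> sq_integrable (u + v).
Proof. by move=> su sv; rewrite -[u]scale1r; exact: sq_integrable_lin. Qed.

Lemma sq_integrableB p (u v : vfun p) :
  sq_integrable u -> sq_integrable v -> sq_integrable (u - v).
Proof. by move=> su sv; rewrite addrC -scaleN1r; exact: sq_integrable_lin. Qed.

Lemma aeqB p (u v : vfun p) : aeq u v <-> aeq (u - v) (fun=> 0).
Proof.
split; apply: filterS => k h kc; have := h kc; first by rewrite -[(u - v) k]/(u k - v k) => ->; rewrite subrr.
by rewrite -[(u - v) k]/(u k - v k) => /eqP; rewrite subr_eq0 => /eqP.
Qed.

(** Only almost everywhere: [avg] need not be additive on the null set of fibres where a section is
    not integrable. *)
Lemma avg_aeD j p (u v : vfun p) : (j <= N)%N -> sq_integrable u -> sq_integrable v ->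
  aeq (avg j (u + v)) (avg j u + avg j v).
Proof.
move=> jN su sv; apply: filterS2 (sq_section jN su) (sq_section jN sv) => k hu hv kc.
apply/matrixP => a b; rewrite ord1 -[(avg j u + avg j v) k]/(avg j u k + avg j v k).
rewrite mxE !avgE !mxE.
have [_ _ cu] := comp_integrable (hu kc) a; have [_ _ cv] := comp_integrable (hv kc) a.
by rewrite -(CintD cu cv); apply: eq_Cint => x _; rewrite mxE.
Qed.

Lemma avg_aeZ j p c (u : vfun p) : (j <= N)%N -> sq_integrable u ->
  aeq (avg j (c *: u)) (c *: avg j u).
Proof.
move=> jN su; apply: filterS (sq_section jN su) => k hu kc.
apply/matrixP => a b; rewrite ord1 -[(c *: avg j u) k]/(c *: avg j u k).
rewrite mxE !avgE !mxE.
have [_ _ cu] := comp_integrable (hu kc) a.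
by rewrite -(CintZ c cu); apply: eq_Cint => x _; rewrite mxE.
Qed.

Lemma aeq_trans p (u v w : vfun p) : aeq u v -> aeq v w -> aeq u w.
Proof. by move=> uv vw; apply: filterS2 uv vw => k h1 h2 kc; rewrite h1// h2. Qed.

Lemma aeq_sym p (u v : vfun p) : aeq u v -> aeq v u.
Proof. by apply: filterS => k h kc; rewrite h. Qed.

Lemma aeq_cube p (u v : vfun p) : (forall k, cube N k -> u k = v k) -> aeq u v.
Proof. by move=> h; exact: aeW. Qed.

(** Averages contract the square norm, applied to u - v. This makes them well defined on classes. *)
Lemma avg_aeq j p (u v : vfun p) : (j <= N)%N -> sq_integrable u -> sq_integrable v ->
  aeq u v -> aeq (avg j u) (avg j v).
Proof.
move=> jN su sv uv; have sw := sq_integrableB su sv.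
have [sa le] := avg_sq_integrable jN sw.
have : aeq (avg j (u - v)) (fun=> 0).
  apply/N2_eq0; first by case: sa.
  apply/eqP; rewrite eq_le N2_ge0 andbT; apply: le_trans le _.
  by rewrite (iffRL (N2_eq0 sw.1) (iffLR (@aeqB p u v) uv)).
have := avg_aeD jN su (sq_integrableZ (-1) sv).
rewrite scaleN1r => h1 h2; have h3 := avg_aeZ (-1) jN sv.
rewrite !scaleN1r in h3.
apply: (iffRL (@aeqB _ _ _)); apply: aeq_trans h2; apply: aeq_sym; apply: aeq_trans h1 _.
apply: filterS h3 => k h kc.
by rewrite -[LHS]/(avg j u k + avg j (- v) k) h.
Qed.

Definition mulF p q (A : 'M[CF]_(p, q)) (u : vfun q) : vfun p :=
  fun k => mxev k A *m u k.

Lemma CF_measurable (f : CF) :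
  measurable_fun (cube N) (fun k => Re (f k)) /\
  measurable_fun (cube N) (fun k => Im (f k)).
Proof.
by split; apply: measurable_funTS; apply: measurable_ucb; [exact: CF_Re|exact: CF_Im].
Qed.

Lemma mulF_sq_integrable p q (A : 'M[CF]_(p, q)) : exists2 c : R, 0 <= c &
  forall u : vfun q, sq_integrable u ->
    sq_integrable (mulF A u) /\ (N2 (mulF A u) <= c%:E * N2 u)%E.
Proof.
have [c c0 hc] := mulmx_sqnorm_bound A; exists c => // u [mu_ iu].
have mc := @measurable_cube R N.
have mv : measurable_vec (mulF A u).
  move=> i; split.
    rewrite (_ : (fun k => _) = (fun k => \sum_(b < q)
      (Re (A i b k) * Re (u k b ord0) - Im (A i b k) * Im (u k b ord0)))).
      apply: measurable_sum => b; have [mr mi] := mu_ b.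
      have [mA mA'] := CF_measurable (A i b).
      by apply: measurable_funB; exact: measurable_funM.
    apply/funext => k; rewrite /mulF mxE cRe_sum; apply: eq_bigr => b _.
    by rewrite cReM mxE.
  rewrite (_ : (fun k => _) = (fun k => \sum_(b < q)
    (Re (A i b k) * Im (u k b ord0) + Im (A i b k) * Re (u k b ord0)))).
    apply: measurable_sum => b; have [mr mi] := mu_ b.
    have [mA mA'] := CF_measurable (A i b).
    by apply: measurable_funD; exact: measurable_funM.
  apply/funext => k; rewrite /mulF mxE cIm_sum; apply: eq_bigr => b _.
  by rewrite cImM mxE.
have ms : measurable_fun (cube N) (fun k => (sqnorm (u k))%:E).
  by apply/measurable_EFinP; exact: measurable_sqnorm.
have le : (N2 (mulF A u) <= c%:E * N2 u)%E.
  rewrite /N2 -ge0_integralZl//; last first.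
    by move=> k _; rewrite lee_fin sqnorm_ge0.
  apply: ge0_le_integral => //.
  - by move=> k _; rewrite lee_fin sqnorm_ge0.
  - by apply/measurable_EFinP; exact: measurable_sqnorm.
  - by apply: measurable_funeM.
  - by move=> k _; rewrite -EFinM lee_fin; exact: hc.
split=> //; split=> //; apply: le_lt_trans le _.
by apply: lte_mul_pinfty => //; rewrite lee_fin.
Qed.

End AverageL2.

(** * The averaging module of L^2 classes *)

Section ModuleL2.
Context {R : realType} {N : nat}.
Local Notation cube := (@cube R).
Local Notation CF := (@CF R N).
Local Notation e := (@eavg R N).
Local Notation he := (@averaging_eavg R N).
Local Notation vfun p := (rtuple R N -> 'cV[R[i]]_p).

Definition L2c p (u : vfun p) : L2 R N p := L2_class (insubd 0 u).

Lemma L2_reprP p (u : L2 R N p) : sq_integrable (L2_repr u).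
Proof. by have := sqint_funP (L2_repr u); rewrite inE. Qed.

Lemma insubd_fun p (u : vfun p) : sq_integrable u ->
  sqint_fun (insubd (0 : sqintType N p) u) = u.
Proof. by move=> su; rewrite /insubd insubT// inE. Qed.

Lemma L2c_repr p (u : L2 R N p) : L2c (L2_repr u) = u.
Proof.
rewrite -[RHS]L2_reprK; congr L2_class; apply: val_inj => /=.
by rewrite insubd_fun//; exact: L2_reprP.
Qed.

Lemma L2c_eqP p (u v : vfun p) : sq_integrable u -> sq_integrable v ->
  L2c u = L2c v <-> aeq u v.
Proof.
move=> su sv; rewrite /L2c; split.
  move/L2_classP; rewrite inE /=; apply: filterS => k h kc.
  have := h kc; rewrite -[LHS]/(sqint_fun (insubd 0 u) k - sqint_fun (insubd 0 v) k).
  by rewrite !insubd_fun// => /eqP; rewrite subr_eq0 => /eqP.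
move=> uv; apply/L2_classP; rewrite inE /=; apply: filterS uv => k h kc.
rewrite -[LHS]/(sqint_fun (insubd 0 u) k - sqint_fun (insubd 0 v) k).
by rewrite !insubd_fun// h// subrr.
Qed.

Lemma repr_L2c p (u : vfun p) : sq_integrable u -> aeq (L2_repr (L2c u)) u.
Proof. by move=> su; apply/L2c_eqP; [exact: L2_reprP|by []|exact: L2c_repr]. Qed.

Lemma L2cD p (u v : vfun p) : sq_integrable u -> sq_integrable v ->
  L2c (u + v) = L2c u + L2c v.
Proof.
move=> su sv; rewrite /L2c -L2_classD; congr L2_class; apply: val_inj => /=.
rewrite insubd_fun; last exact: sq_integrableD.
by apply/funext => k; rewrite -[RHS]/(sqint_fun _ k + sqint_fun _ k) !insubd_fun.
Qed.

Lemma L2cZ p c (u : vfun p) : sq_integrable u -> L2c (c *: u) = c *: L2c u.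
Proof.
move=> su; rewrite -[RHS]L2_classZ; congr L2_class; apply: val_inj => /=.
rewrite insubd_fun; last exact: sq_integrableZ.
by apply/funext => k; rewrite -[RHS]/(c *: sqint_fun _ k) insubd_fun.
Qed.

Opaque L2c.

Definition Lmul p q (A : 'M[CF]_(p, q)) (u : L2 R N q) : L2 R N p :=
  L2c (mulF A (L2_repr u)).

Definition Lavg j p (u : L2 R N p) : L2 R N p :=
  L2c (avg (minn j N) (L2_repr u)).

Lemma mulF_sq p q (A : 'M[CF]_(p, q)) (u : vfun q) :
  sq_integrable u -> sq_integrable (mulF A u).
Proof. by move=> su; have [c _ /(_ u su)[]] := mulF_sq_integrable A. Qed.

Lemma avg_sq j p (u : vfun p) : sq_integrable u -> sq_integrable (avg (minn j N) u).
Proof. by move=> su; have [] := avg_sq_integrable (geq_minr j N) su. Qed.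

Lemma Lmul_c p q (A : 'M[CF]_(p, q)) (u : vfun q) : sq_integrable u ->
  Lmul A (L2c u) = L2c (mulF A u).
Proof.
move=> su; apply/L2c_eqP; [apply: mulF_sq; exact: L2_reprP|exact: mulF_sq|].
by apply: filterS (repr_L2c su) => k h kc; rewrite /mulF h.
Qed.

Lemma Lavg_c j p (u : vfun p) : sq_integrable u ->
  Lavg j (L2c u) = L2c (avg (minn j N) u).
Proof.
move=> su; apply/L2c_eqP; [apply: avg_sq; exact: L2_reprP|exact: avg_sq|].
apply: avg_aeq => //; [exact: geq_minr|exact: L2_reprP|exact: repr_L2c].
Qed.

Lemma L2_ind p (P : L2 R N p -> Prop) :
  (forall u : vfun p, sq_integrable u -> P (L2c u)) -> forall u, P u.
Proof. by move=> h u; rewrite -[u]L2c_repr; apply: h; exact: L2_reprP. Qed.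

Lemma LmulDl p q (A B : 'M[CF]_(p, q)) u : Lmul (A + B) u = Lmul A u + Lmul B u.
Proof.
elim/L2_ind: u => u su; rewrite !Lmul_c// -L2cD; try exact: mulF_sq.
congr L2c; apply/funext => k; rewrite -[RHS]/(mulF A u k + mulF B u k).
by rewrite /mulF /mxev map_mxD mulmxDl.
Qed.

Lemma LmulDr p q (A : 'M[CF]_(p, q)) u v : Lmul A (u + v) = Lmul A u + Lmul A v.
Proof.
elim/L2_ind: u => u su; elim/L2_ind: v => v sv.
rewrite -L2cD// !Lmul_c//; last exact: sq_integrableD.
rewrite -L2cD; try exact: mulF_sq.
congr L2c; apply/funext => k; rewrite -[RHS]/(mulF A u k + mulF A v k).
by rewrite /mulF -mulmxDr.
Qed.

Lemma LmulA p q r (A : 'M[CF]_(p, q)) (B : 'M[CF]_(q, r)) u :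
  Lmul A (Lmul B u) = Lmul (A *m B) u.
Proof.
elim/L2_ind: u => u su; rewrite !Lmul_c//; last exact: mulF_sq.
by congr L2c; apply/funext => k; rewrite /mulF /mxev map_mxM mulmxA.
Qed.

Lemma Lmul1 p u : Lmul (1%:M : 'M[CF]_p) u = u.
Proof.
elim/L2_ind: u => u su; rewrite Lmul_c//.
by congr L2c; apply/funext => k; rewrite /mulF /mxev map_mx1 mul1mx.
Qed.

Lemma LavgD j p (u v : L2 R N p) : Lavg j (u + v) = Lavg j u + Lavg j v.
Proof.
elim/L2_ind: u => u su; elim/L2_ind: v => v sv.
have sD := sq_integrableD su sv.
rewrite -L2cD// !Lavg_c// -L2cD; try exact: avg_sq.
apply/L2c_eqP; [exact: avg_sq|apply: sq_integrableD; exact: avg_sq|].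
by apply: avg_aeD => //; exact: geq_minr.
Qed.

Lemma LavgMl i j p q (A : 'M[CF]_(p, q)) u : (i <= j)%N ->
  Lavg i (Lmul (mxavg e j A) u) = Lmul (mxavg e j A) (Lavg i u).
Proof.
move=> ij; elim/L2_ind: u => u su.
rewrite Lmul_c// Lavg_c; last exact: mulF_sq.
rewrite Lavg_c// Lmul_c; last exact: avg_sq.
apply/L2c_eqP; [apply: avg_sq; exact: mulF_sq|apply: mulF_sq; exact: avg_sq|].
apply: filterS (sq_section (geq_minr i N) su) => k hk kc.
have ck b := let: And3 _ _ h := comp_integrable (hk kc) b in h.
rewrite avgE; apply/matrixP => a b; rewrite ord1 /mulF !mxE.
rewrite (eq_Cint (g := fun x => \sum_c e j (A a c) k * u (subst_point x k) c ord0)); last first.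
  move=> x _; rewrite mxE; apply: eq_bigr => c _.
  by rewrite !mxE /ev eavg_subst// leq_minnN.
rewrite Cint_sum; last by move=> c _; exact: CintegrableZ.
by apply: eq_bigr => c _; rewrite CintZ// avgE !mxE.
Qed.

Lemma LavgMr i j p q (A : 'M[CF]_(p, q)) u : (i <= j)%N ->
  Lavg i (Lmul A (Lavg j u)) = Lmul (mxavg e i A) (Lavg j u).
Proof.
move=> ij; elim/L2_ind: u => u su; have sj := avg_sq j su.
rewrite (Lavg_c j su) !Lmul_c// Lavg_c; last exact: mulF_sq.
(* The equality holds at every point: the average of [u] is constant along the fibre, and only the
   continuous [A] is integrated. *)
congr L2c; apply/funext => k.
rewrite avgE; apply/matrixP => a b; rewrite (ord1 b) /mulF [LHS]mxE [RHS]mxE.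
have inv (x : rtuple R (minn i N)) : avg (minn j N) u (subst_point x k) = avg (minn j N) u k.
  rewrite !avgE; apply/matrixP => a' b'; rewrite !mxE; apply: eq_Cint => y _.
  by rewrite subst_point_absorb// leq_minnN.
rewrite (eq_Cint (g := fun x => \sum_c avg (minn j N) u k c ord0 * A a c (subst_point x k))); last first.
  move=> x _; rewrite inv mxE; apply: eq_bigr => c _.
  by rewrite mxE mulrC.
rewrite Cint_sum; last first.
  by move=> c _; apply: CintegrableZ; exact: CF_Cintegrable.
apply: eq_bigr => c _; rewrite CintZ; last exact: CF_Cintegrable.
by rewrite mulrC; congr (_ * _); rewrite 2!mxE /ev eavgE.
Qed.

Lemma LavgT i j p (u : L2 R N p) : (i <= j)%N -> Lavg j (Lavg i u) = Lavg j u.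
Proof.
move=> ij; elim/L2_ind: u => u su; have si := avg_sq i su.
rewrite (Lavg_c i su) (Lavg_c j su) (Lavg_c j si); apply/L2c_eqP; [exact: avg_sq|exact: avg_sq|].
apply: filterS (sq_section (geq_minr j N) su) => k hk kc.
rewrite !avgE; apply/matrixP => a b; rewrite !mxE.
have [_ _ ck] := comp_integrable (hk kc) a.
rewrite -(Cint_subst (leq_minnN ij) ck); apply: eq_Cint => y _.
rewrite avgE mxE; apply: eq_Cint => x _.
by rewrite subst_point_subst// leq_minnN.
Qed.

Definition L2_module : avg_module e :=
  @AvgModule CF e (fun p => L2 R N p) Lmul Lavg
    LmulDl LmulDr LmulA Lmul1 LavgD LavgMl LavgMr LavgT.

Definition cls p (X : 'cV[CF]_p) : L2 R N p := L2c (fun k => mxev k X).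

Lemma sq_integrable_CF p (X : 'cV[CF]_p) : sq_integrable (fun k => mxev k X).
Proof.
have mv : measurable_vec (fun k => mxev k X).
  move=> i; have [h1 h2] := CF_measurable (X i ord0).
  by split; [apply: eq_measurable_fun h1|apply: eq_measurable_fun h2] => k _; rewrite mxE.
split => //.
rewrite (eq_integral (fun k => (Re (sq X k))%:E)); last first.
  by move=> k _; rewrite sqE.
have := ucb_integrable (CF_Re (sq X)); case/integrableP => _.
by apply: le_lt_trans; apply: ge0_le_integral => //;
  [exact: (@measurable_cube R N)|
   move=> k _; rewrite sqE lee_fin sqnorm_ge0|
   apply/measurable_EFinP; exact: (CF_measurable _).1|
   apply/measurable_EFinP; apply: measurableT_comp => //; exact: (CF_measurable _).1|
   move=> k _ /=; rewrite lee_fin ler_norm].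
Qed.

Lemma cls_mul p q (A : 'M[CF]_(p, q)) (X : 'cV[CF]_q) :
  Lmul A (cls X) = cls (A *m X).
Proof.
rewrite /cls Lmul_c; last exact: sq_integrable_CF.
by congr L2c; apply/funext => k; rewrite /mulF /mxev map_mxM.
Qed.

Lemma cls_avg j p (X : 'cV[CF]_p) : Lavg j (cls X) = cls (mxavg e j X).
Proof.
rewrite /cls Lavg_c; last exact: sq_integrable_CF.
congr L2c; apply/funext => k; rewrite avgE; apply/matrixP => a b.
rewrite (ord1 b) [LHS]mxE [RHS]mxE [mxavg _ _ _ _ _]mxE /ev eavgE.
by apply: eq_Cint => x _; rewrite mxE.
Qed.

Lemma clsD p (X Y : 'cV[CF]_p) : cls (X + Y) = cls X + cls Y.
Proof.
rewrite /cls -L2cD; try exact: sq_integrable_CF.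
by congr L2c; apply/funext => k; rewrite -[RHS]/(mxev k X + mxev k Y) /mxev map_mxD.
Qed.

Lemma cls_act M (r : symbol CF M) l (X : 'cV[CF]_M) :
  act (V := L2_module) r l (cls X) = cls (mact he r l X).
Proof.
elim: l => [|l IH]; first exact: cls_mul.
have -> : mact he r l.+1 X = mact he r l X + sA r l.+1 *m mxavg e l.+1 (sB r l.+1 *m X) by [].
rewrite clsD -IH -cls_mul -cls_avg -cls_mul.
by [].
Qed.

Lemma L2_norm_sqr p (u : vfun p) : sq_integrable u ->
  (L2_norm (L2c u) ^+ 2)%:E = N2 u.
Proof.
move=> su; have sr := L2_reprP (L2c u).
rewrite /L2_norm sqr_sqrtr; last by apply: Rintegral_ge0 => k _; exact: sqnorm_ge0.
have -> : N2 u = N2 (L2_repr (L2c u)).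
  apply: ae_eq_integral => //.
  - exact: (@measurable_cube R N).
  - by apply/measurable_EFinP; apply: measurable_sqnorm; case: su.
  - by apply/measurable_EFinP; apply: measurable_sqnorm; case: sr.
  - by apply: filterS (repr_L2c su) => k h kc; rewrite h.
rewrite /Rintegral fineK// ge0_fin_numE; first by case: sr.
by apply: integral_ge0 => k _; rewrite lee_fin sqnorm_ge0.
Qed.

Lemma L2_norm_ge0 p (u : L2 R N p) : 0 <= L2_norm u.
Proof. exact: sqrtr_ge0. Qed.

(** Any [k] will do, since the average of level N is constant. *)
Lemma L2_norm_cls p (X : 'cV[CF]_p) k :
  L2_norm (cls X) ^+ 2 = Re (e N (sq X) k).
Proof.
apply: EFin_inj; rewrite L2_norm_sqr; last exact: sq_integrable_CF.
rewrite eavgE minnn ReCint /Rintegral fineK.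
  by apply: eq_integral => x _; rewrite subst_point_full sqE.
apply: (integral_fune_fin_num (@measurable_cube R N)).
rewrite (_ : (fun x => _) = EFin \o (fun x => Re (sq X x))); last first.
  by apply/funext => x; rewrite subst_point_full.
by apply: ucb_integrable; exact: CF_Re.
Qed.

Lemma cls_norm0 p (D Z : 'cV[CF]_p) : cls D = cls Z -> sq Z = 0 -> D = 0.
Proof.
move=> h Z0; pose k0 : rtuple R N := [tuple 0 | i < N].
apply: (@sq_eq0 R N p D k0).
have h0 := etrans (esym (L2_norm_cls D k0))
  (etrans (congr1 (fun v => L2_norm v ^+ 2) h) (L2_norm_cls Z k0)).
by rewrite (CF_pos (eavg_ge0 N (sq_ge0 D) k0)) h0 Z0 (avg0 he).
Qed.

(** A continuous column of norm 0 vanishes everywhere; through this, equality of operators gives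
    equality of the matrices that they produce. *)
Lemma cls_inj p : injective (@cls p).
Proof.
move=> X Y XY; apply/eqP; rewrite -subr_eq0; apply/eqP.
apply: (@cls_norm0 p _ 0); first by rewrite clsD XY -clsD subrr.
apply: CF_eqP => k; rewrite sqE /mxev map_mx0 /sqnorm big1// => a _.
by rewrite mxE normc0 expr0n.
Qed.

Lemma Lmul_bounded p q (A : 'M[CF]_(p, q)) :
  exists2 c, 0 <= c & forall u, L2_norm (Lmul A u) ^+ 2 <= c * L2_norm u ^+ 2.
Proof.
have [c c0 hc] := mulF_sq_integrable A; exists c => // u.
elim/L2_ind: u => u su; rewrite Lmul_c// -lee_fin [(c * _)%:E]EFinM (L2_norm_sqr su) L2_norm_sqr; last exact: mulF_sq.
by have [] := hc u su.

Qed.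

Lemma Lavg_bounded j p (u : L2 R N p) : L2_norm (Lavg j u) ^+ 2 <= L2_norm u ^+ 2.
Proof.
elim/L2_ind: u => u su.
rewrite (Lavg_c j su).
rewrite -lee_fin.
rewrite [leRHS](L2_norm_sqr su).
rewrite [leLHS](L2_norm_sqr (avg_sq j su)).
by have [] := avg_sq_integrable (geq_minr j N) su.
Qed.

Lemma L2_normD_sqr p (u v : L2 R N p) :
  L2_norm (u + v) ^+ 2 <= 2 * (L2_norm u ^+ 2 + L2_norm v ^+ 2).
Proof.
elim/L2_ind: u => u su; elim/L2_ind: v => v sv.
have sD := sq_integrableD su sv; have mc := @measurable_cube R N.
have m2 (w : vfun p) : sq_integrable w -> measurable_fun (cube N) (fun k => (sqnorm (w k))%:E).
  by move=> [mw _]; apply/measurable_EFinP; exact: measurable_sqnorm.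
have p2 (w : vfun p) k : cube N k -> (0 <= (sqnorm (w k))%:E)%E.
  by rewrite lee_fin sqnorm_ge0.
rewrite -L2cD//; have := L2_norm_sqr su; have := L2_norm_sqr sv.
have := L2_norm_sqr sD; move: (L2_norm (L2c (u + v))) (L2_norm (L2c u)) (L2_norm (L2c v)) => c a b eD ev eu.
have -> : (c ^+ 2 <= 2 * (a ^+ 2 + b ^+ 2)) =
    ((c ^+ 2)%:E <= 2%:E * ((a ^+ 2)%:E + (b ^+ 2)%:E))%E.
  by rewrite -EFinD -EFinM lee_fin.
rewrite eD eu ev /N2.
rewrite -(ge0_integralD _ mc (p2 u) (m2 u su) (p2 v) (m2 v sv)).
rewrite -ge0_integralZl//; first last.
- by move=> k kc; rewrite adde_ge0// p2.
- by apply: emeasurable_funD; exact: m2.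
apply: ge0_le_integral => //; first exact: p2.
- exact: m2.
- by apply: measurable_funeM; apply: emeasurable_funD; exact: m2.
- by move=> k _; rewrite -EFinD -EFinM lee_fin; exact: sqnormD.
Qed.

End ModuleL2.

(** * Normal forms of operators *)

Section Operators.
Context {R : realType} {N M : nat}.
Local Notation cube := (@cube R).
Local Notation CF := (@CF R N).
Local Notation e := (@eavg R N).
Local Notation he := (@averaging_eavg R N).
Local Notation V := (@L2_module R N).
Local Notation op := (L2 R N M -> L2 R N M).
Local Notation sym := (symbol CF M).
Local Notation actN := (act (V := V)).

Lemma Lmul0 p q (u : L2 R N q) : Lmul (0 : 'M[CF]_(p, q)) u = 0.
Proof. exact: (amul0l (V := V)). Qed.

Lemma mkmx_mxev p q (A : 'M[CF]_(p, q)) : mkmx (fun k => mxev k A) = A.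
Proof.
apply/matrixP => i j; rewrite mxE; apply: CF_eq_cube => k kc.
rewrite mkCF_continuous// ?mxE//.
rewrite (_ : (fun k => _) = (A i j : rtuple R N -> R[i])).
  exact: CF_cube_continuous.
by apply/funext => k'; rewrite mxE.
Qed.

Lemma L2c_cube p (u v : rtuple R N -> 'cV[R[i]]_p) : sq_integrable u ->
  (forall k, cube N k -> u k = v k) -> L2c v = L2c u.
Proof.
move=> su uv; apply/L2c_eqP => //; first exact: eq_sq_integrable uv su.
by apply: aeq_cube => k kc; rewrite uv.
Qed.

Lemma mul_opE (A : rtuple R N -> 'M[R[i]]_M) : continuous_mx A ->
  mul_op A = Lmul (mkmx A).
Proof.
move=> cA; apply/funext => u; apply: L2c_cube; first by apply: mulF_sq; exact: L2_reprP.
by move=> k kc; rewrite /mulF mxev_mkmx.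
Qed.

Lemma avg_opE j : (j <= N)%N -> avg_op j = (fun u => Lavg j u) :> op.
Proof. by move=> jN; apply/funext => u; rewrite /Lavg (minn_idPl jN). Qed.

Lemma eq_avg_cube j p q (F G : rtuple R N -> 'M[R[i]]_(p, q)) k :
  (forall k, cube N k -> F k = G k) -> cube N k -> avg j F k = avg j G k.
Proof.
move=> FG kc; apply/matrixP => a b; rewrite !mxE.
have h (x : rtuple R j) : cube j x -> F (subst_point x k) = G (subst_point x k).
  by move=> xc; apply: FG; exact: cube_subst_point.
by congr (_ +i* _); apply: eq_Rintegral => x; rewrite inE => xc; rewrite h.
Qed.

Lemma int_opE j m (A : rtuple R N -> 'M[R[i]]_(M, m)) (B : rtuple R N -> 'M[R[i]]_(m, M)) u :
  (j <= N)%N -> continuous_mx A -> continuous_mx B ->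
  int_op j A B u = Lmul (mkmx A) (Lavg j (Lmul (mkmx B) u)).
Proof.
move=> jN cA cB; rewrite -{2}[u]L2c_repr Lmul_c; last exact: L2_reprP.
have s1 := mulF_sq (mkmx B) (L2_reprP u).
have s2 := avg_sq j s1.
rewrite (Lavg_c j s1) (Lmul_c _ s2); apply: L2c_cube; first exact: mulF_sq.
move=> k kc; rewrite /mulF mxev_mkmx// (minn_idPl jN); congr (_ *m _).
by apply: eq_avg_cube => // k' kc'; rewrite mxev_mkmx.
Qed.

Definition nf_sym (r : normal_form R N M) : sym :=
  @Symbol CF M (nf_dim r) (mkmx (nf_A0 r)) (fun j => mkmx (nf_A r j))
    (fun j => mkmx (nf_B r j)).

Definition sym_nf (s : sym) : normal_form R N M :=
  @NormalForm R N M (sdim s) (fun k => mxev k (sA0 s))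
    (fun j k => mxev k (sA s j)) (fun j k => mxev k (sB s j)).

Lemma act_sum (s : sym) l u : actN s l u =
  Lmul (sA0 s) u + \sum_(1 <= j < l.+1) Lmul (sA s j) (Lavg j (Lmul (sB s j) u)).
Proof.
elim: l => [|l IH]; first by rewrite big_nil addr0.
by rewrite big_nat_recr//= addrA -IH.
Qed.

Lemma represents_act r T : represents r T -> T = actN (nf_sym r) N.
Proof.
move=> [cA0 cAB ->]; apply/funext => u; rewrite act_sum /nf_op mul_opE//.
congr (_ + _); apply: eq_big_nat => j /andP[j1 jN].
have [|_ cA cB] := cAB j; first by rewrite j1.
exact: int_opE.
Qed.

Definition pos_dims (s : sym) := forall j, (1 <= j <= N)%N -> (0 < sdim s j)%N.

Lemma act_represents (s : sym) : pos_dims s -> represents (sym_nf s) (actN s N).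
Proof.
move=> ps; split; first exact: mxev_continuous.
  by move=> j jN; split; [exact: ps|exact: mxev_continuous|exact: mxev_continuous].
apply/funext => u; rewrite act_sum /nf_op mul_opE; last exact: mxev_continuous.
rewrite mkmx_mxev; congr (_ + _); apply: eq_big_nat => j /andP[j1 jN].
have := @int_opE j _ (fun k => mxev k (sA s j)) (fun k => mxev k (sB s j)) u jN
  (@mxev_continuous R N _ _ _) (@mxev_continuous R N _ _ _).
by rewrite !mkmx_mxev => <-.
Qed.

(** Writing scalars as multiplications by constants derives the linearity of operators from the
    module laws. *)
Lemma Lscale p c (u : L2 R N p) : Lmul ((CF_cst c)%:M) u = c *: u.
Proof.
move: u; apply: L2_ind => u su; rewrite Lmul_c// -L2cZ//; congr L2c; apply/funext => k.
rewrite /mulF -[RHS]/(c *: u k) /mxev map_scalar_mx mul_scalar_mx.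
by congr (_ *: _); exact: CF_cstE.
Qed.

Lemma actZ (s : sym) l c u : actN s l (c *: u) = c *: actN s l u.
Proof.
have sc p q (A : 'M[CF]_(p, q)) (v : L2 R N q) : Lmul A (c *: v) = c *: Lmul A v.
  by rewrite -!Lscale !LmulA scalar_mxC.
have av j p (v : L2 R N p) : Lavg j (c *: v) = c *: Lavg j v.
  rewrite -!Lscale; have fx : mxavg e j ((CF_cst c)%:M : 'M[CF]_p) = (CF_cst c)%:M.
    apply/matrixP => a b; rewrite !mxE; case: (_ == _); rewrite ?mulr1n ?mulr0n.
      exact: eavg_cst.
    exact: (avg0 he).
  by rewrite -fx LavgMl.
elim: l => [|l IH]; first exact: sc.
have E v : actN s l.+1 v = actN s l v + Lmul (sA s l.+1) (Lavg l.+1 (Lmul (sB s l.+1) v)) by [].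
by rewrite !E IH !(sc, av) scalerDr.
Qed.

Lemma act_bounded_sqr (s : sym) l : exists2 c, 0 <= c &
  forall u, L2_norm (actN s l u) ^+ 2 <= c * L2_norm u ^+ 2.
Proof.
elim: l => [|l [c c0 IH]]; first exact: Lmul_bounded.
have [a a0 ha] := Lmul_bounded (sA s l.+1); have [b b0 hb] := Lmul_bounded (sB s l.+1).
exists (2 * (c + a * b)); first by rewrite mulr_ge0// addr_ge0// mulr_ge0.
move=> u; apply: le_trans (L2_normD_sqr _ _) _; rewrite -mulrA ler_pM2l// mulrDl lerD//.
apply: le_trans (ha _) _; rewrite -mulrA ler_wpM2l//.
exact: le_trans (Lavg_bounded _ _) (hb u).
Qed.

Lemma bounded_opP (T : op) c : linear T -> 0 <= c ->
  (forall u, L2_norm (T u) ^+ 2 <= c * L2_norm u ^+ 2) -> bounded_op T.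
Proof.
move=> lT c0 hc; split=> //; exists (Num.sqrt c) => u.
rewrite -(@ler_sqr _ (L2_norm (T u))) ?nnegrE ?L2_norm_ge0 ?mulr_ge0 ?sqrtr_ge0 ?L2_norm_ge0//.
rewrite exprMn [Num.sqrt c ^+ 2]sqr_sqrtr//; exact: hc.
Qed.

Lemma bounded_op_sqr (T : op) : bounded_op T -> exists2 c, 0 <= c &
  forall u, L2_norm (T u) ^+ 2 <= c * L2_norm u ^+ 2.
Proof.
move=> [_ [c hc]]; exists (c ^+ 2); first exact: sqr_ge0.
move=> u; rewrite -exprMn; have := hc u; have := L2_norm_ge0 (T u); nra.
Qed.

Lemma act_bounded (s : sym) : bounded_op (actN s N : op).
Proof.
have [c c0 hc] := act_bounded_sqr s N; apply: (bounded_opP _ c0 hc).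
by move=> a u v; rewrite actD actZ.
Qed.

Lemma bounded_op_comp (T U : op) : bounded_op T -> bounded_op U -> bounded_op (T \o U).
Proof.
move=> bT bU; have [c c0 hc] := bounded_op_sqr bT; have [d d0 hd] := bounded_op_sqr bU.
apply: (@bounded_opP _ (c * d)); [|exact: mulr_ge0|].
  by move=> a u v; rewrite /= bU.1 bT.1.
move=> u /=; apply: le_trans (hc _) _; rewrite -mulrA ler_wpM2l//; exact: hd.
Qed.

Lemma bounded_op_id : bounded_op (id : op).
Proof. by apply: (@bounded_opP _ 1) => // u; rewrite mul1r. Qed.

(* A_0 + A <B .>_j for j >= 1, and A_0 alone for j = 0. *)
Definition sym1 (A0 : 'M[CF]_M) m j (A : 'M[CF]_(M, m)) (B : 'M[CF]_(m, M)) : sym :=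
  @Symbol CF M (fun=> m) A0 (fun l => if l == j then A else 0) (fun=> B).

Lemma act_sym1 A0 m j (A : 'M[CF]_(M, m)) B u : (1 <= j <= N)%N ->
  actN (sym1 A0 j A B) N u = Lmul A0 u + Lmul A (Lavg j (Lmul B u)).
Proof.
move=> jN; rewrite act_sum; congr (_ + _).
rewrite (bigD1_seq j) ?iota_uniq ?mem_index_iota//= eqxx big1_seq ?addr0//.
by move=> i /andP[/negbTE ->] _; exact: Lmul0.
Qed.

Lemma act_sym0 A0 m B u : actN (sym1 A0 0 (0 : 'M[CF]_(M, m)) B) N u = Lmul A0 u.
Proof.
rewrite act_sum big1 ?addr0// => i _.
by rewrite /= if_same; exact: Lmul0.
Qed.

Definition sym_add (s t : sym) : sym :=
  @Symbol CF M (fun j => sdim s j + sdim t j)%N (sA0 s + sA0 t)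
    (fun j => row_mx (sA s j) (sA t j)) (fun j => col_mx (sB s j) (sB t j)).

Lemma act_add s t l u : actN (sym_add s t) l u = actN s l u + actN t l u.
Proof.
elim: l => [|l IH]; first exact: LmulDl.
have E (w : sym) : actN w l.+1 u = actN w l u + Lmul (sA w l.+1) (Lavg l.+1 (Lmul (sB w l.+1) u)) by [].
have AB := amul_block he (V := V) l.+1 (sA s l.+1) (sA t l.+1) (sB s l.+1) (sB t l.+1) u.
by rewrite !E IH addrACA; congr (_ + _); exact: AB.
Qed.

Definition normal_ops : set op := [set T | exists2 s : sym, pos_dims s & T = actN s N].

Lemma normal_opsP T : normal_ops T <-> exists r, represents r T.
Proof.
split=> [[s ps ->]|[r rT]]; first by exists (sym_nf s); exact: act_represents.
exists (nf_sym r); last exact: represents_act.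
by move=> j jN; case: rT => _ /(_ j jN)[].
Qed.

Lemma normal_ops_comp T U : normal_ops T -> normal_ops U -> normal_ops (T \o U).
Proof.
move=> [s ps ->] [t pt ->]; exists (sym_prod he s t).
  by move=> j jN /=; rewrite addn_gt0 pt.
by apply/funext => u; rewrite act_prod.
Qed.

Lemma normal_ops_mul A0 : normal_ops (Lmul A0).
Proof.
exists (sym1 A0 0 (0 : 'M[CF]_(M, 1)) 0) => //.
by apply/funext => u; rewrite act_sym0.
Qed.

Lemma normal_subalgebra : op_subalgebra normal_ops.
Proof.
split.
- by move=> _ [s _ ->]; exact: act_bounded.
- move=> _ _ [s ps ->] [t pt ->]; exists (sym_add s t).
    by move=> j jN /=; rewrite addn_gt0 ps.
  by apply/funext => u; rewrite act_add.
- move=> c T nT; have := normal_ops_comp (normal_ops_mul (CF_cst c)%:M) nT.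
  by congr normal_ops; apply/funext => u /=; rewrite Lscale.
- exact: normal_ops_comp.
Qed.

Hypothesis hM : (1 <= M)%N.

Lemma normal_generators : @mul_ops R N M `|` @avg_ops R N M `<=` normal_ops.
Proof.
move=> T [[A cA ->]|[j jN ->]]; first by rewrite mul_opE//; exact: normal_ops_mul.
have jN' : (j <= N)%N by case/andP: jN.
exists (sym1 0 j 1%:M 1%:M) => //; rewrite avg_opE//.
apply/funext => u; rewrite act_sym1//.
by rewrite Lmul0 add0r !Lmul1.
Qed.

Section Generated.
Variable S : set op.
Hypothesis subS : op_subalgebra S.
Hypothesis genS : @mul_ops R N M `|` @avg_ops R N M `<=` S.

Lemma gen_mul A : S (Lmul A).
Proof.
rewrite -(mkmx_mxev A) -mul_opE; last exact: mxev_continuous.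
by apply: genS; left; exists (fun k => mxev k A) => //; exact: mxev_continuous.
Qed.

Lemma gen_sum I (r : seq I) (F : I -> op) : (forall i, S (F i)) ->
  S (fun u => \sum_(i <- r) F i u).
Proof.
have [_ SD _ _] := subS; move=> SF; elim: r => [|i r IH].
  rewrite (_ : (fun u => _) = Lmul 0); first exact: gen_mul.
  by apply/funext => u; rewrite big_nil Lmul0.
rewrite (_ : (fun u => _) = fun u => F i u + \sum_(i <- r) F i u); first exact: SD.
by apply/funext => u; rewrite big_cons.
Qed.

(** The generators are M x M, whereas [A] is M x m with arbitrary m. Each index [c] is routed
    through a coordinate [i0] of C^M, which exists as M >= 1: A <B u> is the sum over [c] of A
    e_{c,i0} <e_{i0,c} B u>. *)
Lemma gen_int j m (A : 'M[CF]_(M, m)) (B : 'M[CF]_(m, M)) : (1 <= j <= N)%N ->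
  S (fun u => Lmul A (Lavg j (Lmul B u))).
Proof.
move=> jN; have jN' : (j <= N)%N by case/andP: jN.
have [_ _ _ SM] := subS; pose i0 := Ordinal hM.
pose F (c : 'I_m) : op := Lmul (A *m delta_mx c i0) \o ((fun v => Lavg j v) \o Lmul (delta_mx i0 c *m B)).
rewrite (_ : (fun u => _) = fun u => \sum_c F c u).
  apply: gen_sum => c; apply: (SM); first exact: gen_mul.
  apply: (SM); last exact: gen_mul.
  by rewrite -avg_opE//; apply: genS; right; exists j.
apply/funext => u; rewrite /F /=.
have E c : Lmul (A *m delta_mx c i0) (Lavg j (Lmul (delta_mx i0 c *m B) u)) =
    Lmul (A *m delta_mx c c) (Lavg j (Lmul B u)).
  rewrite -(LmulA (delta_mx i0 c) B u).
  have := LavgMl (delta_mx i0 c) (Lmul B u) (leqnn j); rewrite mxavg_delta => ->.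
  by rewrite LmulA -mulmxA mul_delta_mx.
under eq_bigr do rewrite E.
rewrite -{1}[A]mulmx1 mx1_sum_delta mulmx_sumr.
elim: (index_enum _) => [|c r IH]; first by rewrite !big_nil Lmul0.
by rewrite !big_cons LmulDl IH.
Qed.

Lemma gen_act s l : (l <= N)%N -> S (actN s l).
Proof.
have [_ SD _ _] := subS; elim: l => [|l IH] lN; first exact: gen_mul.
by apply: (SD); [exact: IH (ltnW lN)|exact: gen_int].
Qed.

End Generated.

Lemma alg_HP T : alg_H T <-> normal_ops T.
Proof.
split=> [|[s _ ->]].
  apply; split; [exact: normal_subalgebra|exact: normal_generators].
by move=> S [subS genS]; exact: gen_act.
Qed.

Lemma alg_H_act s : alg_H (actN s N : op).
Proof. by move=> S [subS genS]; exact: gen_act. Qed.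

(** The explicit inverse is a composition of factors I - P E^-1 <B .> and one multiplication, all of
    them in H. *)
Lemma alg_H_ainv s l : (l <= N)%N -> alg_H (ainv (V := V) (e := e) s l : op).
Proof.
move=> lN S [subS genS]; have [_ SD SZ SM] := subS.
elim: l lN => [|l IH] lN; first exact: gen_mul.
rewrite (_ : ainv s l.+1 = (fun u => u + (-1) *: Lmul (symP e s l.+1 *m invmx (symE e s l.+1))
  (Lavg l.+1 (Lmul (sB s l.+1) u))) \o ainv (V := V) s l); last first.
  by apply/funext => u; rewrite /= scaleN1r.
apply: (SM); last exact: IH (ltnW lN).
apply: (SD); last by apply: (SZ); exact: gen_int.
rewrite (_ : (fun u => u) = Lmul 1%:M); first exact: gen_mul.
by apply/funext => u; rewrite Lmul1.
Qed.

End Operators.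

(** * Invertibility and the functions pi *)

Section Units.
Context {R : realType} {N M : nat}.
Local Notation cube := (@cube R).
Local Notation CF := (@CF R N).
Local Notation e := (@eavg R N).
Local Notation he := (@averaging_eavg R N).
Local Notation V := (@L2_module R N).
Local Notation op := (L2 R N M -> L2 R N M).
Local Notation sym := (symbol CF M).
Local Notation actN := (act (V := V)).

Definition cst_mx p q (v : 'M[R[i]]_(p, q)) : 'M[CF]_(p, q) := map_mx CF_cst v.

Lemma mxev_cst p q (v : 'M[R[i]]_(p, q)) k : mxev k (cst_mx v) = v.
Proof. by apply/matrixP => a b; rewrite !mxE; exact: CF_cstE. Qed.

Lemma mxavg_cst j p q (v : 'M[R[i]]_(p, q)) : mxavg e j (cst_mx v) = cst_mx v.
Proof. by apply/matrixP => a b; rewrite !mxE eavg_cst. Qed.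

Lemma eavg0 (f : CF) : e 0 f = f.
Proof.
apply: CF_eqP => k; rewrite eavgE -[RHS](Cint_cst (minn 0 N)).
by apply: eq_Cint => x _; congr (f _); apply: eq_from_tnth => i; rewrite subst_point_ge ?min0n.
Qed.

Lemma mxevM p q r (A : 'M[CF]_(p, q)) (B : 'M[CF]_(q, r)) k :
  mxev k (A *m B) = mxev k A *m mxev k B.
Proof. exact: map_mxM. Qed.

Lemma mxevD p q (A B : 'M[CF]_(p, q)) k : mxev k (A + B) = mxev k A + mxev k B.
Proof. exact: map_mxD. Qed.

Lemma sqnorm0 n : sqnorm (0 : 'cV[R[i]]_n) = 0.
Proof. by rewrite /sqnorm big1// => a _; rewrite mxE normc0 expr0n. Qed.

Lemma sqnorm_eq0 n (v : 'cV[R[i]]_n) : sqnorm v = 0 -> v = 0.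
Proof.
move=> h; apply/matrixP => a b; rewrite ord1 mxE; apply: eq0_normc; apply/eqP.
rewrite -sqrf_eq0 eq_le exprn_ge0 ?normc_ge0// andbT -h.
exact: normc_le_sqnorm.
Qed.

Lemma det0_col n (A : 'M[R[i]]_n) : \det A = 0 ->
  exists2 v : 'cV[R[i]]_n, v != 0 & A *m v = 0.
Proof.
move=> dA; have /eqP/det0P[v v0 vA] : \det A^T = 0 by rewrite det_tr.
exists v^T; first by rewrite trmx_eq0.
by rewrite -[A]trmxK -trmx_mul vA trmx0.
Qed.

Lemma mxev_invariant j p q (A : 'M[CF]_(p, q)) k (x : rtuple R (minn j N)) :
  mxev (subst_point x k) (mxavg e j A) = mxev k (mxavg e j A).
Proof. by apply/matrixP => a b; rewrite !mxE /ev eavg_subst. Qed.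

(* By Cauchy-Schwarz on the fibre. *)
Lemma fibre_zero j p (Q : 'M[CF]_(p, M)) (X : 'cV[CF]_M) k :
  e j (sq X) k = 0 -> mxev k (mxavg e j (Q *m X)) = 0.
Proof.
move=> h; apply/matrixP => a b; rewrite (ord1 b) !mxE /ev (avg_sum he).
rewrite CF_sum big1// => c _; apply/eqP; rewrite -normr_eq0 -sqrf_eq0.
have Xc : e j (X c ord0 * CF_conj (X c ord0)) k = 0.
  apply/eqP; rewrite eq_le (avg_sq_ge0 j (X c ord0) k) andbT -h.
  apply: eavg_le => k'; rewrite sqE mul_conj_norm lecR.
  by have := normc_le_sqnorm (mxev k' X) c; rewrite mxE.
have := eavg_CS j (Q a c) (X c ord0) k; rewrite Xc mulr0 => h1.
by rewrite eq_le h1 exprn_ge0.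
Qed.

Section BoundedBelow.
Variables (s : sym) (C : R).
Hypothesis C0 : 0 <= C.
Hypothesis below : forall u, L2_norm u ^+ 2 <= C * L2_norm (actN s N u) ^+ 2.

Lemma below_mact (X : 'cV[CF]_M) k :
  Re (e N (sq X) k) <= C * Re (e N (sq (mact he s N X)) k).
Proof.
have h := below (cls X); have c := cls_act s N X.
have h2 : L2_norm (cls X) ^+ 2 <= C * L2_norm (cls (mact he s N X)) ^+ 2 by rewrite -c.
have e1 := L2_norm_cls X k; have e2 := L2_norm_cls (mact he s N X) k.
by rewrite -e1 -e2.
Qed.

(** A kernel vector v of A_0(k), taken as a constant column, is annihilated by T_0 at the point k,
    which is the whole fibre of level 0. *)
Lemma sym_pi0_neq0 k : cube N k -> sym_pi e s 0 k != 0.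
Proof.
move=> kc; apply/eqP => /= d0.
have [|v v0 Av] := @det0_col _ (mxev k (sA0 s)).
  by rewrite /mxev det_map_mx.
have : e 0 (sq (mact he s 0 (cst_mx v))) k = 0.
  rewrite eavg0 sqE -[mact he s 0 _]/(sA0 s *m cst_mx v) mxevM mxev_cst Av.
  by rewrite sqnorm0.
move/(fibre_injective C0 below_mact (leq0n N) kc).
rewrite eavg0 sqE mxev_cst => /(congr1 Re) /= /sqnorm_eq0 vz.
by rewrite vz eqxx in v0.
Qed.

Lemma sym_piS_neq0 l k : (l < N)%N -> sym_unit e s l -> cube N k ->
  sym_pi e s l.+1 k != 0.
Proof.
move=> lN us kc; apply/eqP => /= d0.
pose P := symP e s l.+1; pose Q := sB s l.+1; pose E := symE e s l.+1.
have [|v v0 Ev] := @det0_col _ (mxev k E).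
  by rewrite /mxev det_map_mx.
have EQ : E = 1%:M + mxavg e l.+1 (Q *m P) by [].
(* T_(l+1) (P v) = T_l P (v + <Q P> v) = A_(l+1) E v, and E v vanishes on the whole fibre of [k]
   because E is constant along it. *)
pose X := P *m cst_mx v; pose Z := E *m cst_mx v.
have Zfix : mxavg e l.+1 Z = Z.
  by have := mxavgMl he E (cst_mx v) (leqnn l.+1);
     rewrite mxavg_cst (mxavg_symE he).
have avgQX : mxavg e l.+1 (Q *m X) = mxavg e l.+1 (Q *m P) *m cst_mx v.
  by rewrite /X mulmxA -[in LHS](mxavg_cst l.+1 v) (mxavgMr he)// mxavg_cst.
have TX : mact he s l.+1 X = sA s l.+1 *m Z.
  rewrite (mactS he _ us) -/P -/Q avgQX /X -mulmxDr.
  have -> : cst_mx v + mxavg e l.+1 (Q *m P) *m cst_mx v = Z.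
    by rewrite /Z EQ mulmxDl mul1mx.
  have Zl : mxavg e l Z = Z by rewrite -Zfix (mxavgK he).
  rewrite (mact_mul_fix _ _ Zl); congr (_ *m _).
  exact: (minvK he us).
have T0 : e l.+1 (sq (mact he s l.+1 X)) k = 0.
  rewrite TX eavgE -[RHS](Cint_cst (minn l.+1 N) 0).
  apply: eq_Cint => x _; rewrite sqE mxevM -Zfix mxev_invariant Zfix /Z mxevM.
  by rewrite mxev_cst Ev mulmx0 sqnorm0.
have X0 := fibre_injective C0 below_mact lN kc T0.
(* As X = P v vanishes on the fibre, <Q P> v = 0 at [k], so that v = E v = 0. *)
have := fibre_zero Q X0; rewrite avgQX mxevM mxev_cst => QPv.
have : mxev k E *m v = v.
  by rewrite EQ mxevD mulmxDl QPv addr0 /mxev map_mx1 mul1mx.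
by rewrite Ev => vz; rewrite -vz eqxx in v0.
Qed.

Lemma below_sym_unit l : (l <= N)%N -> sym_unit e s l.
Proof.
elim: l => [|l IH] lN i.
  by rewrite leqn0 => /eqP ->; apply/CF_unitP => k; exact: sym_pi0_neq0.
rewrite leq_eqVlt => /orP[/eqP->|]; last exact: IH (ltnW lN) i.
by apply/CF_unitP => k; apply: sym_piS_neq0 => //; exact: IH (ltnW lN).
Qed.

End BoundedBelow.

Lemma inv_sym_unit (s : sym) (U : op) : bounded_op U -> U \o actN s N = id ->
  sym_unit e s N.
Proof.
move=> bU UT; have [C C0 hC] := bounded_op_sqr bU.
apply: (@below_sym_unit s C) => // u.
by have := hC (actN s N u); rewrite -[X in L2_norm X ^+ 2 <= _]/((U \o actN s N) u) UT.
Qed.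

Lemma sym_unit_le s l m : (l <= m)%N -> sym_unit e s m -> sym_unit e (s : sym) l.
Proof. by move=> lm h i il; apply: h; exact: leq_trans lm. Qed.

(** [w] and [sym_prod he r t] are symbols of the same operator, so they have the same truncations,
    and those of the latter are products by construction. *)
Lemma act_mact_levels (w r t : sym) :
  (forall u, actN w N u = actN r N (actN t N u)) ->
  forall l p (X : 'M[CF]_(M, p)), (l <= N)%N ->
    mact he w l X = mact he r l (mact he t l X).
Proof.
move=> wrt l p X lN.
have prod i q (Y : 'M[CF]_(M, q)) : mact he (sym_prod he r t) i Y = mact he r i (mact he t i Y).
  exact: (act_prod he (V := mx_module he q)).
rewrite -prod; apply: mact_levels => // Y; apply: cls_inj.
have e1 := cls_act w N Y; have e2 := cls_act (sym_prod he r t) N Y.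
by rewrite -e1 -e2 wrt act_prod.
Qed.

Lemma sym_pi_comp (w r t : sym) : (forall u, actN w N u = actN r N (actN t N u)) ->
  sym_unit e w N -> sym_unit e r N -> sym_unit e t N ->
  forall j, (j <= N)%N -> sym_pi e w j = sym_pi e r j * sym_pi e t j.
Proof.
move=> wrt uw ur ut j jN; apply: (@sym_pi_prod _ _ he _ (@CF_det_nil2 R N)) => //.
- by move=> i q X ij; apply: act_mact_levels => //; exact: leq_trans jN.
- exact: sym_unit_le ur.
- exact: sym_unit_le ut.
- exact: sym_unit_le uw.
Qed.

Lemma minv0 (s : sym) l p : minv e s l (0 : 'M[CF]_(M, p)) = 0.
Proof.
elim: l => [|l IH]; first by rewrite /= mulmx0.
by rewrite /= IH mulmx0 (mxavg0 he) mulmx0 subr0.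
Qed.

Lemma sym_pi_trivial (s : sym) j : sA s j.+1 = 0 -> sym_pi e s j.+1 = 1.
Proof.
by move=> h; rewrite /= /symE /symP h minv0 mulmx0 (mxavg0 he) addr0 det1.
Qed.

Definition sym_id : sym := sym1 1%:M 0 (0 : 'M[CF]_(M, 1)) 0.

Lemma sym_pi_id j : sym_pi e sym_id j = 1.
Proof.
by case: j => [|j]; [rewrite /= det1|exact: sym_pi_trivial].
Qed.

Lemma act_id u : actN sym_id N u = u.
Proof. by rewrite act_sym0 Lmul1. Qed.

(** Multiplicativity applied to T = T I, with different symbols for the two occurrences of T. *)
Lemma sym_pi_unique (s t : sym) : actN s N = actN t N -> sym_unit e s N -> sym_unit e t N ->
  forall j, (j <= N)%N -> sym_pi e s j = sym_pi e t j.
Proof.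
move=> st us ut j jN; rewrite (@sym_pi_comp s t sym_id)// ?sym_pi_id ?mulr1//.
  by move=> u; rewrite act_id st.
by move=> i _; rewrite sym_pi_id unitr1.
Qed.

Lemma mxev_avg j p q (A : 'M[CF]_(p, q)) k : (j <= N)%N ->
  mxev k (mxavg e j A) = avg j (fun k' => mxev k' A) k.
Proof.
move=> jN; apply/matrixP => a b; rewrite !mxE /ev eavgE (minn_idPl jN) /Cint.
by congr (_ +i* _); apply: eq_Rintegral => x _; rewrite mxE.
Qed.

Section RawRecursion.
Variables (r : normal_form R N M) (T : op).
Hypothesis rT : represents r T.
Hypothesis us : sym_unit e (nf_sym r) N.

Let contA0 : continuous_mx (nf_A0 r). Proof. by case: rT. Qed.
Let contA j : (1 <= j <= N)%N -> continuous_mx (@nf_A _ _ _ r j).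
Proof. by move=> jN; case: rT => _ /(_ j jN)[]. Qed.
Let contB j : (1 <= j <= N)%N -> continuous_mx (@nf_B _ _ _ r j).
Proof. by move=> jN; case: rT => _ /(_ j jN)[]. Qed.

(** Agreement holds on the cube: outside it the coefficients of [r] are arbitrary, while those of
    [nf_sym r] are clamped. *)
Lemma nf_AijE l i k : (l <= N)%N -> (1 <= i <= N)%N -> cube N k ->
  nf_Aij r l i k = mxev k (minv e (nf_sym r) l (sA (nf_sym r) i)).
Proof.
elim: l i k => [|l IH] i k lN iN kc.
  have u0 : sA0 (nf_sym r) \in unitmx by apply: (sym_unit0 us).
  rewrite [RHS]mxevM mxev_inv// [mxev k (sA0 _)]mxev_mkmx//.
  by rewrite [mxev k (sA _ _)]mxev_mkmx//; exact: contA.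
have lN' := ltnW lN; have l1 : (1 <= l.+1 <= N)%N by [].
have Bk m k' (F : rtuple R N -> 'M[R[i]]_(M, m)) (X : 'M[CF]_(M, m)) : cube N k' ->
    (forall k, cube N k -> F k = mxev k X) ->
    avg l.+1 (fun k => nf_B r l.+1 k *m F k) k' =
    mxev k' (mxavg e l.+1 (sB (nf_sym r) l.+1 *m X)).
  move=> kc' FX; rewrite mxev_avg//; apply: eq_avg_cube => // k2 kc2.
  by rewrite mxevM FX// [mxev k2 (sB _ _)]mxev_mkmx//; exact: contB.
have EE : E_of (nf_Aij r l l.+1) k = mxev k (symE e (nf_sym r) l.+1).
  rewrite /E_of (Bk _ _ _ (minv e (nf_sym r) l (sA (nf_sym r) l.+1)))//.
    by rewrite /symE mxevD /mxev map_mx1.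
  by move=> k' kc'; apply: IH.
have uE : symE e (nf_sym r) l.+1 \in unitmx by apply: (sym_unitE us).
rewrite [LHS]/= EE (Bk _ _ _ (minv e (nf_sym r) l (sA (nf_sym r) i)))//; last first.
  by move=> k' kc'; apply: IH.
rewrite !IH// -mxev_inv// -!mxevM.
by rewrite -[LHS](map_mxB (ev k)).
Qed.

Lemma nf_piE j k : (j <= N)%N -> cube N k -> nf_pi r j k = sym_pi e (nf_sym r) j k.
Proof.
case: j => [|l] lN kc.
  by rewrite /= -[RHS]/(ev k _) -det_map_mx -/(mxev k _) mxev_mkmx.
rewrite /= -[RHS]/(ev k _) -det_map_mx -/(mxev k _); congr (\det _).
rewrite /symE mxevD /mxev map_mx1 -/(mxev k _) /E_of; congr (_ + _).
rewrite mxev_avg//; apply: eq_avg_cube => // k' kc'.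
rewrite mxevM mxev_mkmx//; last by apply: contB.
by rewrite nf_AijE// ltnW.
Qed.

End RawRecursion.

Lemma in_C_sym_pi (s : sym) j : (j <= N)%N -> in_C j (sym_pi e s j : rtuple R N -> R[i]).
Proof.
move=> jN; split; first exact: CF_cube_continuous.
move=> k k' kc kc' kk'; case: j jN kk' => [|j] jN kk'.
  by congr (_ _); apply: eq_from_tnth => i; exact: kk'.
rewrite /= -[LHS]/(ev k _) -[RHS]/(ev k' _) -!det_map_mx; congr (\det _).
(* E is its own average, hence independent of the averaged coordinates. *)
apply/matrixP => a b; rewrite -(mxavg_symE he) !mxE /ev.
exact: eavg_tail.
Qed.

End Units.

(** * The group Inv(H), the map pi and the factors F_j *)

Section Symbols.
Context {R : realType} {N M : nat}.
Hypothesis hM : (1 <= M)%N.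
Local Notation cube := (@cube R).
Local Notation CF := (@CF R N).
Local Notation e := (@eavg R N).
Local Notation he := (@averaging_eavg R N).
Local Notation V := (@L2_module R N).
Local Notation op := (L2 R N M -> L2 R N M).
Local Notation sym := (symbol CF M).
Local Notation actN := (act (V := V)).
Local Notation invH := (Inv_op (@alg_H R N M)).

Lemma invH_sym_unit (s : sym) : invH (actN s N) -> sym_unit e s N.
Proof. by case=> _ [U [bU _ UT]]; exact: inv_sym_unit bU UT. Qed.

Lemma sym_unit_invH (s : sym) : sym_unit e s N -> 
  [/\ invH (actN s N), invH (ainv (V := V) (e := e) s N),
      actN s N \o ainv (V := V) (e := e) s N = id &
      ainv (V := V) (e := e) s N \o actN s N = id].
Proof.
move=> us; have [h1 h2] := act_inv he V us.
have E1 : actN s N \o ainv (V := V) (e := e) s N = id by apply/funext => u; exact: h2.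
have E2 : ainv (V := V) (e := e) s N \o actN s N = id by apply/funext => u; exact: h1.
have Hi : alg_H (ainv (V := V) (e := e) s N : op) by exact: alg_H_ainv.
have bi : bounded_op (ainv (V := V) (e := e) s N : op).
  by have [t _ ->] := (alg_HP hM _).1 Hi; exact: act_bounded.
split=> //.
  by split; [exact: alg_H_act|exists (ainv (V := V) (e := e) s N)].
by split; [|exists (actN s N : op); split=> //; exact: act_bounded].
Qed.

Lemma invH_symP T : invH T -> exists s : sym, [/\ pos_dims s, T = actN s N & sym_unit e s N].
Proof.
move=> iT; have [s ps Ts] := (alg_HP hM T).1 iT.1.
by exists s; split=> //; apply: invH_sym_unit; rewrite -Ts.
Qed.

Lemma invH_group : op_group invH.
Proof.
split.
- split; last by exists id; split=> //; exact: bounded_op_id.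
  rewrite (_ : id = actN sym_id N); first exact: alg_H_act.
  by apply/funext => u; rewrite act_id.
- move=> T U [HT [T' [bT TT' T'T]]] [HU [U' [bU UU' U'U]]]; split.
    by apply/(alg_HP hM)/normal_ops_comp; exact/(alg_HP hM).
  exists (U' \o T'); split; first exact: bounded_op_comp.
    by rewrite -[LHS]/(T \o (U \o U') \o T') UU'.
  by rewrite -[LHS]/(U' \o (T' \o T) \o U) T'T.
- move=> T /invH_symP[s [_ -> us]]; exists (ainv (V := V) (e := e) s N).
  by have [] := sym_unit_invH us.
Qed.

(* Any symbol of the operator computes pi; outside Inv(H) the value is junk. *)
Definition op_sym (T : op) : sym :=
  if pselect (exists s : sym, [/\ pos_dims s, T = actN s N & sym_unit e s N]) is left h
  then projT1 (cid h) else sym_id.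

Lemma op_symP T : invH T -> T = actN (op_sym T) N /\ sym_unit e (op_sym T) N.
Proof.
move=> /invH_symP h; rewrite /op_sym; case: pselect => // h'.
by case: cid => s [].
Qed.

Definition op_pi (T : op) j : CF := sym_pi e (op_sym T) j.

Lemma op_pi_act (s : sym) j : (j <= N)%N -> sym_unit e s N ->
  op_pi (actN s N) j = sym_pi e s j.
Proof.
move=> jN us; have [iT _ _ _] := sym_unit_invH us; have [E uT] := op_symP iT.
exact: sym_pi_unique.
Qed.

Lemma op_pi_comp T U j : invH T -> invH U -> (j <= N)%N ->
  op_pi (T \o U) j = op_pi T j * op_pi U j.
Proof.
move=> iT iU jN; have [_ iM _] := invH_group.
have [E uw] := op_symP (iM _ _ iT iU).
have [ET ur] := op_symP iT; have [EU ut] := op_symP iU.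
by apply: sym_pi_comp => // u; rewrite -E -ET -EU.
Qed.

(** A symbol with zero blocks off level j makes the determinants of all other levels equal to det
    1. *)
Lemma F_sym j T : (j <= N)%N -> F_ j T -> exists s : sym,
  [/\ T = actN s N, forall i, i.+1 != j -> sA s i.+1 = 0 & j != 0 -> sA0 s = 1%:M].
Proof.
move=> jN [hT _]; case: j hT jN => [[A cA ->] _|j [m [A [B [_ cA cB ->]]]] jN].
  exists (sym1 (mkmx A) 0 (0 : 'M[CF]_(M, 1)) 0); split=> //.
  by apply/funext => u; rewrite act_sym0 mul_opE.
exists (sym1 1%:M j.+1 (mkmx A) (mkmx B)); split=> //.
  by apply/funext => u; rewrite act_sym1// Lmul1 int_opE.
by move=> i /negbTE /= ->.
Qed.

Lemma F_invH j T : (j <= N)%N -> F_ j T -> invH T.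
Proof.
move=> jN FT; have [s [TE _ _]] := F_sym jN FT; case: FT => _ iT; split=> //.
by rewrite TE; exact: alg_H_act.
Qed.

Lemma F_pi j i T : (j <= N)%N -> (i <= N)%N -> i != j -> F_ j T -> op_pi T i = 1.
Proof.
move=> jN iN ij FT; have iT := F_invH jN FT; have [s [TE sA0 s1]] := F_sym jN FT.
rewrite TE in iT *; rewrite op_pi_act//; last exact: invH_sym_unit.
case: i ij {iN} => [|i] ij; last by apply: sym_pi_trivial; exact: sA0.
by rewrite /= s1 ?det1// eq_sym.
Qed.

End Symbols.

Theorem theorem1p8 (R : realType) (N M : nat) (hN : (1 <= N)%N)
    (hM : (1 <= M)%N) :
  op_group (Inv_op (@alg_H R N M)) /\
  exists ppi : (L2 R N M -> L2 R N M) -> 'I_N.+1 -> rtuple R N -> R[i],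
    [/\ forall T, Inv_op alg_H T ->
          (exists r, represents r T) /\
          (forall r, represents r T ->
             forall (j : 'I_N.+1) k, cube N k -> ppi T j k = nf_pi r j k),
        forall T, Inv_op alg_H T -> in_InvC (ppi T),
        forall T U, Inv_op alg_H T -> Inv_op alg_H U ->
          forall (j : 'I_N.+1) k, cube N k ->
            ppi (T \o U) j k = ppi T j k * ppi U j k &
        forall (j : 'I_N.+1) T, F_ j T ->
          Inv_op alg_H T /\
          forall (i : 'I_N.+1) k, i != j -> cube N k -> ppi T i k = 1].
Proof.
split; first exact: invH_group.
exists (fun T j k => op_pi T j k); split.
- move=> T iT; split; first exact: (normal_opsP T).1 ((alg_HP hM T).1 iT.1).
  move=> r rT j k kc; have TE := represents_act rT.
  (* [nf_sym r] may differ from the symbol chosen in [op_pi]; [op_pi_act] shows that both give the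
     same value. *)
  have us : sym_unit eavg (nf_sym r) N by apply: invH_sym_unit; rewrite -TE.
  have jN := leq_ord j; by rewrite (nf_piE rT us)//= TE op_pi_act.
- move=> T iT j; have jN := leq_ord j; have [_ u] := op_symP hM iT.
  by split; [exact: in_C_sym_pi jN|apply/CF_unitP/u].
- by move=> T U iT iU j k kc; rewrite (op_pi_comp hM iT iU (leq_ord j)).
- move=> j T FT; split; first exact: F_invH hM _ _ (leq_ord j) FT.
  by move=> i k ij kc; rewrite (F_pi hM (leq_ord j) (leq_ord i) ij FT).
Qed.
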